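(* There is a polynomial-time $9$-approximation algorithm for Lottery Priority $\mathcal{F}$-Center when $\mathcal{F}$ is the family of independent sets of a matroid on $X$.
   Context: Lottery Priority $\mathcal{F}$-Center: the input is a finite metric space $(X,d)$ in which each point $v$ has a distance demand $r(v)>0$ and a probability demand $\mathrm{prob}(v)\in[0,1]$, together with a family $\mathcal{F}\subseteq 2^X$ of allowed center sets. A probability distribution over $\mathcal{F}$ is $\alpha$-approximate if for every $v\in X$, $\Pr_{S}[d(v,S)\le\alpha\cdot r(v)]\ge\mathrm{prob}(v)$, where $d(v,S)=\min_{s\in S}d(v,s)$. An $\alpha$-approximation algorithm either correctly asserts that no $1$-approximate distribution exists, or returns an $\alpha$-approximate distribution. *)

(* Defs.v *)
From HB Require Import structures.
From mathcomp Require Import all_boot all_order all_algebra.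
From mathcomp Require Import constructive_ereal reals.
Set Implicit Arguments.
Unset Strict Implicit.
Unset Printing Implicit Defensive.
Import Order.TTheory GRing.Theory Num.Theory.
Local Open Scope ring_scope.

(* The numerical data of an instance are rational so that they can be the
   input of an algorithm. The family of allowed sets is kept separate. *)
Record instance (X : finType) := Instance {
  dist : X -> X -> rat;
  radius : X -> rat;
  prob : X -> rat;
  dist_ge0 : forall x y, 0 <= dist x y;
  dist_eq0 : forall x y, dist x y = 0 <-> x = y;
  dist_sym : forall x y, dist x y = dist y x;
  dist_triangle : forall x y z, dist x z <= dist x y + dist y z;
  radius_gt0 : forall x, 0 < radius x;
  prob_ge0 : forall x, 0 <= prob x;
  prob_le1 : forall x, prob x <= 1 }.

(* The distance to the empty set is +oo. *)
Definition dist_set (X : finType) (I : instance X) (v : X) (S : {set X})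
  : \bar rat := \big[Order.min/+oo%E]_(s in S) (dist I v s)%:E.

Definition lottery (R : realType) (X : finType) (F : {set {set X}})
    (mu : {set X} -> R) : Prop :=
  [/\ forall S, 0 <= mu S,
      forall S, S \notin F -> mu S = 0
    & \sum_(S : {set X}) mu S = 1].

Definition Pr (R : realType) (X : finType) (mu : {set X} -> R)
    (E : pred {set X}) : R := \sum_(S | E S) mu S.

Definition approximate (R : realType) (X : finType) (I : instance X)
    (F : {set {set X}}) (alpha : rat) (mu : {set X} -> R) : Prop :=
  lottery F mu /\
  forall v : X,
    ratr (prob I v)
      <= Pr mu (fun S => (dist_set I v S <= (alpha * radius I v)%:E)%E).

Definition matroid (X : finType) (F : {set {set X}}) : Prop :=
  [/\ set0 \in F,
      forall A B : {set X}, A \subset B -> B \in F -> A \in F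
    & forall A B : {set X}, A \in F -> B \in F -> (#|A| < #|B|)%N ->
        exists2 x, x \in B :\: A & x |: A \in F].

(* Model of computation: while programs on binary trees whose leaves are
   integers, with access to an oracle. A program maps one tree to one tree. *)
Inductive tree := Leaf of int | Node of tree & tree.

(* Bit size; trunc_log 2 m is one less than the binary length of m > 0. *)
Fixpoint tree_size (v : tree) : nat :=
  match v with
  | Leaf z => (trunc_log 2 `|z|%N).+2
  | Node u w => (tree_size u + tree_size w).+1
  end.

Definition truth (v : tree) : bool := if v is Leaf z then z != 0 else true.

Inductive op := Id | Fst | Snd | Plus | Minus | Times | Quo | Leq.

(* Operations applied to a tree of the wrong shape return Leaf 0. *)
Definition op_sem (o : op) (v : tree) : tree :=
  match o, v with
  | Id, _ => v
  | Fst, Node u _ => u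
  | Snd, Node _ w => w
  | Plus, Node (Leaf a) (Leaf b) => Leaf (a + b)
  | Minus, Node (Leaf a) (Leaf b) => Leaf (a - b)
  | Times, Node (Leaf a) (Leaf b) => Leaf (a * b)
  | Quo, Node (Leaf a) (Leaf b) => Leaf (a %/ b)%Z
  | Leq, Node (Leaf a) (Leaf b) => Leaf (nat_of_bool (a <= b))%:Z
  | _, _ => Leaf 0
  end.

Inductive program :=
  | Op of op
  | Const of tree
  | Query
  | Seq of program & program
  | Fork of program & program
  | If of program & program & program
  | While of program & program.

(* exec O p v w t: with oracle O, program p on input v halts with output w
   after time t. Every basic step is charged the bit sizes of its argument and
   result, so the time bounds the size of all intermediate values, and time is
   polynomially related to that of (oracle) Turing machines. *)
Inductive exec (O : tree -> bool) : program -> tree -> tree -> nat -> Prop :=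
  | exec_op o v : exec O (Op o) v (op_sem o v) (tree_size v + tree_size (op_sem o v))
  | exec_const c v : exec O (Const c) v c (tree_size v + tree_size c)
  | exec_query v :
      exec O Query v (Leaf (nat_of_bool (O v))%:Z)
        (tree_size v + tree_size (Leaf (nat_of_bool (O v))%:Z))
  | exec_seq p q v u w t1 t2 :
      exec O p v u t1 -> exec O q u w t2 -> exec O (Seq p q) v w (t1 + t2).+1
  | exec_fork p q v u w t1 t2 :
      exec O p v u t1 -> exec O q v w t2 ->
      exec O (Fork p q) v (Node u w) (t1 + t2).+1
  | exec_if p q r v c w t1 t2 :
      exec O p v c t1 -> exec O (if truth c then q else r) v w t2 ->
      exec O (If p q r) v w (t1 + t2).+1
  | exec_while_end p q v c t :
      exec O p v c t -> truth c = false -> exec O (While p q) v v t.+1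
  | exec_while_step p q v c u w t1 t2 t3 :
      exec O p v c t1 -> truth c = true ->
      exec O q v u t2 -> exec O (While p q) u w t3 ->
      exec O (While p q) v w (t1 + t2 + t3).+1.

Definition tree_of_seq (A : Type) (f : A -> tree) (s : seq A) : tree :=
  foldr (fun a v => Node (f a) v) (Leaf 0) s.

Definition tree_of_ord (n : nat) (i : 'I_n) : tree := Leaf (i : nat)%:Z.

Definition tree_of_rat (x : rat) : tree := Node (Leaf (numq x)) (Leaf (denq x)).

Definition tree_of_fun (n : nat) (A : Type) (enc : A -> tree) (f : 'I_n -> A)
  : tree := tree_of_seq (fun i => enc (f i)) (enum 'I_n).

Definition tree_of_instance (n : nat) (I : instance 'I_n) : tree :=
  Node (Leaf n%:Z)
    (Node (tree_of_fun (tree_of_fun tree_of_rat) (dist I))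
       (Node (tree_of_fun tree_of_rat (radius I))
             (tree_of_fun tree_of_rat (prob I)))).

(* None asserts that no 1-approximate distribution exists; Some l is the
   distribution choosing each listed set with the probability next to it. *)
Definition answer (n : nat) := option (seq (seq 'I_n * rat)).

Definition tree_of_answer (n : nat) (a : answer n) : tree :=
  if a is Some l then
    Node (Leaf 1)
      (tree_of_seq (fun e => Node (tree_of_seq (@tree_of_ord n) e.1)
                                  (tree_of_rat e.2)) l)
  else Leaf 0.

(* A set may be listed several times. *)
Definition lottery_of (R : realType) (n : nat) (l : seq (seq 'I_n * rat))
  : {set 'I_n} -> R := fun S => \sum_(e <- l | [set i in e.1] == S) ratr e.2.

Fixpoint tree_elements (v : tree) : seq tree :=
  if v is Node u w then u :: tree_elements w else [::].

(* Membership oracle of F: a query is the list of elements of a set. *)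
Definition family_oracle (n : nat) (F : {set {set 'I_n}}) (v : tree) : bool :=
  [set i : 'I_n | has (fun u => if u is Leaf z then z == (i : nat)%:Z else false)
                      (tree_elements v)] \in F.

Definition correct_answer (R : realType) (n : nat) (I : instance 'I_n)
    (F : {set {set 'I_n}}) (alpha : rat) (a : answer n) : Prop :=
  if a is Some l then approximate I F alpha (@lottery_of R n l)
  else ~ exists mu : {set 'I_n} -> R, approximate I F 1 mu.

Definition polytime_approximation (R : realType)
    (C : forall n, {set {set 'I_n}} -> Prop) (alpha : rat) (p : program)
  : Prop :=
  exists q : {poly nat}, forall (n : nat) (I : instance 'I_n)
      (F : {set {set 'I_n}}), C n F ->
    exists (a : answer n) (t : nat),
      [/\ exec (family_oracle F) p (tree_of_instance I) (tree_of_answer a) t,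
          (t <= q.[tree_size (tree_of_instance I)])%N
        & @correct_answer R n I F alpha a].

(* Main.v *)
Require Import Defs.
From HB Require Import structures.
From mathcomp Require Import all_boot all_order all_algebra.
From mathcomp Require Import constructive_ereal reals.
From mathcomp Require Import zify lra.
Set Implicit Arguments.
Unset Strict Implicit.
Unset Printing Implicit Defensive.

(** Scale the radii to integers and round them to powers of two. Inside each
class, keep greedily, in order of decreasing probability, the vertices whose
balls are disjoint from the balls of the vertices already kept. A kept vertex is
served either by a point of its ball or by a kept vertex of lower class whose
ball meets its own and which serves at most one other vertex. The injective
choices whose points form a member of F are the transversals of a matroid.
Radii at least double from one class to the next, so a chain of such choices
from a vertex of class c ends at a distance at most r + 4 * 2^c, and a
vertex that was not kept, being close to a kept one of its class, is served
within 9 r.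

A 1-approximate lottery yields an average of independent sets covering every
part with its demand. A push-relabel algorithm over the matroid finds weighted
independent sets that cover the demands exactly, or a union of parts that no
average can cover. The former is only a fractional transversal; it is rewritten
as a combination of transversals by repeatedly subtracting as much as possible
of one lying on the same face of the base polytope, which a Newton iteration
computes exactly. Each subtraction shrinks the support or makes a new
inequality tight, and the latter happens at most |E| + 1 times. *)

Local Open Scope nat_scope.

(** * Programs running in polynomial time *)

(** A centre may serve many vertices at once, whereas a transversal uses each point once; letting
    vertices rely on other vertices reconciles the two. The price fixes the constants. Suppose
    [r + B * 2^c] bounds the distance for class [c]. A hop leads to a kept vertex of lower class,
    whose radius is below [2^c] and is paid twice, so [B = (2 + 2 + B) / 2] and [B = 4]. A vertex
    [u] represented by [v] adds [r(u) + r(v)]; with [r(v) < 2 * 2^c] and [2^c <= r(u)] the factor is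
    [1 + 2 + 2 + 4 = 9].

    The covering step controls only averages: one of its independent sets may meet a block twice and
    miss another, and then a chain can break at a vertex that nothing serves. This is why true
    transversals are required. Weights are kept integral by scaling; the factor of each round of the
    decomposition is 1 or a difference of ranks, so the bit size stays polynomial. *)

Definition oracle := tree -> bool.

(** Pairs and lists are encoded as the input format prescribes, so the tables of [raw_of] encode to
    the input tree itself and the program starts without parsing. *)
Class encodable (A : Type) := encode : A -> tree.
#[export] Hint Mode encodable ! : typeclass_instances.

#[export] Instance encodable_tree : encodable tree := id.
#[export] Instance encodable_nat : encodable nat := fun n => Leaf n%:Z.
#[export] Instance encodable_bool : encodable bool := fun b => Leaf (nat_of_bool b)%:Z.
#[export] Instance encodable_prod (A B : Type) {eA : encodable A} {eB : encodable B} :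
  encodable (A * B) := fun x => Node (encode x.1) (encode x.2).
#[export] Instance encodable_seq (A : Type) {eA : encodable A} : encodable (seq A) :=
  tree_of_seq encode.

Definition esize (A : Type) {eA : encodable A} (x : A) := tree_size (encode x).

Lemma tree_size_ge2 v : 2 <= tree_size v.
Proof. elim: v => [z|u hu w hw] //=; lia. Qed.

Lemma esize_ge2 (A : Type) {eA : encodable A} (x : A) : 2 <= esize x.
Proof. exact: tree_size_ge2. Qed.

Lemma esize_nat (n : nat) : esize n = (trunc_log 2 n).+2.
Proof. by []. Qed.

Lemma esize_bool (b : bool) : esize b = 2.
Proof. by case: b. Qed.

Lemma esize_pair (A B : Type) {eA : encodable A} {eB : encodable B} (x : A * B) :
  esize x = (esize x.1 + esize x.2).+1.
Proof. by []. Qed.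

Lemma esize_fst (A B : Type) {eA : encodable A} {eB : encodable B} (x : A * B) :
  esize x.1 <= esize x.
Proof. by rewrite [leqRHS]esize_pair leqW // leq_addr. Qed.

Lemma esize_snd (A B : Type) {eA : encodable A} {eB : encodable B} (x : A * B) :
  esize x.2 <= esize x.
Proof. by rewrite [leqRHS]esize_pair leqW // leq_addl. Qed.

Lemma esize_nil (A : Type) {eA : encodable A} : esize ([::] : seq A) = 2.
Proof. by []. Qed.

Lemma esize_cons (A : Type) {eA : encodable A} (x : A) s :
  esize (x :: s) = (esize x + esize s).+1.
Proof. by []. Qed.

Lemma esize_seq (A : Type) {eA : encodable A} (s : seq A) :
  esize s = 2 + \sum_(x <- s) (esize x).+1.
Proof.
elim: s => [|x s IH]; first by rewrite big_nil.
rewrite esize_cons big_cons IH; lia.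
Qed.

Lemma esize_cat (A : Type) {eA : encodable A} (s1 s2 : seq A) :
  esize (s1 ++ s2) <= esize s1 + esize s2.
Proof. rewrite !esize_seq big_cat /=; lia. Qed.

Lemma size_le_esize (A : Type) {eA : encodable A} (s : seq A) : size s <= esize s.
Proof. elim: s => [|x s IH] //=; rewrite esize_cons; lia. Qed.

Lemma esize_drop (A : Type) {eA : encodable A} i (s : seq A) : esize (drop i s) <= esize s.
Proof.
elim: s i => [|x s IH] [|i] //=; apply: leq_trans (IH i) _.
by rewrite esize_cons leqW // leq_addl.
Qed.

Lemma esize_nth (A : Type) {eA : encodable A} x0 i (s : seq A) :
  i < size s -> esize (nth x0 s i) <= esize s.
Proof.
elim: s i => [|x s IH] [|i] //= hi; rewrite esize_cons leqW //; first exact: leq_addr.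
by apply: leq_trans (IH i hi) _; rewrite leq_addl.
Qed.

Lemma mem_esize (A : eqType) {eA : encodable A} (s : seq A) x :
  x \in s -> esize x <= esize s.
Proof.
elim: s => [|y s IH] //=; rewrite inE esize_cons => /orP[/eqP->|/IH]; lia.
Qed.

Lemma esize_seq_le (A : eqType) {eA : encodable A} (s : seq A) b :
  (forall x, x \in s -> esize x <= b) -> esize s <= 2 + size s * b.+1.
Proof.
move=> h; rewrite esize_seq leq_add2l.
elim: s h => [|x s IH] h; first by rewrite big_nil.
rewrite big_cons /= mulSn leq_add ?ltnS ?h ?mem_head //.
by apply: IH => y ys; apply: h; rewrite inE ys orbT.
Qed.

Lemma leq_trunc_log2 m n : m <= n -> trunc_log 2 m <= trunc_log 2 n.
Proof. exact: leq_trunc_log. Qed.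

Lemma ltn_trunc_log2 n : n < 2 ^ (trunc_log 2 n).+1.
Proof. exact: trunc_log_ltn. Qed.

Lemma trunc_log2_lt m k : m < 2 ^ k.+1 -> trunc_log 2 m <= k.
Proof.
case: m => [|m] h; first by rewrite trunc_log0.
have := trunc_logP (isT : 1 < 2) (isT : 0 < m.+1).
move=> h1; have := leq_ltn_trans h1 h.
by rewrite ltn_exp2l // ltnS.
Qed.

Lemma trunc_logD m n : trunc_log 2 (m + n) <= (trunc_log 2 m + trunc_log 2 n).+1.
Proof.
apply: trunc_log2_lt.
have h1 := ltn_trunc_log2 m; have h2 := ltn_trunc_log2 n.
have h3 : 2 ^ (trunc_log 2 m).+1 <= 2 ^ (trunc_log 2 m + trunc_log 2 n).+1.
  by rewrite leq_exp2l // ltnS leq_addr.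
have h4 : 2 ^ (trunc_log 2 n).+1 <= 2 ^ (trunc_log 2 m + trunc_log 2 n).+1.
  by rewrite leq_exp2l // ltnS leq_addl.
rewrite (expnS 2 (_.+1)); lia.
Qed.

Lemma trunc_logM m n : trunc_log 2 (m * n) <= (trunc_log 2 m + trunc_log 2 n).+1.
Proof.
apply: trunc_log2_lt.
have h1 := ltn_trunc_log2 m; have h2 := ltn_trunc_log2 n.
have -> : (trunc_log 2 m + trunc_log 2 n).+2 = (trunc_log 2 m).+1 + (trunc_log 2 n).+1 by lia.
by rewrite expnD ltn_mul.
Qed.

Lemma esize_natD (m n : nat) : esize (m + n) <= esize m + esize n.
Proof. rewrite !esize_nat; have := trunc_logD m n; lia. Qed.

Lemma esize_natS (n : nat) : esize n.+1 <= (esize n).+2.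
Proof. by rewrite -addn1 -addn2; apply: esize_natD. Qed.

Lemma esize_natM (m n : nat) : esize (m * n) <= esize m + esize n.
Proof. rewrite !esize_nat; have := trunc_logM m n; lia. Qed.

Lemma esize_nat_le (m n : nat) : m <= n -> esize m <= esize n.
Proof. by move=> h; rewrite !esize_nat !ltnS leq_trunc_log2. Qed.

Lemma esize_nat_id (n : nat) : esize n <= n.+2.
Proof.
rewrite esize_nat !ltnS; apply: trunc_log2_lt.
by apply: leq_trans (ltn_expl n (isT : 1 < 2)) _; rewrite leq_exp2l.
Qed.

(** Every basic step is charged for its argument and its result, so a time bound also bounds input
    and output sizes. Compositions then need no separate size bookkeeping. *)
Lemma exec_time O p v w t : exec O p v w t -> tree_size v <= t /\ tree_size w <= t.
Proof.
elim=> {p v w t}.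
- by move=> o v; rewrite leq_addr leq_addl.
- by move=> c v; rewrite leq_addr leq_addl.
- by move=> v; rewrite leq_addr leq_addl.
- by move=> p q v u w t1 t2 _ [? ?] _ [? ?]; split; lia.
- by move=> p q v u w t1 t2 _ [? ?] _ [? ?] /=; split; lia.
- by move=> p q r v c w t1 t2 _ [? ?] _ [? ?]; split; lia.
- by move=> p q v c t _ [? ?] _; split; lia.
- by move=> p q v c u w t1 t2 t3 _ [? ?] _ _ [? ?] _ [? ?]; split; lia.
Qed.

(** A promise notion: the bound is claimed only on [P], which may mention the oracle, because the
    main loops are shown to terminate only for matroids. Sizes are at least 2, so a pure power
    [esize x ^ k] absorbs constants. *)
Definition ptime (A B : Type) {eA : encodable A} {eB : encodable B}
    (P : oracle -> A -> Prop) (f : oracle -> A -> B) : Prop :=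
  exists p k, forall O x, P O x ->
    exists2 t, exec O p (encode x) (encode (f O x)) t & t <= esize x ^ k.

Lemma pow_bound2 s a b : 2 <= s -> s ^ a + s ^ b + 1 <= s ^ (a + b + 2).
Proof.
move=> s2; have s0 : 0 < s by lia.
have h1 : s ^ a <= s ^ (a + b) by rewrite leq_pexp2l // leq_addr.
have h2 : s ^ b <= s ^ (a + b) by rewrite leq_pexp2l // leq_addl.
have h3 : 0 < s ^ (a + b) by rewrite expn_gt0 s0.
have h4 : 2 ^ 2 <= s ^ 2 by rewrite leq_exp2r.
rewrite -[2 ^ 2]/4 in h4.
have h5 : s ^ (a + b) * 4 <= s ^ (a + b + 2) by rewrite (expnD _ (a + b) 2) leq_mul2l h4 orbT.
lia.
Qed.

Lemma pow_step s a b t1 t2 : 2 <= s -> t1 <= s ^ a -> t2 <= s ^ b ->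
  (t1 + t2).+1 <= s ^ (a + b + 2).
Proof.
by move=> s2 h1 h2; apply: leq_trans (pow_bound2 a b s2); rewrite addn1 ltnS leq_add.
Qed.

Section PolyBound.
Variables (X : Type) (P : X -> Prop) (s : X -> nat).
Hypothesis s_ge2 : forall x, 2 <= s x.

Definition pbound (f : X -> nat) := exists k, forall x, P x -> f x <= s x ^ k.

Lemma pbound_le f g : (forall x, P x -> f x <= g x) -> pbound g -> pbound f.
Proof. by move=> h [k hk]; exists k => x Px; apply: leq_trans (h _ Px) (hk _ Px). Qed.

Lemma pbound_id : pbound s.
Proof. by exists 1 => x _; rewrite expn1. Qed.

Lemma pbound_const c : pbound (fun=> c).
Proof.
exists c => x _; apply: leq_trans (ltnW (ltn_expl c (isT : 1 < 2))) _.
by case: c => // c; rewrite leq_exp2r.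
Qed.

Lemma pboundD f g : pbound f -> pbound g -> pbound (fun x => f x + g x).
Proof.
move=> [a ha] [b hb]; exists (a + b + 2) => x Px.
have := pow_bound2 a b (s_ge2 x); have := ha _ Px; have := hb _ Px; lia.
Qed.

Lemma pboundM f g : pbound f -> pbound g -> pbound (fun x => f x * g x).
Proof.
move=> [a ha] [b hb]; exists (a + b) => x Px.
by rewrite expnD leq_mul ?ha ?hb.
Qed.

Lemma pboundS f : pbound f -> pbound (fun x => (f x).+1).
Proof.
move=> h; apply: pbound_le (pboundD h (pbound_const 1)) => x _; lia.
Qed.

Lemma pboundX f k : pbound f -> pbound (fun x => f x ^ k).
Proof.
move=> h; elim: k => [|k IH]; first exact: pbound_const 1.
by apply: pbound_le (pboundM h IH) => x _; rewrite expnS.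
Qed.

Lemma pbound_s f : (forall x, P x -> f x <= s x) -> pbound f.
Proof. by move/pbound_le; apply; apply: pbound_id. Qed.
End PolyBound.

Definition esz (A : Type) {eA : encodable A} (y : oracle * A) := esize y.2.
Definition on (A : Type) (P : oracle -> A -> Prop) (y : oracle * A) := P y.1 y.2.

Section Basic.
Context (A : Type) {eA : encodable A}.
Implicit Types P : oracle -> A -> Prop.

Lemma ptime_sub (B : Type) {eB : encodable B} P Q (f : oracle -> A -> B) :
  (forall O x, P O x -> Q O x) -> ptime Q f -> ptime P f.
Proof. by move=> h [p [k H]]; exists p, k => O x /h /H. Qed.

Lemma ptime_ext (B : Type) {eB : encodable B} P (f g : oracle -> A -> B) :
  (forall O x, P O x -> f O x = g O x) -> ptime P f -> ptime P g.
Proof. by move=> h [p [k H]]; exists p, k => O x Px; rewrite -h //; apply: H. Qed.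

Lemma ptime_esize (B : Type) {eB : encodable B} P (f : oracle -> A -> B) :
  ptime P f -> pbound (on P) (esz (eA:=eA)) (fun y => esize (f y.1 y.2)).
Proof.
move=> [p [k H]]; exists k => -[O x] /= /H[t /exec_time[_ h] ht].
exact: leq_trans h ht.
Qed.

Lemma ptime_id P : ptime P (fun _ x => x).
Proof.
exists (Op Id), 2 => O x _; exists (esize x + esize x); first exact: (@exec_op O Id).
by rewrite expnS expn1 addnn -mul2n leq_mul2r esize_ge2 orbT.
Qed.

Lemma ptime_const (B : Type) {eB : encodable B} P (b : B) : ptime P (fun _ _ => b).
Proof.
have [k hk] := pboundD (@esize_ge2 _ eA) (pbound_id (fun=> True) (@esize _ eA))
  (pbound_const (fun=> True) (@esize_ge2 _ eA) (esize b)).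
exists (Const (encode b)), k => O x _; exists (esize x + esize b); first exact: exec_const.
exact: hk.
Qed.

Lemma ptime_comp (B C : Type) {eB : encodable B} {eC : encodable C} P
    (Q : oracle -> B -> Prop) (f : oracle -> A -> B) (g : oracle -> B -> C) :
  ptime P f -> ptime Q g -> (forall O x, P O x -> Q O (f O x)) ->
  ptime P (fun O x => g O (f O x)).
Proof.
move=> [p [a ha]] [q [b hb]] PQ; exists (Seq p q), (a + a * b + 2) => O x Px.
have [t1 e1 h1] := ha _ _ Px; have [t2 e2 h2] := hb _ _ (PQ _ _ Px).
exists (t1 + t2).+1; first exact: exec_seq e1 e2.
have [_ h3] := exec_time e1.
have h4 : t2 <= esize x ^ (a * b).
  apply: leq_trans h2 _; case: (b) => [|b']; first by rewrite muln0.
  rewrite expnM leq_exp2r //; exact: leq_trans h3 h1.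
exact: pow_step (esize_ge2 x) _ _.
Qed.

Lemma ptime_pair (B C : Type) {eB : encodable B} {eC : encodable C} P
    (f : oracle -> A -> B) (g : oracle -> A -> C) :
  ptime P f -> ptime P g -> ptime P (fun O x => (f O x, g O x)).
Proof.
move=> [p [a ha]] [q [b hb]]; exists (Fork p q), (a + b + 2) => O x Px.
have [t1 e1 h1] := ha _ _ Px; have [t2 e2 h2] := hb _ _ Px.
exists (t1 + t2).+1; first exact: exec_fork e1 e2.
exact: pow_step (esize_ge2 x) _ _.
Qed.

Lemma ptime_if (B : Type) {eB : encodable B} P (b : oracle -> A -> bool)
    (f g : oracle -> A -> B) :
  ptime P b -> ptime (fun O x => P O x /\ b O x) f ->
  ptime (fun O x => P O x /\ ~~ b O x) g ->
  ptime P (fun O x => if b O x then f O x else g O x).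
Proof.
move=> [p [a ha]] [q [k hk]] [r [l hl]]; exists (If p q r), (a + (k + l) + 2) => O x Px.
have [t1 e1 h1] := ha _ _ Px.
have s0 : 0 < esize x by rewrite (leq_trans _ (esize_ge2 x)).
have tr : truth (encode (b O x)) = b O x by case: (b O x).
case E: (b O x).
  have [t2 e2 h2] : exists2 t, exec O q (encode x) (encode (f O x)) t & t <= esize x ^ k.
    by apply: hk; rewrite E.
  exists (t1 + t2).+1; first by apply: exec_if e1 _; rewrite tr E.
  by apply: (pow_step (esize_ge2 x)) => //; apply: leq_trans h2 _; rewrite leq_pexp2l // leq_addr.
have [t2 e2 h2] : exists2 t, exec O r (encode x) (encode (g O x)) t & t <= esize x ^ l.
  by apply: hl; rewrite E.
exists (t1 + t2).+1; first by apply: exec_if e1 _; rewrite tr E.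
by apply: (pow_step (esize_ge2 x)) => //; apply: leq_trans h2 _; rewrite leq_pexp2l // leq_addl.
Qed.

Lemma ptime_if' (B : Type) {eB : encodable B} P (b : oracle -> A -> bool)
    (f g : oracle -> A -> B) :
  ptime P b -> ptime P f -> ptime P g ->
  ptime P (fun O x => if b O x then f O x else g O x).
Proof.
by move=> hb hf hg; apply: ptime_if => //; [apply: ptime_sub hf|apply: ptime_sub hg] => O x [].
Qed.

Lemma ptime_op (B C : Type) {eB : encodable B} {eC : encodable C} P o
    (f : oracle -> A -> B) (g : oracle -> A -> C) :
  ptime P f ->
  (forall O x, P O x -> op_sem o (encode (f O x)) = encode (g O x)) ->
  (forall O x, P O x -> esize (g O x) <= esize (f O x)) ->
  ptime P g.
Proof.
move=> hf ho hs.
apply: (ptime_ext (f := fun O x => op_sem o (encode (f O x)))) => [O x Px|].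
  exact: ho.
have [p [a ha]] := hf.
exists (Seq p (Op o)), (a + a.+1 + 2) => O x Px; have [t1 e1 h1] := ha _ _ Px.
exists (t1 + (esize (f O x) + tree_size (op_sem o (encode (f O x))))).+1.
  by apply: exec_seq e1 _; apply: exec_op.
have [_ h3] := exec_time e1.
have := hs _ _ Px; rewrite /esize -ho // => h4.
apply: (pow_step (esize_ge2 x)) => //; rewrite expnS; apply: (@leq_trans (2 * esize x ^ a)).
  by rewrite mul2n -addnn leq_add //; [apply: leq_trans h1|apply: leq_trans h4 (leq_trans h3 h1)].
by rewrite leq_mul2r esize_ge2 orbT.
Qed.
End Basic.

Section Pairs.
Context (A : Type) {eA : encodable A} (P : oracle -> A -> Prop).
Context (B : Type) {eB : encodable B} (C : Type) {eC : encodable C}.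

Lemma ptime_fst (f : oracle -> A -> B * C) : ptime P f -> ptime P (fun O x => (f O x).1).
Proof.
move=> hf; apply: (ptime_op (o := Fst) hf) => // O x _.
by rewrite [leqRHS]esize_pair; lia.
Qed.

Lemma ptime_snd (f : oracle -> A -> B * C) : ptime P f -> ptime P (fun O x => (f O x).2).
Proof.
move=> hf; apply: (ptime_op (o := Snd) hf) => // O x _.
by rewrite [leqRHS]esize_pair; lia.
Qed.

Lemma ptime_encode (f : oracle -> A -> B) : ptime P f -> ptime P (fun O x => encode (f O x)).
Proof. by []. Qed.
End Pairs.

Section Arith.
Context (A : Type) {eA : encodable A} (P : oracle -> A -> Prop).
Implicit Types f g : oracle -> A -> nat.

Lemma ptime_add f g : ptime P f -> ptime P g -> ptime P (fun O x => f O x + g O x).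
Proof.
move=> hf hg; apply: (ptime_op (o := Plus) (ptime_pair hf hg)) => // O x _.
by rewrite esize_pair; apply: leq_trans (esize_natD _ _) _.
Qed.

Lemma ptime_mul f g : ptime P f -> ptime P g -> ptime P (fun O x => f O x * g O x).
Proof.
move=> hf hg; apply: (ptime_op (o := Times) (ptime_pair hf hg)) => // O x _.
by rewrite esize_pair; apply: leq_trans (esize_natM _ _) _.
Qed.

Lemma ptime_leq f g : ptime P f -> ptime P g -> ptime P (fun O x => f O x <= g O x).
Proof.
move=> hf hg; apply: (ptime_op (o := Leq) (ptime_pair hf hg)) => // O x _.
by rewrite esize_pair esize_bool (leq_trans (esize_ge2 (f O x))) //= leqW // leq_addr.
Qed.

Lemma ptime_div f g : ptime P f -> ptime P g -> ptime P (fun O x => f O x %/ g O x).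
Proof.
move=> hf hg; apply: (ptime_op (o := Quo) (ptime_pair hf hg)) => // O x _.
  by rewrite /= divz_nat.
rewrite esize_pair /=; have := esize_nat_le (leq_div (f O x) (g O x)); lia.
Qed.

Lemma ptime_sub' f g : ptime P f -> ptime P g -> ptime P (fun O x => f O x - g O x).
Proof.
move=> hf hg.
(* [Minus] subtracts integers, so the truncated case is split off by a test. *)
apply: (ptime_ext (f := fun O x => if g O x <= f O x then f O x - g O x else 0)).
  by move=> O x _; case: leqP => // /ltnW; rewrite -subn_eq0 => /eqP ->.
apply: ptime_if; [exact: ptime_leq| |exact: ptime_const].
apply: (ptime_op (o := Minus) (ptime_pair (ptime_sub _ hf) (ptime_sub _ hg))) => O x [] //.
  by move=> _ h; rewrite /= subzn.
move=> _ h; rewrite esize_pair /=; have := esize_nat_le (leq_subr (g O x) (f O x)); lia.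
Qed.

Lemma ptime_S f : ptime P f -> ptime P (fun O x => (f O x).+1).
Proof.
move=> hf; apply: (ptime_ext (f := fun O x => f O x + 1)) => [O x _|]; first exact: addn1.
by apply: ptime_add => //; apply: ptime_const.
Qed.

Implicit Types b c : oracle -> A -> bool.
Lemma ptime_andb b c : ptime P b -> ptime P c -> ptime P (fun O x => b O x && c O x).
Proof. by move=> hb hc; apply: ptime_if' => //; apply: ptime_const. Qed.

Lemma ptime_orb b c : ptime P b -> ptime P c -> ptime P (fun O x => b O x || c O x).
Proof. by move=> hb hc; apply: ptime_if' => //; apply: ptime_const. Qed.

Lemma ptime_negb b : ptime P b -> ptime P (fun O x => ~~ b O x).
Proof. by move=> hb; apply: ptime_if' => //; apply: ptime_const. Qed.

Lemma ptime_eqn f g : ptime P f -> ptime P g -> ptime P (fun O x => f O x == g O x).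
Proof.
move=> hf hg; apply: (ptime_ext (f := fun O x => (f O x <= g O x) && (g O x <= f O x))).
  by move=> O x _; rewrite eqn_leq.
by apply: ptime_andb; apply: ptime_leq.
Qed.

Lemma ptime_minn f g : ptime P f -> ptime P g -> ptime P (fun O x => minn (f O x) (g O x)).
Proof. by move=> hf hg; apply: ptime_if' => //; apply: ptime_leq => //; apply: ptime_S. Qed.

Lemma ptime_maxn f g : ptime P f -> ptime P g -> ptime P (fun O x => maxn (f O x) (g O x)).
Proof. by move=> hf hg; apply: ptime_if' => //; apply: ptime_leq => //; apply: ptime_S. Qed.

Lemma ptime_query (f : oracle -> A -> tree) : ptime P f -> ptime P (fun O x => O (f O x)).
Proof.
move=> hf; apply: (ptime_comp (Q := fun _ _ => True) (g := fun O v => O v) hf) => //.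
exists Query, 2 => O v _; eexists; first exact: exec_query.
rewrite expnS expn1 /=; have : 2 <= esize v by exact: esize_ge2.
rewrite /esize /encode /encodable_tree /=; case: (O v) => /=; rewrite ?trunc_log1 ?trunc_log0; nia.
Qed.
End Arith.

Section Lists.
Context (A : Type) {eA : encodable A} (P : oracle -> A -> Prop).
Context (B : Type) {eB : encodable B} (C : Type) {eC : encodable C}.

Lemma ptime_cons (f : oracle -> A -> B) (l : oracle -> A -> seq B) :
  ptime P f -> ptime P l -> ptime P (fun O x => f O x :: l O x).
Proof. by move=> hf hl; apply: (ptime_op (o := Id) (ptime_pair hf hl)). Qed.

(** An encoded list is its own truth value, since only the empty one is [Leaf 0], and a nonempty one
    is encoded as the pair of its head and tail. The code that computes [l] thus serves both as the
    test and to supply the branch. *)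
Lemma ptime_case Q (l : oracle -> A -> seq B) (d : oracle -> A -> C)
    (g : oracle -> A * (B * seq B) -> C) :
  ptime P l -> ptime P d -> ptime Q g ->
  (forall O x b s, P O x -> l O x = b :: s -> Q O (x, (b, s))) ->
  ptime P (fun O x => if l O x is b :: s then g O (x, (b, s)) else d O x).
Proof.
move=> [p [a ha]] hd hg hQ; have hl := ha.
have [q [k hk]] : ptime (fun O x => P O x /\ l O x <> [::])
    (fun O x => if l O x is b :: s then g O (x, (b, s)) else d O x).
  have h1 : ptime (fun O x => P O x /\ l O x <> [::]) (fun O x => (x, encode (l O x))).
    by apply: ptime_pair; [exact: ptime_id|exists p, a => O x [/ha]].
  have [q [k hk]] := hg; have [r [m hm]] := h1.
  exists (Seq r q), (m + m * k + 2) => O x [Px]; case E: (l O x) => [|b s] // _.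
  have [t1 e1 h1'] : exists2 t, exec O r (encode x) (encode (x, encode (l O x))) t & t <= esize x ^ m.
    by apply: hm; rewrite E.
  have [t2 e2 h2] := hk _ _ (hQ _ _ _ _ Px E).
  have e12 : encode (x, encode (l O x)) = encode (x, (b, s)) by rewrite E.
  rewrite e12 in e1.
  exists (t1 + t2).+1; first exact: exec_seq e1 e2.
  have [_ h3] := exec_time e1.
  have h4 : t2 <= esize x ^ (m * k).
    apply: leq_trans h2 _; case: (k) => [|b']; first by rewrite muln0.
    by rewrite expnM leq_exp2r //; exact: leq_trans h3 h1'.
  exact: pow_step (esize_ge2 x) _ _.
have [r [m hm]] := hd.
exists (If p q r), (a + (k + m) + 2) => O x Px.
have [t1 e1 h1] := ha _ _ Px.
have s0 : 0 < esize x by rewrite (leq_trans _ (esize_ge2 x)).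
case E: (l O x) => [|b s].
  have [t2 e2 h2] := hm _ _ Px.
  exists (t1 + t2).+1; first by apply: exec_if e1 _; rewrite E.
  by apply: (pow_step (esize_ge2 x)) => //; apply: leq_trans h2 _; rewrite leq_pexp2l // leq_addl.
have [t2 e2 h2] : exists2 t, exec O q (encode x)
    (encode (if l O x is b :: s then g O (x, (b, s)) else d O x)) t & t <= esize x ^ k.
  by apply: hk; rewrite E.
rewrite E in e2; exists (t1 + t2).+1; first by apply: exec_if e1 _; rewrite E.
by apply: (pow_step (esize_ge2 x)) => //; apply: leq_trans h2 _; rewrite leq_pexp2l // leq_addr.
Qed.
End Lists.

(** Iteration with fuel. When the fuel is at least a measure that decreases in each round, it does
    not run out before the guard fails, and the result is that of [While]. *)
Fixpoint loop (A : Type) (n : nat) (c : A -> bool) (f : A -> A) (x : A) : A :=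
  if n is n'.+1 then if c x then loop n' c f (f x) else x else x.

Lemma loopP (A : Type) (c : A -> bool) (f : A -> A) (Inv : A -> Prop) (mu : A -> nat) n x :
  (forall y, Inv y -> c y -> Inv (f y) /\ mu (f y) < mu y) ->
  Inv x -> mu x <= n -> Inv (loop n c f x) /\ c (loop n c f x) = false.
Proof.
move=> h; elim: n x => [|n IH] x Ix hn /=.
  by split=> //; apply/negP => /(h _ Ix)[_]; lia.
case E: (c x) => //; have [I' m'] := h _ Ix E; apply: IH => //; lia.
Qed.

Lemma exec_loop (A : Type) {eA : encodable A} O p q T (c : A -> bool) (f : A -> A)
    (Inv : A -> Prop) (mu : A -> nat) n x :
  (forall y, Inv y -> c y -> Inv (f y) /\ mu (f y) < mu y) ->
  (forall y, Inv y -> exists2 t, exec O p (encode y) (encode (c y)) t & t <= T) ->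
  (forall y, Inv y -> c y -> exists2 t, exec O q (encode y) (encode (f y)) t & t <= T) ->
  Inv x -> mu x <= n ->
  exists2 t, exec O (While p q) (encode x) (encode (loop n c f x)) t & t <= n.+1 * (T + T).+1.
Proof.
move=> h hp hq; elim: n x => [|n IH] x Ix hn /=.
  have [t e ht] := hp _ Ix; exists t.+1; last lia.
  apply: exec_while_end e _.
  case E: (c x) => //.
  by have [_] := h _ Ix E; lia.
have [t e ht] := hp _ Ix; case E: (c x).
  have [I' m'] := h _ Ix E; have [t2 e2 ht2] := hq _ Ix E.
  have [|t3 e3 ht3] := IH _ I'; first lia.
  exists (t + t2 + t3).+1; last by rewrite mulSn; lia.
  by apply: exec_while_step e _ e2 e3; rewrite E.
exists t.+1; last nia.
by apply: exec_while_end e _; rewrite E.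
Qed.

(** The last hypothesis bounds every reachable state by the initial one. Polynomial steps alone
    would not do: a state whose size doubles in each round grows exponentially. [Inv O x] refers to
    the initial state [x] for this purpose. *)
Lemma ptime_loop (A : Type) {eA : encodable A} (P Q : oracle -> A -> Prop)
    (Inv : oracle -> A -> A -> Prop) (c : oracle -> A -> bool) (f : oracle -> A -> A)
    (mu : oracle -> A -> nat) (n : oracle -> A -> nat) :
  ptime Q c -> ptime (fun O y => Q O y /\ c O y) f ->
  (forall O x, P O x -> Inv O x x) ->
  (forall O x y, P O x -> Inv O x y -> Q O y) ->
  (forall O x y, P O x -> Inv O x y -> c O y -> Inv O x (f O y) /\ mu O (f O y) < mu O y) ->
  (forall O x, P O x -> mu O x <= n O x) ->
  pbound (on P) (esz (eA:=eA)) (fun y => n y.1 y.2) ->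
  (exists k, forall O x y, P O x -> Inv O x y -> esize y <= esize x ^ k) ->
  ptime P (fun O x => loop (n O x) (c O) (f O) x).
Proof.
move=> [p [a ha]] [q [b hb]] h1 h2 h3 h4 hn [k hk].
have [l hl] : pbound (on P) (esz (eA:=eA)) (fun y => (n y.1 y.2).+1 *
    (esize y.2 ^ (k * a + k * b) + esize y.2 ^ (k * a + k * b)).+1).
  have s2 : forall y, 2 <= esz (eA:=eA) y by move=> y; apply: esize_ge2.
  apply: pboundM; first exact: pboundS.
  apply: pboundS => //; apply: pboundD => //; apply: pboundX => //; exact: pbound_id.
exists (While p q), l => O x Px.
have s0 : 0 < esize x by rewrite (leq_trans _ (esize_ge2 x)).
have bnd y e : Inv O x y -> esize y ^ e <= esize x ^ (k * e).
  move=> Iy; case: e => [|e]; first by rewrite muln0.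
  by rewrite expnM leq_exp2r ?(hk O x y).
have [|||t e ht] := @exec_loop _ eA O p q (esize x ^ (k * a + k * b)) (c O) (f O) (Inv O x) (mu O)
    (n O x) x (fun y => h3 O x y Px) _ _ (h1 _ _ Px).
- move=> y Iy; have [t e ht] := ha _ _ (h2 _ _ _ Px Iy).
  exists t => //; apply: leq_trans ht _; apply: leq_trans (bnd _ _ Iy) _.
  by rewrite leq_pexp2l // leq_addr.
- move=> y Iy cy; have [t e ht] := hb _ _ (conj (h2 _ _ _ Px Iy) cy).
  exists t => //; apply: leq_trans ht _; apply: leq_trans (bnd _ _ Iy) _.
  by rewrite leq_pexp2l // leq_addl.
- exact: h4.
by exists t => //; apply: leq_trans ht (hl (O, x) Px).
Qed.

(** * Polynomial-time list operations *)

(** Destructuring as an ordinary function, so that [ptime_step] can match on it. *)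
Definition casel (B C : Type) (l : seq B) (d : C) (g : B -> seq B -> C) : C :=
  if l is b :: s then g b s else d.

Definition total (A : Type) : oracle -> A -> Prop := fun _ _ => True.
Arguments total {A} O x /.

Section Casel.
Context (A : Type) {eA : encodable A} (P : oracle -> A -> Prop).
Context (B : Type) {eB : encodable B} (C : Type) {eC : encodable C}.

Lemma ptime_casel (l : oracle -> A -> seq B) (d : oracle -> A -> C)
    (g : oracle -> A -> B -> seq B -> C) :
  ptime P l -> ptime P d ->
  ptime (fun O (y : A * (B * seq B)) => P O y.1) (fun O y => g O y.1 y.2.1 y.2.2) ->
  ptime P (fun O x => casel (l O x) (d O x) (g O x)).
Proof.
move=> hl hd hg; apply: (ptime_case (l := l) (d := d)
  (g := fun O y => g O y.1 y.2.1 y.2.2) hl hd hg).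
by move=> O x b s Px _.
Qed.

End Casel.

Section Folds.
Context (A : Type) {eA : encodable A} (P : oracle -> A -> Prop).
Context (B : Type) {eB : encodable B} (C : Type) {eC : encodable C}.

Let S : Type := (A * (C * seq B))%type.
Variables (h : oracle -> A -> C -> B -> C) (c0 : oracle -> A -> C) (l : oracle -> A -> seq B).

Let body O (y : S) : S :=
  casel y.2.2 y (fun b s => (y.1, (h O y.1 y.2.1 b, s))).
Let cond (y : S) : bool := casel y.2.2 false (fun _ _ => true).

Lemma loop_foldl O x c s n : size s <= n ->
  loop n cond (body O) (x, (c, s)) = (x, (foldl (h O x) c s, [::])).
Proof.
elim: n c s => [|n IH] c [|b s] //= hs.
by rewrite {1}/cond /= IH.
Qed.

(** The growth condition is additive in the accumulator: an entry may enlarge it only by a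
    polynomial in the input and that entry, so the total stays polynomial. A multiplicative
    condition would allow exponential growth. *)
Lemma ptime_foldl :
  ptime total (fun O (y : (A * C) * B) => h O y.1.1 y.1.2 y.2) ->
  ptime P c0 -> ptime P l ->
  (exists k, forall O x c b, esize (h O x c b) <= esize c + esize (x, b) ^ k) ->
  ptime P (fun O x => foldl (h O x) (c0 O x) (l O x)).
Proof.
move=> hh hc hl [k hk].
pose P' O (y : S) := P O y.1 /\ y.2 = (c0 O y.1, l O y.1).
have hL : ptime P' (fun O y => loop (size y.2.2) cond (body O) y).
  apply: (ptime_loop (Q := total) (mu := fun _ y => size y.2.2)
    (Inv := fun O x y => exists i, i <= size (l O x.1) /\
      y = (x.1, (foldl (h O x.1) (c0 O x.1) (take i (l O x.1)), drop i (l O x.1))))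
    (c := fun _ y => cond y)) => //.
  - rewrite /cond; apply: (ptime_casel (l := fun _ y => y.2.2) (d := fun _ _ => false)
      (g := fun _ _ _ _ => true)); try exact: ptime_const.
    exact/ptime_snd/ptime_snd/ptime_id.
  - rewrite /body; apply: (ptime_casel (l := fun _ y => y.2.2) (d := fun _ y => y)
      (g := fun O y b s => (y.1, (h O y.1 y.2.1 b, s)))).
    + exact/ptime_snd/ptime_snd/ptime_id.
    + exact/ptime_id.
    + apply: ptime_pair; first exact/ptime_fst/ptime_fst/ptime_id.
      apply: ptime_pair; last exact/ptime_snd/ptime_snd/ptime_id.
      apply: (ptime_comp (f := fun _ (y : S * (B * seq B)) => ((y.1.1, y.1.2.1), y.2.1)) _ hh) => //.
      do 2?apply: ptime_pair.
      * exact/ptime_fst/ptime_fst/ptime_id.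
      * exact/ptime_fst/ptime_snd/ptime_fst/ptime_id.
      * exact/ptime_fst/ptime_snd/ptime_id.
  - move=> O [x y] [/= Px ->]; exists 0; by rewrite take0 drop0.
  - move=> O [x y] _ [/= Px _] [i [hi ->]]; rewrite /cond /body /=.
    case: (ltnP i (size (l O x))) => hi'; last by rewrite drop_oversize.
    have [b _] : {b : B | true} by case: (l O x) hi' => // b; exists b.
    rewrite (drop_nth b) //=; split=> //; exists i.+1; split=> //.
    by rewrite (take_nth b) // foldl_rcons.
  - apply: pbound_s => -[O y] _; rewrite /esz /= [leqRHS]esize_pair esize_pair.
    pose proof (size_le_esize y.2.2); lia.
  have [m hm] : pbound (on P') (esz (A := S))
      (fun y => esz y + size y.2.2.2 * esz y ^ k).
    have s2 : forall y, 2 <= esz (A := S) y by move=> y; apply: esize_ge2.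
    apply: pboundD => //; first exact: pbound_id.
    apply: pboundM; last by apply: pboundX => //; apply: pbound_id.
    apply: pbound_s => -[O y] _; rewrite /esz /= [leqRHS]esize_pair esize_pair.
    pose proof (size_le_esize y.2.2); lia.
  exists m => O x y Px [i [hi ->]]; apply: leq_trans (hm (O, x) Px).
  rewrite /esz /=; set s := esize x.
  case: Px => _ Ex.
  have hx : s = (esize x.1 + (esize (c0 O x.1) + esize (l O x.1)).+1).+1.
    by rewrite /s !esize_pair Ex.
  pose proof (esize_drop i (l O x.1)) as hd.
  have hf j : j <= size (l O x.1) -> esize (foldl (h O x.1) (c0 O x.1) (take j (l O x.1)))
      <= esize (c0 O x.1) + j * s ^ k.
    elim: j => [|j IH] hj; first by rewrite take0 addn0.
    have [b _] : {b : B | true} by case: (l O x.1) hj => // b; exists b.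
    rewrite (take_nth b) // foldl_rcons.
    apply: leq_trans (hk _ _ _ _) _.
    have h1 : esize (x.1, nth b (l O x.1) j) ^ k <= s ^ k.
      case: (k) => // k'; rewrite leq_exp2r // esize_pair /=.
      by rewrite hx ltnS leq_add2l leqW // (leq_trans (esize_nth b hj)) // leq_addl.
    have := IH (ltnW hj); rewrite mulSn; lia.
  have hfi := hf i hi; have hi2 : i * s ^ k <= size x.2.2 * s ^ k.
    by rewrite Ex /= leq_mul2r hi orbT.
  rewrite !esize_pair /=; lia.
apply: (ptime_ext (f := fun O x => (loop (size (l O x)) cond (body O) (x, (c0 O x, l O x))).2.1)).
  by move=> O x _; rewrite loop_foldl.
apply/ptime_fst/ptime_snd.
apply: (ptime_comp (f := fun O x => (x, (c0 O x, l O x))) _ hL) => //.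
do 2?apply: ptime_pair => //; exact: ptime_id.
Qed.
End Folds.

Section ListOps.
Context (A : Type) {eA : encodable A} (P : oracle -> A -> Prop).
Context (B : Type) {eB : encodable B} (C : Type) {eC : encodable C}.

Lemma ptime_esize_total (D E : Type) {eD : encodable D} {eE : encodable E}
    (f : oracle -> D -> E) :
  ptime total f -> exists k, forall O x, (esize (f O x)).+1 <= esize x ^ k.
Proof.
move/ptime_esize => [k hk]; exists k.+1 => O x.
apply: leq_ltn_trans (hk (O, x) I) _; rewrite /esz /=.
by rewrite ltn_exp2l // esize_ge2.
Qed.

Lemma ptime_rev (l : oracle -> A -> seq B) : ptime P l -> ptime P (fun O x => rev (l O x)).
Proof.
move=> hl; apply: (ptime_ext (f := fun O x => foldl (fun s b => b :: s) [::] (l O x))).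
  by move=> O x _; rewrite /rev; elim: (l O x) [::] => //= b s IH c; rewrite IH.
apply: (ptime_foldl (h := fun _ _ s b => b :: s)) => //.
- by apply: ptime_cons; [exact/ptime_snd/ptime_id|exact/ptime_snd/ptime_fst/ptime_id].
- exact: ptime_const.
- by exists 1 => O x c b; rewrite esize_cons expn1 esize_pair /=; lia.
Qed.

Lemma ptime_map (h : oracle -> A -> B -> C) (l : oracle -> A -> seq B) :
  ptime total (fun O (y : A * B) => h O y.1 y.2) -> ptime P l ->
  ptime P (fun O x => map (h O x) (l O x)).
Proof.
move=> hh hl.
apply: (ptime_ext (f := fun O x => foldl (fun s b => h O x b :: s) [::] (rev (l O x)))).
  by move=> O x _; rewrite foldl_rev.
apply: (ptime_foldl (h := fun O x s b => h O x b :: s)) => //.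
- apply: ptime_cons; last exact/ptime_snd/ptime_fst/ptime_id.
  apply: (ptime_comp (f := fun _ (y : A * seq C * B) => (y.1.1, y.2)) _ hh) => //.
  by apply: ptime_pair; [exact/ptime_fst/ptime_fst/ptime_id|exact/ptime_snd/ptime_id].
- exact: ptime_const.
- exact: ptime_rev.
- have [k hk] := ptime_esize_total hh.
  exists k => O x c b; rewrite esize_cons; have := hk O (x, b); rewrite /=; lia.
Qed.

Lemma ptime_filter (h : oracle -> A -> B -> bool) (l : oracle -> A -> seq B) :
  ptime total (fun O (y : A * B) => h O y.1 y.2) -> ptime P l ->
  ptime P (fun O x => filter (h O x) (l O x)).
Proof.
move=> hh hl.
apply: (ptime_ext (f := fun O x =>
  foldl (fun s b => if h O x b then b :: s else s) [::] (rev (l O x)))).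
  by move=> O x _; rewrite foldl_rev; elim: (l O x) => //= b s ->.
apply: (ptime_foldl (h := fun O x s b => if h O x b then b :: s else s)) => //.
- apply: ptime_if'.
  + apply: (ptime_comp (f := fun _ (y : A * seq B * B) => (y.1.1, y.2)) _ hh) => //.
    by apply: ptime_pair; [exact/ptime_fst/ptime_fst/ptime_id|exact/ptime_snd/ptime_id].
  + by apply: ptime_cons; [exact/ptime_snd/ptime_id|exact/ptime_snd/ptime_fst/ptime_id].
  + exact/ptime_snd/ptime_fst/ptime_id.
- exact: ptime_const.
- exact: ptime_rev.
- exists 1 => O x c b; rewrite expn1 esize_pair /=.
  by case: ifP => _; rewrite ?esize_cons; lia.
Qed.

Lemma ptime_has (h : oracle -> A -> B -> bool) (l : oracle -> A -> seq B) :
  ptime total (fun O (y : A * B) => h O y.1 y.2) -> ptime P l ->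
  ptime P (fun O x => has (h O x) (l O x)).
Proof.
move=> hh hl.
apply: (ptime_ext (f := fun O x => casel (filter (h O x) (l O x)) false (fun _ _ => true))).
  by move=> O x _; elim: (l O x) => //= b s <-; case: (h O x b).
by apply: ptime_casel; try exact: ptime_const; apply: ptime_filter.
Qed.

Lemma ptime_all (h : oracle -> A -> B -> bool) (l : oracle -> A -> seq B) :
  ptime total (fun O (y : A * B) => h O y.1 y.2) -> ptime P l ->
  ptime P (fun O x => all (h O x) (l O x)).
Proof.
move=> hh hl.
apply: (ptime_ext (f := fun O x => ~~ has (fun b => ~~ h O x b) (l O x))).
  by move=> O x _; rewrite -all_predC; apply: eq_all => b /=; rewrite negbK.
by apply/ptime_negb/(ptime_has (h := fun O x b => ~~ h O x b)) => //; apply: ptime_negb.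
Qed.

Lemma ptime_cat (l1 l2 : oracle -> A -> seq B) :
  ptime P l1 -> ptime P l2 -> ptime P (fun O x => l1 O x ++ l2 O x).
Proof.
move=> h1 h2.
apply: (ptime_ext (f := fun O x => foldl (fun s b => b :: s) (l2 O x) (rev (l1 O x)))).
  by move=> O x _; rewrite foldl_rev; elim: (l1 O x) => //= b s ->.
apply: (ptime_foldl (h := fun _ _ s b => b :: s)) => //.
- by apply: ptime_cons; [exact/ptime_snd/ptime_id|exact/ptime_snd/ptime_fst/ptime_id].
- exact: ptime_rev.
- by exists 1 => O x c b; rewrite esize_cons expn1 esize_pair /=; lia.
Qed.

Lemma ptime_size (l : oracle -> A -> seq B) : ptime P l -> ptime P (fun O x => size (l O x)).
Proof.
move=> hl; apply: (ptime_ext (f := fun O x => foldl (fun s _ => s.+1) 0 (l O x))).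
  move=> O x _; rewrite -[RHS]add0n; elim: (l O x) 0 => //= [n|_ s IH n]; first by rewrite addn0.
  by rewrite IH addSnnS.
apply: (ptime_foldl (h := fun _ _ s _ => s.+1)) => //.
- exact/ptime_S/ptime_snd/ptime_fst/ptime_id.
- exact: ptime_const.
- exists 1 => O x c b; rewrite expn1 esize_pair /= -addn1.
  apply: leq_trans (esize_natD _ _) _; rewrite leq_add2l [esize 1]esize_nat.
  by pose proof (esize_ge2 x); pose proof (esize_ge2 b); rewrite /= trunc_log1; lia.
Qed.

Lemma ptime_nth (b0 : B) (l : oracle -> A -> seq B) (i : oracle -> A -> nat) :
  ptime P l -> ptime P i -> ptime P (fun O x => nth b0 (l O x) (i O x)).
Proof.
move=> hl hi.
apply: (ptime_ext (f := fun O x =>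
  (foldl (fun s b => (s.1.+1, if s.1 == i O x then b else s.2)) (0, b0) (l O x)).2)).
  move=> O x _; set f := fun _ _ => _.
  have H n c s : (foldl f (n, c) s).2 = if n <= i O x then nth c s (i O x - n) else c.
    elim: s n c => [|b s IH] n c; first by rewrite nth_nil if_same.
    rewrite [foldl _ _ _]/= /f -/f /= IH; case: ltngtP => h.
    - by have -> : i O x - n = (i O x - n.+1).+1 by lia.
    - by [].
    - by rewrite h subnn.
  by rewrite H subn0.
pose g (O : oracle) (y : A * nat) (s : nat * B) (b : B) := (s.1.+1, if s.1 == y.2 then b else s.2).
have hg : ptime total (fun O (y : (A * nat) * seq B) => foldl (g O y.1) (0, b0) y.2).
  apply: (ptime_foldl (h := fun O (y : (A * nat) * seq B) => g O y.1)).
  - apply: ptime_pair; first exact/ptime_S/ptime_fst/ptime_snd/ptime_fst/ptime_id.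
    apply: ptime_if'; last 2 first.
    + exact/ptime_snd/ptime_id.
    + exact/ptime_snd/ptime_snd/ptime_fst/ptime_id.
    apply: ptime_eqn; first exact/ptime_fst/ptime_snd/ptime_fst/ptime_id.
    exact/ptime_snd/ptime_fst/ptime_fst/ptime_fst/ptime_id.
  - exact: ptime_const.
  - exact/ptime_snd/ptime_id.
  - exists 1 => O x c b; rewrite expn1 !esize_pair /=.
    pose proof (esize_natS c.1).
    pose proof (esize_ge2 x.1.1); pose proof (esize_ge2 x.1.2).
    by case: ifP => _; lia.
apply: ptime_snd.
apply: (ptime_comp (f := fun O x => ((x, i O x), l O x)) _ hg) => //.
by do 2?apply: ptime_pair => //; exact: ptime_id.
Qed.

End ListOps.

Lemma ptime_eqnn (A : Type) {eA : encodable A} (P : oracle -> A -> Prop)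
    (f g : oracle -> A -> nat * nat) :
  ptime P f -> ptime P g -> ptime P (fun O x => f O x == g O x).
Proof.
move=> hf hg.
apply: (ptime_ext (f := fun O x => ((f O x).1 == (g O x).1) && ((f O x).2 == (g O x).2))).
  by move=> O x _; rewrite -pair_eqE.
by apply: ptime_andb; apply: ptime_eqn; (apply: ptime_fst || apply: ptime_snd).
Qed.

Section ListOps2.
Context (A : Type) {eA : encodable A} (P : oracle -> A -> Prop).
Context (B : Type) {eB : encodable B}.

Lemma ptime_flatten (l : oracle -> A -> seq (seq B)) :
  ptime P l -> ptime P (fun O x => flatten (l O x)).
Proof.
move=> hl; apply: (ptime_ext (f := fun O x => foldl (fun s b => b ++ s) [::] (rev (l O x)))).
  by move=> O x _; rewrite foldl_rev.
apply: (ptime_foldl (h := fun _ _ s b => b ++ s)) => //.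
- by apply: ptime_cat; [exact/ptime_snd/ptime_id|exact/ptime_snd/ptime_fst/ptime_id].
- exact: ptime_const.
- exact: ptime_rev.
- exists 1 => O x c b; rewrite expn1 esize_pair /=; pose proof (esize_cat b c); lia.
Qed.

Lemma ptime_sumn (l : oracle -> A -> seq nat) : ptime P l -> ptime P (fun O x => sumn (l O x)).
Proof.
move=> hl; apply: (ptime_ext (f := fun O x => foldl (fun s b => b + s) 0 (rev (l O x)))).
  by move=> O x _; rewrite foldl_rev.
apply: (ptime_foldl (h := fun _ _ s b => b + s)) => //.
- by apply: ptime_add; [exact/ptime_snd/ptime_id|exact/ptime_snd/ptime_fst/ptime_id].
- exact: ptime_const.
- exact: ptime_rev.
- exists 1 => O x c b; rewrite expn1 esize_pair /=; pose proof (esize_natD b c); lia.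
Qed.

Lemma ptime_foldr_mul (l : oracle -> A -> seq nat) :
  ptime P l -> ptime P (fun O x => foldr muln 1 (l O x)).
Proof.
move=> hl; apply: (ptime_ext (f := fun O x => foldl (fun s b => b * s) 1 (rev (l O x)))).
  by move=> O x _; rewrite foldl_rev.
apply: (ptime_foldl (h := fun _ _ s b => b * s)) => //.
- by apply: ptime_mul; [exact/ptime_snd/ptime_id|exact/ptime_snd/ptime_fst/ptime_id].
- exact: ptime_const.
- exact: ptime_rev.
- exists 1 => O x c b; rewrite expn1 esize_pair /=; pose proof (esize_natM b c); lia.
Qed.

Lemma ptime_foldr_max (l : oracle -> A -> seq nat) :
  ptime P l -> ptime P (fun O x => foldr maxn 0 (l O x)).
Proof.
move=> hl; apply: (ptime_ext (f := fun O x => foldl (fun s b => maxn b s) 0 (rev (l O x)))).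
  by move=> O x _; rewrite foldl_rev.
apply: (ptime_foldl (h := fun _ _ s b => maxn b s)) => //.
- by apply: ptime_maxn; [exact/ptime_snd/ptime_id|exact/ptime_snd/ptime_fst/ptime_id].
- exact: ptime_const.
- exact: ptime_rev.
- exists 1 => O x c b; rewrite expn1 esize_pair /=.
  by rewrite /maxn; case: ifP => _; lia.
Qed.

Lemma ptime_foldr_min (d : oracle -> A -> nat) (l : oracle -> A -> seq nat) :
  ptime P d -> ptime P l -> ptime P (fun O x => foldr minn (d O x) (l O x)).
Proof.
move=> hd hl.
apply: (ptime_ext (f := fun O x => foldl (fun s b => minn b s) (d O x) (rev (l O x)))).
  by move=> O x _; rewrite foldl_rev.
apply: (ptime_foldl (h := fun _ _ s b => minn b s)) => //.
- by apply: ptime_minn; [exact/ptime_snd/ptime_id|exact/ptime_snd/ptime_fst/ptime_id].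
- exact: ptime_rev.
- exists 1 => O x c b; rewrite expn1 esize_pair /=.
  by rewrite /minn; case: ifP => _; lia.
Qed.

Lemma ptime_memn (f : oracle -> A -> nat) (l : oracle -> A -> seq nat) :
  ptime P f -> ptime P l -> ptime P (fun O x => f O x \in l O x).
Proof.
move=> hf hl; pose g := fun (y : nat * seq nat) => has (fun z => z == y.1) y.2.
apply: (ptime_comp (f := fun O x => (f O x, l O x)) (Q := total)
  (g := fun O (y : nat * seq nat) => y.1 \in y.2)) => //; first exact: ptime_pair.
apply: (ptime_ext (f := fun _ y => g y)) => [O y _|]; first exact: has_pred1.
apply: (ptime_has (h := fun _ (y : nat * seq nat) z => z == y.1)); last exact/ptime_snd/ptime_id.
by apply: ptime_eqn; [exact/ptime_snd/ptime_id|exact/ptime_fst/ptime_fst/ptime_id].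
Qed.

Lemma ptime_memnn (f : oracle -> A -> nat * nat) (l : oracle -> A -> seq (nat * nat)) :
  ptime P f -> ptime P l -> ptime P (fun O x => f O x \in l O x).
Proof.
move=> hf hl; pose g := fun (y : (nat * nat) * seq (nat * nat)) => has (fun z => z == y.1) y.2.
apply: (ptime_comp (f := fun O x => (f O x, l O x)) (Q := total)
  (g := fun O (y : (nat * nat) * seq (nat * nat)) => y.1 \in y.2)) => //; first exact: ptime_pair.
apply: (ptime_ext (f := fun _ y => g y)) => [O y _|]; first exact: has_pred1.
apply: (ptime_has (h := fun _ (y : (nat * nat) * seq (nat * nat)) z => z == y.1));
  last exact/ptime_snd/ptime_id.
by apply: ptime_eqnn; [exact/ptime_snd/ptime_id|exact/ptime_fst/ptime_fst/ptime_id].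
Qed.
End ListOps2.

(** A hook, redefined whenever further operations have been shown to be polynomial. *)
Ltac ptime_user := fail.

(** Dispatches on the head symbol of the function body. What matches no pattern is tried as a user
    operation, then as a constant independent of the input, then as a conditional. *)
Ltac ptime_step :=
  cbv beta;
  lazymatch goal with
  | |- ptime _ (fun O x => x) => apply ptime_id
  | |- ptime _ (fun O x => (@?f O x, @?g O x)) => apply (ptime_pair (f := f) (g := g))
  | |- ptime _ (fun O x => fst (@?f O x)) => apply (ptime_fst (f := f))
  | |- ptime _ (fun O x => snd (@?f O x)) => apply (ptime_snd (f := f))
  | |- ptime _ (fun O x => addn (@?f O x) (@?g O x)) => apply (ptime_add (f := f) (g := g))
  | |- ptime _ (fun O x => muln (@?f O x) (@?g O x)) => apply (ptime_mul (f := f) (g := g))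
  | |- ptime _ (fun O x => subn (@?f O x) (@?g O x)) => apply (ptime_sub' (f := f) (g := g))
  | |- ptime _ (fun O x => divn (@?f O x) (@?g O x)) => apply (ptime_div (f := f) (g := g))
  | |- ptime _ (fun O x => S (@?f O x)) => apply (ptime_S (f := f))
  | |- ptime _ (fun O x => minn (@?f O x) (@?g O x)) => apply (ptime_minn (f := f) (g := g))
  | |- ptime _ (fun O x => maxn (@?f O x) (@?g O x)) => apply (ptime_maxn (f := f) (g := g))
  | |- ptime _ (fun O x => leq (@?f O x) (@?g O x)) => apply (ptime_leq (f := f) (g := g))
  | |- ptime _ (fun O x => andb (@?f O x) (@?g O x)) => apply (ptime_andb (b := f) (c := g))
  | |- ptime _ (fun O x => orb (@?f O x) (@?g O x)) => apply (ptime_orb (b := f) (c := g))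
  | |- ptime _ (fun O x => negb (@?f O x)) => apply (ptime_negb (b := f))
  | |- ptime _ (fun O x => @cons _ (@?f O x) (@?l O x)) => apply (ptime_cons (f := f) (l := l))
  | |- ptime _ (fun O x => casel (@?l O x) (@?d O x) (@?g O x)) =>
      apply (ptime_casel (l := l) (d := d) (g := g))
  | |- ptime _ (fun O x => cat (@?l O x) (@?g O x)) => apply (ptime_cat (l1 := l) (l2 := g))
  | |- ptime _ (fun O x => map (@?h O x) (@?l O x)) => apply (ptime_map (h := h) (l := l))
  | |- ptime _ (fun O x => filter (@?h O x) (@?l O x)) => apply (ptime_filter (h := h) (l := l))
  | |- ptime _ (fun O x => has (@?h O x) (@?l O x)) => apply (ptime_has (h := h) (l := l))
  | |- ptime _ (fun O x => all (@?h O x) (@?l O x)) => apply (ptime_all (h := h) (l := l))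
  | |- ptime _ (fun O x => size (@?l O x)) => apply (ptime_size (l := l))
  | |- ptime _ (fun O x => sumn (@?l O x)) => apply (ptime_sumn (l := l))
  | |- ptime _ (fun O x => flatten (@?l O x)) => apply (ptime_flatten (l := l))
  | |- ptime _ (fun O x => rev (@?l O x)) => apply (ptime_rev (l := l))
  | |- ptime _ (fun O x => nth ?b0 (@?l O x) (@?i O x)) => apply (ptime_nth (l := l) (i := i) b0)
  | |- ptime _ (fun O x => foldr muln 1 (@?l O x)) => apply (ptime_foldr_mul (l := l))
  | |- ptime _ (fun O x => foldr maxn 0 (@?l O x)) => apply (ptime_foldr_max (l := l))
  | |- ptime _ (fun O x => foldr minn (@?d O x) (@?l O x)) =>
      apply (ptime_foldr_min (d := d) (l := l))
  | |- ptime _ (fun O x => @eq_op _ (@?f O x) (@?g O x)) =>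
      first [apply (ptime_eqn (f := f) (g := g)) | apply (ptime_eqnn (f := f) (g := g))]
  | |- ptime _ (fun O x => in_mem (@?f O x) (mem (@?l O x))) =>
      first [apply (ptime_memn (f := f) (l := l)) | apply (ptime_memnn (f := f) (l := l))]
  | |- ptime _ (fun O x => encode (@?f O x)) => apply (ptime_encode (f := f))
  | |- ptime _ (fun O x => O (@?f O x)) => apply (ptime_query (f := f))
  | _ => first [ptime_user | simple apply ptime_const | apply ptime_if']
  end.

Ltac pt := repeat ptime_step.

(** * Matroids on lists *)

Lemma size_filter_neq (T : eqType) (s : seq T) f :
  uniq s -> f \in s -> (size [seq g <- s | g != f]).+1 = size s.
Proof.
move=> us fs; rewrite -[filter _ _]/(filter (predC1 f) s) -rem_filter // size_rem //.
by case: s fs {us}.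
Qed.

Section ListMatroid.
Variables (T : eqType) (E : seq T).

Record list_matroid (ind : pred (seq T)) : Prop := ListMatroid {
  lm_nil : ind [::];
  lm_sub : forall s t, ind s -> {subset t <= s} -> uniq t -> ind t;
  lm_exch : forall s t, uniq s -> uniq t -> {subset s <= E} -> {subset t <= E} ->
    ind s -> ind t -> size s < size t -> exists x, [/\ x \in t, x \notin s & ind (x :: s)] }.

Variable ind : pred (seq T).
Hypothesis indM : list_matroid ind.

Definition indep (s : seq T) := [/\ uniq s, {subset s <= E} & ind s].

Lemma indep_cons x s : x \in E -> x \notin s -> ind (x :: s) -> indep s -> indep (x :: s).
Proof.
move=> xE xs ixs [us sE _]; split=> //=; first by rewrite xs.
by move=> y; rewrite inE => /orP[/eqP->|/sE].
Qed.

Lemma indep_sub s t : indep s -> {subset t <= s} -> uniq t -> indep t.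
Proof.
move=> [us sE is_] ts ut; split=> //; first by move=> x /ts /sE.
exact: lm_sub is_ ts ut.
Qed.

Lemma indep_filter p s : indep s -> indep (filter p s).
Proof.
move=> h; apply: (indep_sub h); first by move=> x; rewrite mem_filter => /andP[].
by case: h => us _ _; rewrite filter_uniq.
Qed.

Lemma indep_exch s t : indep s -> indep t -> size s < size t ->
  exists x, [/\ x \in t, x \notin s & indep (x :: s)].
Proof.
move=> hs ht st; case: (hs) (ht) => us sE is_ [ut tE it].
have [x [xt xs ixs]] := lm_exch indM us ut sE tE is_ it st.
by exists x; split=> //; apply: indep_cons => //; apply: tE.
Qed.

Lemma indep_extend s t : indep s -> indep t -> size s <= size t ->
  exists u, [/\ {subset u <= t}, indep (u ++ s) & size (u ++ s) = size t].
Proof.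
move=> hs ht; move En: (size t - size s) => n; elim: n s hs En => [|n IH] s hs En st.
  by exists [::]; split=> //=; lia.
have [|x [xt xs hxs]] := indep_exch hs ht; first lia.
have [||u [ut hu su]] := IH _ hxs; [by rewrite /=; lia|by rewrite /=; lia|].
exists (rcons u x); rewrite cat_rcons; split=> //.
by move=> y; rewrite mem_rcons inE => /orP[/eqP->|/ut].
Qed.

(* Every ground element of level l > 0 is spanned by the members of s of level at least l - 1. *)
Definition valid (lev : T -> nat) (s : seq T) := forall e, e \in E -> e \notin s -> 0 < lev e ->
  ~~ ind (e :: [seq f <- s | (lev e).-1 <= lev f]).

Lemma valid_add lev s e : indep s -> valid lev s -> valid lev (e :: s).
Proof.
move=> [us _ _] hv g gE; rewrite inE negb_or => /andP[ge gs] lg.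
apply: contra (hv g gE gs lg) => h; apply: (lm_sub indM h).
  move=> y; rewrite !inE => /orP[->//|]; rewrite mem_filter => /andP[h1 h2].
  by rewrite mem_filter h1 inE h2 !orbT.
by rewrite /= filter_uniq // mem_filter (negPf gs) andbF.
Qed.

(** The set [t] extends inside [e :: s] to an independent set of size [size s], which misses a
    member [f] of [s]; members of level at least [lev e] lie in [t], so [f] is lower. Validity gives
    [size t <= size s]: otherwise all of [s] would have level at least [lev e] and yet not span
    [e]. *)
Lemma swap_exists lev s e : indep s -> valid lev s -> e \in E -> e \notin s -> 0 < lev e ->
  ind (e :: [seq f <- s | lev e <= lev f]) ->
  exists f, [/\ f \in s, lev f < lev e & ind (e :: [seq g <- s | g != f])].
Proof.
move=> hs hv eE es le h0; case: (hs) => us sE is_.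
pose t := e :: [seq f <- s | lev e <= lev f].
have ht : indep t.
  by apply: indep_cons => //; [rewrite mem_filter (negPf es) andbF|apply: indep_filter].
have st : size t <= size s.
  rewrite /t /= size_filter -(count_predC (fun f => lev e <= lev f) s) -addn1 leq_add2l.
  rewrite -has_count; apply/negPn/negP => /hasPn hh.
  have := hv e eE es le; apply/negP; rewrite negbK.
  apply: (lm_sub indM h0); last by rewrite /= filter_uniq // mem_filter (negPf es) andbF.
  move=> y; rewrite !inE !mem_filter => /orP[->//|/andP[_ ys]].
  by have := hh y ys; rewrite /= negbK => ->; rewrite ys orbT.
have [u [us' hu su]] := indep_extend ht hs st.
have [f fs fu] : exists2 f, f \in s & f \notin u ++ t.
  apply/hasP; rewrite -[has _ _]negbK -all_predC; apply/negP => /allP hall.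
  case: (hu) => uu _ _.
  have : size (e :: s) <= size (u ++ t).
    apply: uniq_leq_size; first by rewrite /= es.
    move=> y; rewrite inE => /orP[/eqP->|/hall]; last by rewrite /= negbK.
    by rewrite mem_cat inE eqxx orbT.
  rewrite su /=; lia.
exists f; move: fu; rewrite mem_cat inE mem_filter fs andbT !negb_or -ltnNge => /and3P[fu fe lf].
split=> //; have := @uniq_leq_size _ (u ++ t) (e :: [seq g <- s | g != f]).
case: (hu) => uu uE iu.
have hsub : {subset u ++ t <= e :: [seq g <- s | g != f]}.
  move=> y; rewrite mem_cat /t !inE !mem_filter => /or3P[yu|->//|/andP[ly ys]].
    by rewrite (us' _ yu) andbT orbC; case: eqVneq yu fu => [->->|].
  by rewrite ys andbT orbC; case: eqVneq ly lf => [->|//]; rewrite leqNgt => /negP.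
have hsz : size (e :: [seq g <- s | g != f]) = size (u ++ t).
  by rewrite su /= size_filter_neq.
move=> _; have [h1 h2] := uniq_min_size uu hsub (eq_leq hsz).
apply: (lm_sub indM iu); first by move=> y; rewrite h2.
by rewrite /= filter_uniq // mem_filter (negPf es) andbF.
Qed.

(** By validity the members of level at least [lev e - 1] span [e], so an independent result cannot
    contain all of them: the removed [f] is one. *)
Lemma swap_level lev s e f : indep s -> valid lev s -> e \in E -> e \notin s ->
  f \in s -> lev f < lev e -> ind (e :: [seq g <- s | g != f]) -> lev f = (lev e).-1.
Proof.
move=> hs hv eE es fs lf hi; case: (hs) => us sE is_.
have le : 0 < lev e by lia.
apply/eqP; rewrite eqn_leq -ltnS prednK // lf /= leqNgt; apply/negP => lf2.
have := hv e eE es le; apply/negP; rewrite negbK; apply: (lm_sub indM hi).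
  move=> y; rewrite !inE => /orP[->//|]; rewrite !mem_filter => /andP[h1 ->].
  by rewrite andbT orbC; case: eqVneq h1 lf2 => [->|//] h; rewrite ltnNge h.
by rewrite /= filter_uniq // mem_filter (negPf es) andbF.
Qed.

(** For [g] above [e] the relevant members lose nothing by the swap. Otherwise, if [g] were not
    spanned, then [g], [e] and the old members other than [f] of level at least [lev g - 1] would be
    independent and one more than these old members including [f]; exchange would add [g] or [e] to
    the latter, against validity of [s]. *)
Lemma valid_swap lev s e f : indep s -> valid lev s -> e \in E -> e \notin s ->
  f \in s -> lev f < lev e -> ind (e :: [seq g <- s | g != f]) ->
  valid lev (e :: [seq g <- s | g != f]).
Proof.
move=> hs hv eE es fs lf hi g gE gs lg.
have lfE := swap_level hs hv eE es fs lf hi.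
case: (hs) => us sE is_.
have le : 0 < lev e by lia.
have ge : g != e by apply: contraNneq gs => ->; rewrite mem_head.
have gsf : g \in s -> g = f.
  by move: gs; rewrite inE (negPf ge) mem_filter /= negb_and negbK => /orP[/eqP->//|/negPf->].
have hv' k (h : T) : h \in E -> h \notin s -> 0 < lev h -> k <= (lev h).-1 ->
    ind (h :: [seq y <- s | k <= lev y]) -> False.
  move=> hE hns lh kh hh; have := hv h hE hns lh; apply/negP; rewrite negbK.
  apply: (lm_sub indM hh).
    move=> y; rewrite !inE => /orP[->//|]; rewrite !mem_filter => /andP[h1 ->].
    by rewrite (leq_trans kh h1) orbT.
  by rewrite /= filter_uniq // mem_filter (negPf hns) andbF.
apply/negP => hY.
case: (leqP (lev g) (lev e)) => hle; last first.
  have gns : g \notin s by apply/negP => /gsf gf; rewrite gf in hle; lia.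
  apply: (hv' (lev g).-1 g gE gns lg (leqnn _)); apply: (lm_sub indM hY).
    move=> y; rewrite !inE => /orP[->//|]; rewrite !mem_filter => /andP[h1 h2].
    rewrite inE mem_filter h2 andbT h1 /=; case: (eqVneq y f) => [yf|]; last by rewrite !orbT.
    by move: h1 hle lfE le; rewrite yf; clear; lia.
  by rewrite /= filter_uniq // mem_filter (negPf gns) andbF.
set l := (lev g).-1 in hY *.
pose X := [seq y <- s | l <= lev y].
pose Y := g :: e :: [seq y <- X | y != f].
have lf' : l <= lev f by lia.
have fX : f \in X by rewrite mem_filter lf' fs.
have uY : uniq Y.
  rewrite /Y /= !inE (negPf ge) /= !mem_filter (negPf es) !andbF /= !filter_uniq ?andbT //.
  by apply/negP => /and3P[gf _ /gsf]; apply/eqP.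
have hX : indep X by apply: indep_filter.
have hYi : indep Y.
  split=> //.
    move=> y; rewrite /Y !inE !mem_filter => /or3P[/eqP->//|/eqP->//|/and3P[_ _ /sE//]].
  apply: (lm_sub indM hY) => //.
  move=> y; rewrite /Y !inE !mem_filter => /or3P[->//|/eqP->|/and3P[h1 h2 h3]].
    by rewrite (leq_trans lf' (ltnW lf)) mem_head orbT.
  by rewrite h2 inE mem_filter h1 h3 !orbT.
have sXY : size X < size Y.
  have uX : uniq X by rewrite filter_uniq.
  by rewrite /Y /= (size_filter_neq uX fX) ltnSn.
have [y [yY yX hyX]] := indep_exch hX hYi sXY.
move: yY; rewrite /Y !inE => /or3P[/eqP yg|/eqP ye|].
- rewrite yg in yX hyX; case: hyX => _ _ hyX.
  have gns : g \notin s by apply: contra yX => /gsf ->.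
  exact: (hv' l g gE gns lg (leqnn _) hyX).
- rewrite ye in hyX; case: hyX => _ _ hyX.
  have hl : l <= (lev e).-1 by rewrite /l -!subn1 leq_sub2r.
  exact: hv' l e eE es le hl hyX.
- by rewrite mem_filter => /andP[_ hy]; rewrite hy in yX.
Qed.

(** An element above [g] is spanned by members of level at least [g], and these lie above [g] since
    no level equals [g]. So the members of [s] above the gap span everything above it. *)
Lemma gap_span lev s g x : indep s -> valid lev s -> (forall e, e \in E -> lev e != g) ->
  indep x -> count (fun e => g < lev e) x <= count (fun e => g < lev e) s.
Proof.
move=> hs hv hg hx; rewrite -!size_filter leqNgt; apply/negP => hlt.
have [e [ex es he]] := indep_exch (indep_filter _ hs) (indep_filter _ hx) hlt.
case: he => _ eE hi.
have eE' : e \in E by apply: eE; rewrite mem_head.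
move: ex es; rewrite !mem_filter => /andP[le _]; rewrite le /= => es.
have := hv e eE' es (leq_ltn_trans (leq0n _) le).
apply/negP; rewrite negbK; apply: (lm_sub indM hi).
  move=> y; rewrite !inE !mem_filter => /orP[->//|/andP[h1 h2]].
  rewrite h2 andbT; case: (hs) => us sE _; have := hg y (sE _ h2).
  have -> : g < lev y = (g <= lev y) && (lev y != g) by rewrite ltn_neqAle andbC eq_sym.
  by move=> ->; rewrite andbT (leq_trans _ h1) ?orbT //; lia.
by case: (hs) => us _ _; rewrite /= filter_uniq // mem_filter (negPf es) andbF.
Qed.
End ListMatroid.

(** * Covering by weighted independent sets: push-relabel *)

(* A record (Q, (d, l)) is a part Q with deficit d and level l; a class (S, w)
   stands for w copies of the set S. *)
Notation record T := (seq T * (nat * nat))%type (only parsing).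
Notation class T := (seq T * nat)%type (only parsing).

Section RadoDefs.
Variable T : eqType.

(** The parts are disjoint, so the sum has at most one term: the level of the part of [f], and 0
    outside the parts. *)
Definition lev (recs : seq (record T)) (f : T) := sumn [seq r.2.2 | r <- recs & f \in r.1].
Definition cov (cls : seq (class T)) (Q : seq T) :=
  sumn [seq c.2 * size [seq x <- c.1 | x \in Q] | c <- cls].
(** A part that reaches level [k], the number of parts, is given up: some level below [k] must then
    be empty, and this gap yields the obstruction. *)
Definition active k (r : record T) := (0 < r.2.1) && (r.2.2 < k).
Definition top k (recs : seq (record T)) := foldr maxn 0 [seq r.2.2 | r <- recs & active k r].

Variable ind : seq T -> bool.

(** For a valid [S] this says that [e] can enter at the expense of at most one member, of level
    below [h]; see [swap_exists]. *)
Definition good (recs : seq (record T)) h (S : seq T) e :=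
  (e \notin S) && ind (e :: [seq f <- S | h <= lev recs f]).
Definition outgoing (recs : seq (record T)) h (S : seq T) e : seq T :=
  casel [seq f <- S | (lev recs f < h) && ind (e :: [seq g <- S | g != f])] [::]
    (fun f _ => [:: f]).

(** Only [w] copies of the class change, so it splits unless [w] uses it up. The part that loses the
    element [out] takes over the deficit [w]. *)
Definition push (r0 : record T) (others : seq (record T)) (c : class T) (cothers : seq (class T))
    e (out : seq T) w : seq (record T) * seq (class T) :=
  ((r0.1, (r0.2.1 - w, r0.2.2)) ::
     [seq if has (fun f => f \in r.1) out then (r.1, (r.2.1 + w, r.2.2)) else r | r <- others],
   (e :: [seq f <- c.1 | f \notin out], w) ::
     (if c.2 <= w then cothers else (c.1, c.2 - w) :: cothers)).

Definition relabel (r0 : record T) (others : seq (record T)) : seq (record T) :=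
  (r0.1, (r0.2.1, r0.2.2.+1)) :: others.

Definition rado_at (recs : seq (record T)) (cls : seq (class T)) (r0 : record T) (others : seq (record T)) :=
  casel [seq c <- cls | has (good recs r0.2.2 c.1) r0.1] (relabel r0 others, cls)
    (fun c crest =>
       casel [seq e <- r0.1 | good recs r0.2.2 c.1 e] (recs, cls)
         (fun e _ => push r0 others c
            (crest ++ [seq c <- cls | ~~ has (good recs r0.2.2 c.1) r0.1]) e
            (outgoing recs r0.2.2 c.1 e) (minn r0.2.1 c.2))).

Definition at_top (recs : seq (record T)) (r : record T) :=
  active (size recs) r && (r.2.2 == top (size recs) recs).

Definition rado_step (st : seq (record T) * seq (class T)) :=
  casel [seq r <- st.1 | at_top st.1 r] st
    (fun r0 rest => rado_at st.1 st.2 r0 (rest ++ [seq r <- st.1 | ~~ at_top st.1 r])).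

Definition rado_cond (st : seq (record T) * seq (class T)) := has (active (size st.1)) st.1.

Definition rado_init (ps : seq (seq T * nat)) D : seq (record T) * seq (class T) :=
  ([seq (p.1, (p.2, 0)) | p <- ps], if 0 < D then [:: ([::], D)] else [::]).

(** A push from the top active level moves deficit to a part one level below, which is counted
    already. The count therefore does not grow, and it drops when the deficit of the pushing part is
    exhausted. *)
Definition heads (recs : seq (record T)) :=
  count (fun r => (r.2.2 < top (size recs) recs) ||
    ((r.2.2 == top (size recs) recs) && active (size recs) r)) recs.
(** A push raises this potential of the moved class by exactly one: [e] replaces a member one level
    lower, or enters at level 0. *)
Definition phi (recs : seq (record T)) (S : seq T) := sumn [seq (lev recs e).+1 | e <- S].

(* Lexicographic: relabellings, then pushes that exhaust a deficit, then pushes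
   that move a whole class. *)
Definition cap k n := (n * k.+1).+1.
Definition rado_measure n (st : seq (record T) * seq (class T)) :=
  ((cap (size st.1) n).+1 * size st.1).+1 * sumn [seq size st.1 - r.2.2 | r <- st.1] +
  (cap (size st.1) n).+1 * heads st.1 +
  sumn [seq cap (size st.1) n - phi st.1 c.1 | c <- st.2].

Lemma sumn_perm (s t : seq nat) : perm_eq s t -> sumn s = sumn t.
Proof. by move=> h; rewrite !sumnE; apply: perm_big. Qed.

Lemma lev_perm r1 r2 : perm_eq r1 r2 -> lev r1 =1 lev r2.
Proof. by move=> h f; apply/sumn_perm/perm_map/perm_filter. Qed.

Lemma lev_cons r recs f : lev (r :: recs) f = (f \in r.1) * r.2.2 + lev recs f.
Proof. by rewrite /lev /=; case: (f \in r.1) => //=; rewrite mul1n. Qed.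

Lemma lev0 recs f : f \notin flatten [seq r.1 | r <- recs] -> lev recs f = 0.
Proof.
elim: recs => [|r recs IH] //=; rewrite mem_cat negb_or lev_cons => /andP[/negPf-> /IH->].
by [].
Qed.

Lemma top_perm k r1 r2 : perm_eq r1 r2 -> top k r1 = top k r2.
Proof.
move=> h; rewrite /top !foldrE; apply: perm_big.
exact/perm_map/perm_filter.
Qed.

Lemma phi_perm r1 r2 S : perm_eq r1 r2 -> phi r1 S = phi r2 S.
Proof. by move=> h; congr sumn; apply: eq_map => e; rewrite (lev_perm h). Qed.

Lemma heads_perm r1 r2 : perm_eq r1 r2 -> heads r1 = heads r2.
Proof.
move=> h; rewrite /heads (top_perm _ h) (perm_size h).
by apply/permP.
Qed.

Lemma rado_measure_perm n r1 r2 c1 c2 : perm_eq r1 r2 -> perm_eq c1 c2 ->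
  rado_measure n (r1, c1) = rado_measure n (r2, c2).
Proof.
move=> h hc; rewrite /rado_measure /= (perm_size h) (heads_perm h).
congr (_ * _ + _ + _); first exact/sumn_perm/perm_map.
rewrite (sumn_perm (perm_map _ hc)); congr sumn.
by apply: eq_map => c; rewrite (phi_perm _ h).
Qed.

Lemma cov_perm c1 c2 Q : perm_eq c1 c2 -> cov c1 Q = cov c2 Q.
Proof. by move=> h; apply/sumn_perm/perm_map. Qed.

Lemma cov_cons c cls Q : cov (c :: cls) Q = c.2 * size [seq x <- c.1 | x \in Q] + cov cls Q.
Proof. by []. Qed.

Lemma leq_top k recs r : r \in recs -> active k r -> r.2.2 <= top k recs.
Proof.
move=> hr ha; rewrite /top foldrE; apply: (@leq_bigmax_seq _ _ xpredT id) => //.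
by apply/map_f; rewrite mem_filter ha.
Qed.

Lemma topP k recs : has (active k) recs ->
  exists2 r, r \in recs & active k r && (r.2.2 == top k recs).
Proof.
rewrite has_filter /top => hne.
have : exists2 r, r \in [seq r <- recs | active k r] & 
    r.2.2 = foldr maxn 0 [seq r.2.2 | r <- recs & active k r].
  elim: [seq r <- recs | active k r] hne => [|r [|r' s] IH] // _.
    by exists r; rewrite ?mem_head //= maxn0.
  have [r1 hr1 e1] := IH isT.
  case: (leqP r.2.2 r1.2.2) => h.
    exists r1; first by rewrite inE hr1 orbT.
    by rewrite map_cons /= -[maxn _ (foldr _ _ _)]e1 (maxn_idPr h).
  exists r; first exact: mem_head.
  by rewrite map_cons /= -[maxn _ (foldr _ _ _)]e1 (maxn_idPl (ltnW h)).
by move=> [r]; rewrite mem_filter => /andP[ha hr] e; exists r; rewrite // ha e eqxx.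
Qed.
End RadoDefs.

(** * Correctness and progress of push and relabel *)

Section RadoCorrect.
Variables (T : eqType) (ind : pred (seq T)) (ps : seq (seq T * nat)) (D : nat).
Let E := flatten [seq p.1 | p <- ps].
Hypothesis uE : uniq E.
Hypothesis indM : list_matroid E ind.

Definition class_ok recs (c : class T) :=
  [/\ indep E ind c.1, 0 < c.2 & valid E ind (lev recs) c.1].

(** By [ri_cov], deficit and coverage of a part always add up to its demand; in particular no part
    is ever covered beyond its demand. *)
Record rado_inv (recs : seq (record T)) (cls : seq (class T)) : Prop := RadoInv {
  ri_cov : perm_eq [seq (r.1, r.2.1 + cov cls r.1) | r <- recs] ps;
  ri_ok : forall c, c \in cls -> class_ok recs c;
  ri_D : sumn [seq c.2 | c <- cls] = D;
  ri_lev : forall r, r \in recs -> r.2.2 <= size recs }.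

Lemma valid_eq (l1 l2 : T -> nat) s : l1 =1 l2 -> valid E ind l1 s -> valid E ind l2 s.
Proof.
move=> h hv e eE es; rewrite -h => le.
rewrite -(eq_filter (a1 := fun f => (l1 e).-1 <= l1 f)) ; first exact: hv.
by move=> f; rewrite [l1 f]h.
Qed.

Lemma rado_inv_perm r1 r2 c1 c2 : perm_eq r1 r2 -> perm_eq c1 c2 ->
  rado_inv r1 c1 -> rado_inv r2 c2.
Proof.
move=> hr hc [h1 h2 h3 h4]; split.
- apply: perm_trans h1; rewrite perm_sym; apply: perm_trans (perm_map _ hr) _.
  rewrite (eq_map (g := fun r => (r.1, r.2.1 + cov c2 r.1))) ?perm_refl // => r.
  by rewrite (cov_perm _ hc).
- move=> c; rewrite -(perm_mem hc) => /h2[? ? hv]; split=> //.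
  exact: valid_eq (lev_perm hr) hv.
- by rewrite -h3; apply/sumn_perm/perm_map; rewrite perm_sym.
- by move=> r; rewrite -(perm_mem hr) -(perm_size hr); apply: h4.
Qed.

Section Inv.
Variables (recs : seq (record T)) (cls : seq (class T)).
Hypothesis inv : rado_inv recs cls.

Lemma perm_ground : perm_eq (flatten [seq r.1 | r <- recs]) E.
Proof.
have := perm_flatten (perm_map fst (ri_cov inv)).
by rewrite -map_comp (eq_map (g := fst)).
Qed.

Lemma uniq_ground : uniq (flatten [seq r.1 | r <- recs]).
Proof. by rewrite (perm_uniq perm_ground). Qed.

Lemma mem_ground r f : r \in recs -> f \in r.1 -> f \in E.
Proof.
by move=> hr fr; rewrite -(perm_mem perm_ground); apply/flattenP; exists r.1; rewrite ?map_f.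
Qed.

Lemma lev_mem r f : r \in recs -> f \in r.1 -> lev recs f = r.2.2.
Proof.
move=> hr fr; have hp := perm_to_rem hr; rewrite (lev_perm hp) lev_cons fr mul1n lev0 ?addn0 //.
have := uniq_ground; rewrite (perm_uniq (perm_flatten (perm_map _ hp))) /= cat_uniq.
by case/and3P=> _ /hasPn h _; apply/negP => /h; rewrite fr.
Qed.

Lemma groundP f : f \in E -> exists2 r, r \in recs & f \in r.1.
Proof.
rewrite -(perm_mem perm_ground) => /flattenP[Q /mapP[r hr ->] fr]; by exists r.
Qed.

Lemma lev_le f : lev recs f <= size recs.
Proof.
case: (boolP (f \in E)) => [/groundP[r hr fr]|fE].
  by rewrite (lev_mem hr fr) (ri_lev inv).
by rewrite lev0 // (perm_mem perm_ground).
Qed.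

Lemma phi_le S : indep E ind S -> phi recs S < cap (size recs) (size E).
Proof.
move=> [uS SE _]; rewrite /cap ltnS; apply: (@leq_trans (size S * (size recs).+1)).
  elim: {uS SE} S => //= x S IH; rewrite mulSn leq_add // ltnS; exact: lev_le.
by rewrite leq_mul2r (uniq_leq_size uS SE) orbT.
Qed.

Lemma deficit_le r : r \in recs -> exists2 p, p \in ps & r.1 = p.1 /\ r.2.1 + cov cls r.1 = p.2.
Proof.
move=> hr; have : (r.1, r.2.1 + cov cls r.1) \in ps.
  by rewrite -(perm_mem (ri_cov inv)); apply/mapP; exists r.
by move=> h; eexists; first exact: h.
Qed.
End Inv.

Lemma heads_le (recs : seq (record T)) : heads recs <= size recs.
Proof. exact: count_size. Qed.

Lemma leq_sumn (A : eqType) (f g : A -> nat) s : (forall x, x \in s -> f x <= g x) ->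
  sumn (map f s) <= sumn (map g s).
Proof.
elim: s => //= x s IH h; rewrite leq_add ?h ?mem_head // IH // => y ys.
by apply: h; rewrite inE ys orbT.
Qed.

Lemma sub_in_count (A : eqType) (p q : pred A) s : {in s, forall x, p x -> q x} ->
  count p s <= count q s.
Proof.
elim: s => //= x s IH h; apply: leq_add.
  by have := h x (mem_head _ _); case: (p x) => // ->.
by apply: IH => y ys; apply: h; rewrite inE ys orbT.
Qed.

Section Relabel.
Variables (r0 : record T) (others : seq (record T)) (cls : seq (class T)).
Let recs := r0 :: others.
Hypothesis inv : rado_inv recs cls.
Hypothesis act : active (size recs) r0.
Hypothesis stuck : forall c e, c \in cls -> e \in r0.1 -> ~~ good ind recs r0.2.2 c.1 e.

Lemma relabel_lev f : lev (relabel r0 others) f = (f \in r0.1) + lev recs f.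
Proof. by rewrite /relabel /recs !lev_cons /= mulnS addnA. Qed.

(** For the elements of [r0], [stuck] already says that the members of level at least [r0.2.2] span
    them, which is validity at the raised level. For the other elements the levels of members only
    rise, so the spanning members can only become more. *)
Lemma relabel_inv : rado_inv (relabel r0 others) cls.
Proof.
case: (inv) => h1 h2 h3 h4; split=> //.
- move=> c hc; have [hi hc0 hv] := h2 c hc; split=> // e eE es; rewrite !relabel_lev.
  have hsub (p q : pred T) : (forall f, p f -> q f) -> ind (e :: filter q c.1) ->
      ind (e :: filter p c.1).
    move=> pq hq; apply: (lm_sub indM hq).
      move=> y; rewrite !inE !mem_filter => /orP[->//|/andP[/pq-> ->]]; by rewrite orbT.
    by case: hi => us _ _; rewrite /= filter_uniq // mem_filter (negPf es) andbF.
  case er: (e \in r0.1).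
    have := stuck hc er; rewrite /good es /= => hst _.
    apply: contra hst; apply: hsub => f; rewrite relabel_lev (lev_mem inv (mem_head _ _) er).
    by rewrite /=; case: (f \in r0.1); lia.
  rewrite add0n => le; apply: contra (hv e eE es le); apply: hsub => f.
  by rewrite relabel_lev; case: (f \in r0.1); lia.
- move=> r; rewrite inE => /orP[/eqP->|hr] /=; first by case/andP: act.
  by apply: h4; rewrite inE hr orbT.
Qed.

Lemma relabel_measure :
  rado_measure (size E) (relabel r0 others, cls) < rado_measure (size E) (recs, cls).
Proof.
rewrite /rado_measure /=; set k := (size others).+1; set K := (cap k (size E)).+1.
have lt : r0.2.2 < k by case/andP: act.
have hh : heads (relabel r0 others) <= k by apply: heads_le.
have hs : sumn [seq cap k (size E) - phi (relabel r0 others) c.1 | c <- cls] <=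
          sumn [seq cap k (size E) - phi recs c.1 | c <- cls].
  apply: leq_sumn => c _; apply: leq_sub2l.
  by apply: leq_sumn => f _; rewrite relabel_lev ltnS leq_addl.
have -> : k - r0.2.2 = (k - r0.2.2.+1).+1 by lia.
move: (sumn _) (sumn _) (sumn _) hs (heads recs) => X Y Z hs W.
rewrite addSn mulnS; have : K * heads (relabel r0 others) <= K * k by rewrite leq_mul2l hh orbT.
lia.
Qed.
End Relabel.

Section Push.
Variables (r0 : record T) (others : seq (record T)) (c : class T) (cothers : seq (class T)).
Let recs := r0 :: others.
Let cls := c :: cothers.
Variables (lv : T -> nat) (e : T) (out : seq T).
Hypothesis inv : rado_inv recs cls.
Hypothesis act : active (size recs) r0.
Hypothesis lvl : r0.2.2 = top (size recs) recs.
Hypothesis er0 : e \in r0.1.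
Hypothesis es : e \notin c.1.
Hypothesis ie : ind (e :: [seq f <- c.1 | r0.2.2 <= lev recs f]).
Hypothesis outP : (out = [::] /\ forall f, f \in c.1 -> lev recs f < r0.2.2 ->
     ~~ ind (e :: [seq g <- c.1 | g != f])) \/
  exists f, [/\ out = [:: f], f \in c.1, lev recs f < r0.2.2 & ind (e :: [seq g <- c.1 | g != f])].

Let w := minn r0.2.1 c.2.
Let new := push r0 others c cothers e out w.
Let S' := e :: [seq f <- c.1 | f \notin out].

Let eE : e \in E. Proof. exact: (mem_ground inv (mem_head _ _) er0). Qed.
Let cok : class_ok recs c. Proof. by apply: (ri_ok inv); rewrite mem_head. Qed.
Let lev_e : lev recs e = r0.2.2. Proof. exact: (lev_mem inv (mem_head _ _) er0). Qed.

(** If no lower member can leave, [swap_exists] forces [e] to be at level 0; then goodness means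
    that all of [c.1] stays independent with [e], which is simply added. Otherwise [swap_level]
    gives the level of the leaving member. *)
Lemma out_cases : (out = [::] /\ r0.2.2 = 0 /\ ind (e :: c.1)) \/
  exists f, [/\ out = [:: f], f \in c.1, (lev recs f).+1 = r0.2.2 & ind (e :: [seq g <- c.1 | g != f])].
Proof.
have [hi hc0 hv] := cok; case: outP => [[ho hno]|[f [ho fc lf hif]]].
  left; case: (posnP r0.2.2) => h0.
    split=> //; split=> //; have := ie; rewrite h0.
    by rewrite (eq_filter (a2 := predT)) ?filter_predT.
  rewrite -lev_e in h0; have := swap_exists indM hi hv eE es h0.
  rewrite lev_e => /(_ ie)[f [fc lf hif]].
  by have := hno f fc lf; rewrite hif.
right; exists f; split=> //; have := swap_level indM hi hv eE es fc.
rewrite lev_e => /(_ lf hif) ->; rewrite prednK //; exact: leq_ltn_trans lf.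
Qed.

Lemma new_class_ok : indep E ind S' /\ valid E ind (lev recs) S'.
Proof.
have [hi hc0 hv] := cok; rewrite /S'; case: out_cases => [[-> [h0 hiS]]|[f [-> fc lf hif]]].
  have -> : [seq f <- c.1 | f \notin [::]] = c.1 by rewrite (eq_filter (a2 := predT)) ?filter_predT.
  by split; [apply: indep_cons|apply: valid_add].
have -> : [seq g <- c.1 | g \notin [:: f]] = [seq g <- c.1 | g != f].
  by apply: eq_filter => g; rewrite inE.
split.
  by apply: indep_cons => //; [rewrite mem_filter (negPf es) andbF|apply: indep_filter].
by apply: valid_swap => //; rewrite lev_e -lf.
Qed.

Lemma out_level f : f \in out -> (lev recs f).+1 = r0.2.2 /\ f \in c.1.
Proof.
case: out_cases => [[-> //]|[g [-> gc lg _]]].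
by rewrite inE => /eqP->.
Qed.

Lemma push_lev f : lev new.1 f = lev recs f.
Proof.
rewrite /new /push /= /recs !lev_cons; congr (_ + _).
elim: (others) => //= r rs IH; rewrite !lev_cons IH; by case: ifP.
Qed.

Lemma push_size : size new.1 = size recs.
Proof. by rewrite /= size_map. Qed.

Lemma w_gt0 : 0 < w.
Proof. by rewrite /w leq_min; case/andP: act => -> _; case: cok. Qed.

Lemma out_notin_r0 f : f \in out -> f \in r0.1 -> False.
Proof.
by move=> /out_level[hl _] fr; move: hl; rewrite (lev_mem inv (mem_head _ _) fr) => /eqP; rewrite eqn_leq ltnn.
Qed.

Lemma push_count (Q : seq T) : size [seq x <- S' | x \in Q] + has (fun f => f \in Q) out =
  size [seq x <- c.1 | x \in Q] + (e \in Q).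
Proof.
have [[us _ _] _ _] := cok; rewrite /S' /=.
suff h : size [seq x <- [seq f <- c.1 | f \notin out] | x \in Q] + has (fun f => f \in Q) out =
    size [seq x <- c.1 | x \in Q].
  by rewrite -h; case: (e \in Q) => /=; lia.
case: out_cases => [[-> _]|[f [-> fc _ _]]] /=.
  have -> : [seq _ <- c.1 | true] = c.1 by exact: filter_predT.
  by rewrite addn0.
rewrite orbF -filter_predI !size_filter; case fQ: (f \in Q) => /=; last first.
  rewrite addn0; apply: eq_count => g /=; rewrite inE.
  by case: eqVneq => [->|]; rewrite ?fQ ?andbT.
rewrite -!size_filter addn1 -(@size_filter_neq _ [seq x <- c.1 | x \in Q] f) ?filter_uniq ?mem_filter ?fQ //.
rewrite -filter_predI; congr (size _).+1; apply: eq_filter => g /=.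
by rewrite inE andbC.
Qed.

Lemma push_cov (Q : seq T) : cov new.2 Q + w * has (fun f => f \in Q) out = cov cls Q + w * (e \in Q).
Proof.
have hw : w <= c.2 by rewrite geq_minr.
have -> : cov new.2 Q = w * size [seq x <- S' | x \in Q] +
    ((c.2 - w) * size [seq x <- c.1 | x \in Q] + cov cothers Q).
  rewrite /new /push /= cov_cons; congr (_ + _); case: ifP => h //=.
  by rewrite (eqP (_ : c.2 - w == 0)) // subn_eq0.
rewrite /cls cov_cons mulnBl.
have := push_count Q; set a := size _; set b := size _; set o := has _ _ : nat.
set x : nat := (e \in Q) => h; have : w * (a + o) = w * (b + x) by rewrite h.
have : w * b <= c.2 * b by rewrite leq_mul2r hw orbT.
rewrite !mulnDr; lia.
Qed.

Lemma disjoint_others r f : r \in others -> f \in r.1 -> f \notin r0.1.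
Proof.
move=> hr fr; have := uniq_ground inv; rewrite /recs /= cat_uniq => /and3P[_ /hasPn h _].
by apply: h; apply/flattenP; exists r.1; rewrite ?map_f.
Qed.

Lemma push_inv : rado_inv new.1 new.2.
Proof.
case: (inv) => h1 h2 h3 h4; split.
- apply: perm_trans h1; rewrite /new /push /=; apply/permP => p0; congr (count p0 _); congr (_ :: _).
    congr (_, _); have := push_cov r0.1; rewrite er0 muln1.
    have -> : has (fun f => f \in r0.1) out = false.
      by apply/hasP => -[f fo fr]; apply: (out_notin_r0 fo fr).
    have : w <= r0.2.1 by rewrite geq_minl.
    rewrite muln0 /cls /new /push /=; lia.
  rewrite -map_comp; apply/eq_in_map => r hr /=.
  have := push_cov r.1; have -> : (e \in r.1) = false.
    by apply/negP => /(disjoint_others hr); rewrite er0.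
  rewrite muln0 addn0 /new /push /cls /=.
  by case: (has _ out) => /= h; congr (_, _); lia.
- move=> x hx; have : class_ok recs x.
    have [hi hv] := new_class_ok.
    move: hx; rewrite /new /push /= inE => /orP[/eqP->|]; first by split=> //=; apply: w_gt0.
    case: ifP => [_ hx|/negbT hlt]; first by apply: h2; rewrite inE hx orbT.
    rewrite inE => /orP[/eqP->|hx]; last by apply: h2; rewrite inE hx orbT.
    by have [? ? ?] := cok; split=> //=; lia.
  by case=> ? ? hv; split=> //; apply: valid_eq hv => f; rewrite push_lev.
- rewrite -h3 /new /push /=; have : w <= c.2 by rewrite geq_minr.
  by case: ifP => /= h1'; lia.
- move=> r; rewrite push_size /new /push /= inE => /orP[/eqP->|/mapP[r' hr' ->]] /=.
    exact: (h4 r0 (mem_head _ _)).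
  have : r'.2.2 <= size recs by apply: h4; rewrite inE hr' orbT.
  by case: ifP.
Qed.

Lemma push_phi : phi recs S' = (phi recs c.1).+1.
Proof.
have [[us _ _] _ _] := cok; rewrite /S' /phi /= lev_e.
case: out_cases => [[-> [-> _]]|[f [-> fc lf _]]].
  by rewrite (eq_filter (a2 := predT)) ?filter_predT.
have hp := perm_to_rem fc; rewrite [in RHS](sumn_perm (perm_map _ hp)) /= -lf.
rewrite rem_filter // addSn; do 2 congr _.+1.
by congr (_ + sumn (map _ _)); apply: eq_filter => g; rewrite inE.
Qed.

Lemma push_top : top (size recs) new.1 <= top (size recs) recs.
Proof.
rewrite -lvl /top foldrE; apply/bigmax_leqP_seq => l /mapP[r].
rewrite mem_filter => /andP[ha hr] -> _.
move: hr ha; rewrite /new /push /= inE => /orP[/eqP->|/mapP[r' hr' ->]] //=.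
have hr2 : r' \in recs by rewrite inE hr' orbT.
case: ifP => [/hasP[f fo fr]|_] /=.
  by have [<- _] := out_level fo; rewrite (lev_mem inv hr2 fr).
by move=> ha; rewrite lvl; apply: leq_top.
Qed.

Lemma push_heads : heads new.1 + (r0.2.1 <= c.2) <= heads recs.
Proof.
rewrite /heads push_size; set h' := top _ new.1; set h := top _ recs.
have hh : h' <= h := push_top.
have lh : r0.2.2 = h := lvl.
rewrite /recs -cat1s [X in _ <= X]count_cat /= -/recs act lh eqxx orbT addn0.
rewrite addnAC -lh; apply: leq_add.
  rewrite {1}/active /= lh ltnNge hh /= /w; case: (leqP r0.2.1 c.2) => hrc /=.
    by rewrite subnn /= andbF.
  by rewrite addn0 leq_b1.
rewrite count_map; apply: sub_in_count => r hr /=.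
have hr2 : r \in recs by rewrite inE hr orbT.
case: ifP => [/hasP[f fo fr]|_] /=.
  by have [hl _] := out_level fo; rewrite -(lev_mem inv hr2 fr) -hl ltnSn.
rewrite lh; case: (ltngtP r.2.2 h) => //= hrh.
  by rewrite ltnNge (leq_trans hh (ltnW hrh)) /= (gtn_eqF (leq_ltn_trans hh hrh)).
by rewrite hrh ltnNge hh /= => /andP[].
Qed.

Lemma push_measure : rado_measure (size E) new < rado_measure (size E) (recs, cls).
Proof.
rewrite /rado_measure push_size [(recs, cls).1]/= [(recs, cls).2]/=.
set k := size recs; set K := cap k (size E); set A := (K.+1 * k).+1.
have -> : sumn [seq k - r.2.2 | r <- new.1] = sumn [seq k - r.2.2 | r <- recs].
  rewrite /new /push /= -map_comp; congr (_ + sumn _); apply/eq_map => r /=; by case: ifP.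
have hphi S : phi new.1 S = phi recs S.
  by congr sumn; apply: eq_map => f; rewrite push_lev.
have -> : [seq K - phi new.1 x.1 | x <- new.2] = [seq K - phi recs x.1 | x <- new.2].
  by apply: eq_map => x; rewrite hphi.
have hh := push_heads; have hc := phi_le inv (let: And3 h _ _ := cok in h).
rewrite -/k -/K in hc.
have hS : phi recs S' = (phi recs c.1).+1 := push_phi.
rewrite -[X in _ + X < _]/(sumn [seq K - phi recs x.1 | x <-
  (S', w) :: (if c.2 <= w then cothers else (c.1, c.2 - w) :: cothers)]).
rewrite [in X in X < _]map_cons /= -/S' hS; move: hh.
have -> : sumn [seq K - phi recs x.1 | x <- if c.2 <= w then cothers else (c.1, c.2 - w) :: cothers]
  = (if c.2 <= w then 0 else K - phi recs c.1) + sumn [seq K - phi recs x.1 | x <- cothers].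
  by case: ifP.
move: (sumn _) (sumn _) (heads new.1) (heads recs) => X Y W' W.
have hw : (c.2 <= w) = (c.2 <= r0.2.1) by rewrite /w leq_min leqnn andbT.
rewrite hw; case: (leqP c.2 r0.2.1) => h1 h2.
  have : K.+1 * W' <= K.+1 * W by rewrite leq_mul2l; apply/orP; right; lia.
  lia.
(* The class splits, which adds a term of at most [K] to the last sum; the drop of [heads], weighted
   by [K + 1], pays for it. *)
have h3 : W'.+1 <= W by move: h2; rewrite (ltnW h1) addn1.
have : K.+1 * W'.+1 <= K.+1 * W by rewrite leq_mul2l h3 orbT.
rewrite mulnS; lia.
Qed.
End Push.
Lemma good_perm r1 r2 h S e : perm_eq r1 r2 -> good ind r1 h S e = good ind r2 h S e.
Proof.
move=> hp; rewrite /good; congr (_ && ind (e :: _)).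
by apply: eq_filter => f; rewrite (lev_perm hp).
Qed.

Lemma outgoing_perm r1 r2 h S e : perm_eq r1 r2 -> outgoing ind r1 h S e = outgoing ind r2 h S e.
Proof.
move=> hp; rewrite /outgoing; congr casel.
by apply: eq_filter => f; rewrite (lev_perm hp).
Qed.

Lemma outgoingP recs h S e : (outgoing ind recs h S e = [::] /\ forall f, f \in S ->
     lev recs f < h -> ~~ ind (e :: [seq g <- S | g != f])) \/
  exists f, [/\ outgoing ind recs h S e = [:: f], f \in S, lev recs f < h &
     ind (e :: [seq g <- S | g != f])].
Proof.
rewrite /outgoing; case E1: (filter _ S) => [|f s] /=.
  left; split=> // f fS lf; apply/negP => hi.
  by have : f \in [::] by rewrite -E1 mem_filter lf hi fS.
right; exists f; have : f \in f :: s by rewrite mem_head.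
by rewrite -E1 mem_filter => /andP[/andP[? ?] ?].
Qed.

Lemma perm_filter_split (A : eqType) (p : pred A) s x t : [seq y <- s | p y] = x :: t ->
  perm_eq s (x :: t ++ [seq y <- s | ~~ p y]).
Proof. by move=> h; rewrite -cat_cons -h perm_sym perm_filterC. Qed.

Lemma rado_step_ok st : rado_inv st.1 st.2 -> rado_cond st ->
  rado_inv (rado_step ind st).1 (rado_step ind st).2 /\
  rado_measure (size E) (rado_step ind st) < rado_measure (size E) st.
Proof.
case: st => recs cls /= inv hc; rewrite /rado_step /=.
case E1: [seq r <- recs | at_top recs r] => [|r0 rest] /=.
  have [r hr ha] := topP hc.
  by have : r \in [::] by rewrite -E1 mem_filter hr andbT.
have top0 : at_top recs r0 by have := mem_head r0 rest; rewrite -E1 mem_filter => /andP[].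
have hp := perm_filter_split E1; set others := rest ++ _ in hp *.
have inv' := rado_inv_perm hp (perm_refl cls) inv.
have act0 : active (size (r0 :: others)) r0 by rewrite -(perm_size hp); case/andP: top0.
have lvl : r0.2.2 = top (size (r0 :: others)) (r0 :: others).
  by rewrite -(perm_size hp) -(top_perm _ hp); case/andP: top0 => _ /eqP.
rewrite (rado_measure_perm _ hp (perm_refl cls)) /rado_at.
case E2: [seq c <- cls | has (good ind recs r0.2.2 c.1) r0.1] => [|c crest] /=.
  have stuck c e : c \in cls -> e \in r0.1 -> ~~ good ind (r0 :: others) r0.2.2 c.1 e.
    move=> hcc he; apply/negP; rewrite -(good_perm _ _ _ hp) => hg.
    have : c \in [::] by rewrite -E2 mem_filter hcc andbT; apply/hasP; exists e.
    by [].
  by split; [apply: relabel_inv|apply: relabel_measure].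
have hasg : has (good ind recs r0.2.2 c.1) r0.1.
  by have := mem_head c crest; rewrite -E2 mem_filter => /andP[].
have hpc := perm_filter_split E2; set cothers := crest ++ _ in hpc *.
case E3: [seq e <- r0.1 | good ind recs r0.2.2 c.1 e] => [|e es] /=.
  by move: hasg; rewrite has_filter E3.
have := mem_head e es; rewrite -E3 mem_filter => /andP[hg er0].
have inv2 := rado_inv_perm (perm_refl _) hpc inv'.
rewrite (rado_measure_perm _ (perm_refl _) hpc).
move: hg; rewrite (good_perm _ _ _ hp) => /andP[hes hie].
rewrite (outgoing_perm _ _ _ hp).
have hout := outgoingP (r0 :: others) r0.2.2 c.1 e.
split; first exact: push_inv.
exact: push_measure.
Qed.

Definition rado n := fun st => loop (rado_measure n st) (rado_cond (T := T)) (rado_step ind) st.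

Lemma rado_init_inv : rado_inv (rado_init ps D).1 (rado_init ps D).2.
Proof.
have hl f : lev (rado_init ps D).1 f = 0.
  by rewrite /rado_init /lev /=; elim: ps => //= p ps' IH; case: ifP => //= _; rewrite IH.
have h0 Q : cov (rado_init ps D).2 Q = 0 by rewrite /rado_init /=; case: ifP => //= _; rewrite cov_cons /= muln0.
split=> /=.
- rewrite -map_comp; apply/permP => p0; congr (count p0 _); rewrite -[RHS]map_id.
  by apply: eq_map => -[Q a] /=; rewrite h0 addn0.
- move=> c; rewrite /rado_init /=; case: (posnP D) => // hD; rewrite inE => /eqP-> /=; split=> //.
    by split=> //; apply: (lm_nil indM).
  by move=> e _ _; rewrite hl.
- by case: (posnP D) => //= hD; rewrite addn0.
- by move=> r /mapP[p _ ->].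
Qed.

End RadoCorrect.

(** The list [iota 0 (size l)] as a left fold. The cap [size l] bounds each new entry by the input
    whatever the accumulator is, as [ptime_foldl] requires. *)
Definition idx (B : Type) (l : seq B) : seq nat :=
  rev (foldl (fun s _ => minn (size s) (size l) :: s) [::] l).

Lemma idxE (B : Type) (l : seq B) : idx l = iota 0 (size l).
Proof.
rewrite /idx; suff H (l1 l2 : seq B) : size l1 + size l2 <= size l ->
    rev (foldl (fun s _ => minn (size s) (size l) :: s) (rev (iota 0 (size l1))) l2) =
    iota 0 (size l1 + size l2) by exact: (H [::] l).
elim: l2 l1 => [|b l2 IH] l1 /= hs; first by rewrite revK addn0.
have -> : minn (size (rev (iota 0 (size l1)))) (size l) :: rev (iota 0 (size l1)) =
    rev (iota 0 (size (b :: l1))).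
  rewrite size_rev size_iota (minn_idPl _); last lia.
  by rewrite -[size (b :: l1)]addn1 iotaD rev_cat.
by rewrite IH /= ?addSn ?addnS //; lia.
Qed.

Lemma ptime_idx (A : Type) {eA : encodable A} (P : oracle -> A -> Prop) (B : Type)
    {eB : encodable B} (l : oracle -> A -> seq B) : ptime P l -> ptime P (fun O x => idx (l O x)).
Proof.
move=> hl; apply: (ptime_comp (f := l) (g := fun _ s => idx s) (Q := total)) => //.
apply: ptime_rev; apply: (ptime_foldl (h := fun _ (x : seq B) s _ => minn (size s) (size x) :: s)).
- by pt.
- exact: ptime_const.
- exact: ptime_id.
- exists 2 => O x c b; rewrite esize_cons.
  have h1 : esize (minn (size c) (size x)) <= (esize x).+2.
    apply: leq_trans (esize_nat_id _) _; rewrite !ltnS.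
    exact: leq_trans (geq_minr _ _) (size_le_esize x).
  pose proof (esize_ge2 x); pose proof (esize_ge2 b).
  rewrite esize_pair /=; nia.
Qed.

Ltac ptime_user ::= eapply ptime_idx.

(** * Outcome of the covering algorithm: an exact cover or a violated union of parts *)

Section Outcome.
Variable T : eqType.

Definition solved (recs : seq (record T)) := all (fun r => r.2.1 == 0) recs.
Definition gap (recs : seq (record T)) :=
  casel [seq g <- idx recs | g \notin [seq r.2.2 | r <- recs]] 0 (fun g _ => g).
Definition failset (recs : seq (record T)) : seq T :=
  flatten [seq r.1 | r <- recs & gap recs < r.2.2].
Definition deficit (recs : seq (record T)) := sumn [seq r.2.1 | r <- recs].

Lemma size_filter_flatten (Qs : seq (seq T)) (s : seq T) : uniq (flatten Qs) ->
  size [seq x <- s | x \in flatten Qs] = sumn [seq size [seq x <- s | x \in Q] | Q <- Qs].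
Proof.
elim: Qs => [|Q Qs IH] /=; first by rewrite (eq_filter (a2 := pred0)) ?filter_pred0.
rewrite cat_uniq => /and3P[_ /hasPn h u]; rewrite -IH // !size_filter.
rewrite -count_predUI (eq_count (a1 := predI _ _) (a2 := pred0)).
  by rewrite count_pred0 addn0; apply: eq_count => x /=; rewrite mem_cat.
move=> x /=; apply/negP => /andP[xQ xR]; have := h x xR; by rewrite xQ.
Qed.

Lemma cov_flatten (cls : seq (class T)) (Qs : seq (seq T)) : uniq (flatten Qs) ->
  cov cls (flatten Qs) = sumn [seq cov cls Q | Q <- Qs].
Proof.
move=> u; elim: cls => [|c cls IH].
  by rewrite /cov /=; elim: Qs {u} => //= Q Qs <-.
rewrite cov_cons IH size_filter_flatten //.
elim: Qs {u IH} => [|Q Qs IH] /=; first by rewrite muln0.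
by rewrite -IH cov_cons mulnDr addnACA.
Qed.

Lemma sumnD (A : Type) (f g : A -> nat) s :
  sumn [seq f x + g x | x <- s] = sumn (map f s) + sumn (map g s).
Proof. by elim: s => //= x s ->; lia. Qed.

Lemma sumn_filter_le (A : Type) (f : A -> nat) p s :
  sumn [seq f x | x <- s & p x] <= sumn (map f s).
Proof. by elim: s => //= x s IH; case: (p x) => /=; lia. Qed.

Lemma sumn_map_filter (A B : Type) (g : A -> B) (f : B -> nat) p s :
  sumn [seq f y | y <- map g s & p y] = sumn [seq f (g x) | x <- s & p (g x)].
Proof. by elim: s => //= x s IH; case: (p (g x)) => /=; rewrite IH. Qed.

Lemma subseq_flatten_filter (A : eqType) (B : Type) (f : B -> seq A) p (s : seq B) :
  subseq (flatten [seq f x | x <- s & p x]) (flatten (map f s)).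
Proof.
elim: s => //= x s IH; case: (p x) => /=; first by rewrite cat_subseq.
exact: subseq_trans IH (suffix_subseq _ _).
Qed.

Lemma mem_sumn (n : nat) s : n \in s -> n <= sumn s.
Proof. elim: s => //= x s IH; rewrite inE => /orP[/eqP->|/IH]; lia. Qed.
End Outcome.

Section OutcomeCorrect.
Variables (T : eqType) (ind : pred (seq T)) (ps : seq (seq T * nat)) (D : nat).
Let E := flatten [seq p.1 | p <- ps].
Hypothesis uE : uniq E.
Hypothesis indM : list_matroid E ind.
Variables (recs : seq (record T)) (cls : seq (class T)).
Hypothesis inv : rado_inv ind ps D recs cls.
Hypothesis stop : rado_cond (recs, cls) = false.

Lemma solved_cov p : solved recs -> p \in ps -> cov cls p.1 = p.2.
Proof.
move=> hs; rewrite -(perm_mem (ri_cov inv)) => /mapP[r hr -> /=].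
by rewrite (eqP (allP hs r hr)).
Qed.

Lemma sumn_parts (P : pred (seq T)) : sumn [seq p.2 | p <- ps & P p.1] =
  sumn [seq r.2.1 | r <- recs & P r.1] + sumn [seq cov cls r.1 | r <- recs & P r.1].
Proof.
rewrite -(sumn_perm (perm_map snd (perm_filter (fun p => P p.1) (ri_cov inv)))).
by rewrite sumn_map_filter -sumnD.
Qed.

Lemma deficit_gt0 : ~~ solved recs -> 0 < deficit recs.
Proof.
case/allPn => r hr d0; apply: leq_trans (mem_sumn (map_f (fun r => r.2.1) hr)).
by rewrite lt0n.
Qed.

Lemma cov_sub (Q R : seq T) : {subset Q <= R} -> cov cls Q <= cov cls R.
Proof.
move=> h; apply: leq_sumn => c _; rewrite leq_mul2l !size_filter sub_count ?orbT // => x.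
Qed.

(** Demand is deficit plus coverage, and the parts inside [A] are covered at most as much as [A].
    This holds for every [A] and later shows that no set is violated more than the failing one. *)
Lemma cover_bound (A : seq T) :
  sumn [seq p.2 | p <- ps & all (fun x => x \in A) p.1] <= deficit recs + cov cls A.
Proof.
rewrite (sumn_parts (fun Q => all (fun x => x \in A) Q)) leq_add ?sumn_filter_le //.
have u : uniq (flatten [seq r.1 | r <- recs & all (fun x => x \in A) r.1]).
  exact: subseq_uniq (subseq_flatten_filter _ _ _) (uniq_ground uE inv).
have -> : sumn [seq cov cls r.1 | r <- recs & all (fun x => x \in A) r.1] =
    cov cls (flatten [seq r.1 | r <- recs & all (fun x => x \in A) r.1]).
  by rewrite cov_flatten // -map_comp.
apply: cov_sub => x /flattenP[Q /mapP[r]]; rewrite mem_filter => /andP[/allP h _] ->.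
exact: h.
Qed.

Section Fail.
Hypothesis unsolved : ~~ solved recs.
Let g := gap recs.

(** Pigeonhole: a part left in deficit has stopped at level [size recs]; if every lower level were
    occupied as well, [size recs] records would have [size recs + 1] distinct levels. *)
Lemma gapP : g < size recs /\ forall r, r \in recs -> r.2.2 != g.
Proof.
rewrite /g /gap; case E1: (filter _ (idx recs)) => [|h s] /=; last first.
  have : h \in h :: s by rewrite mem_head.
  rewrite -E1 mem_filter idxE mem_iota add0n /= => /andP[h1 h2]; split=> // r hr.
  by apply: contraNneq h1 => <-; apply/mapP; exists r.
have [r hr d0] := allPn unsolved.
have lr : r.2.2 = size recs.
  apply/eqP; rewrite eqn_leq (ri_lev inv hr) leqNgt; apply/negP => lt.
  by move/negP: stop; apply; apply/hasP; exists r; rewrite //= /active lt0n d0 lt.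
have : size (iota 0 (size recs).+1) <= size [seq r.2.2 | r <- recs].
  apply: uniq_leq_size; first exact: iota_uniq.
  move=> l; rewrite mem_iota leq0n add0n andTb ltnS leq_eqVlt => /orP[/eqP->|hl].
    by rewrite -lr; apply: (map_f (fun r => r.2.2)).
  apply/negPn/negP => hl2.
  have : l \in [::] by rewrite -E1 mem_filter hl2 idxE mem_iota.
  by [].
by rewrite size_iota size_map ltnn.
Qed.

Lemma mem_failset x : x \in E -> (x \in failset recs) = (g < lev recs x).
Proof.
move=> /(groundP inv)[r hr xr]; rewrite (lev_mem uE inv hr xr); apply/flattenP/idP.
  move=> [Q /mapP[r']]; rewrite mem_filter => /andP[h hr'] -> xr'.
  by rewrite -(lev_mem uE inv hr xr) (lev_mem uE inv hr' xr').
by move=> h; exists r.1 => //; apply/mapP; exists r; rewrite // mem_filter h.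
Qed.

Lemma failset_sub x : x \in failset recs -> x \in E.
Proof.
move=> /flattenP[Q /mapP[r]]; rewrite mem_filter => /andP[_ hr] -> xr.
exact: (mem_ground inv hr xr).
Qed.

Lemma failset_uniq : uniq (failset recs).
Proof. exact: subseq_uniq (subseq_flatten_filter _ _ _) (uniq_ground uE inv). Qed.

Lemma failset_span X c : indep E ind X -> c \in cls ->
  size [seq x <- X | x \in failset recs] <= size [seq x <- c.1 | x \in failset recs].
Proof.
move=> hX hc; have [hS _ hv] := ri_ok inv hc.
have hE S : indep E ind S -> size [seq x <- S | x \in failset recs] =
    count (fun x => g < lev recs x) S.
  move=> [_ SE _]; rewrite size_filter; apply: eq_in_count => x /SE.
  exact: mem_failset.
rewrite !hE //; apply: (gap_span indM hS hv) => // e /(groundP inv)[r hr er].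
by rewrite (lev_mem uE inv hr er); have [_] := gapP; apply.
Qed.

Hypothesis nonempty : all (fun p => p.1 != [::]) ps.

(** All deficit lies above the gap: a part below it has level less than [size recs], and with a
    positive deficit it would still be active. *)
Lemma failset_sum :
  sumn [seq p.2 | p <- ps & has (fun x => x \in failset recs) p.1] =
  deficit recs + cov cls (failset recs).
Proof.
have hf : [seq r <- recs | has (fun x => x \in failset recs) r.1] = [seq r <- recs | g < r.2.2].
  apply: eq_in_filter => r hr; apply/hasP/idP => [[x xr]|h].
    by rewrite (mem_failset (mem_ground inv hr xr)) (lev_mem uE inv hr xr).
  have [p hp [e1 _]] := deficit_le inv hr.
  have := allP nonempty p hp; rewrite -e1; case E1: r.1 => [|x s] // _.
  exists x; first exact: mem_head.
  by apply/flattenP; exists r.1; rewrite ?E1 ?mem_head //; apply/mapP; exists r;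
    rewrite ?mem_filter ?h ?hr ?E1.
rewrite (sumn_parts (fun Q => has (fun x => x \in failset recs) Q)) hf; congr (_ + _).
  rewrite /deficit; have [hg _] := gapP.
  have : forall r, r \in recs -> ~~ (g < r.2.2) -> r.2.1 = 0.
    move=> r hr; rewrite -leqNgt => hl; apply/eqP; rewrite -leqn0 leqNgt; apply/negP => d0.
    move/negP: stop; apply; apply/hasP; exists r; rewrite //= /active d0 /=.
    exact: leq_ltn_trans hl hg.
  elim: recs => //= r rs IH h.
  have e : sumn [seq r.2.1 | r <- rs & g < r.2.2] = sumn [seq r.2.1 | r <- rs].
    by apply: IH => r' hr'; apply: h; rewrite inE hr' orbT.
  by case: ifP => hr /=; rewrite e // (h r (mem_head _ _)) ?hr.
rewrite /failset cov_flatten -?map_comp //.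
exact: subseq_uniq (subseq_flatten_filter _ _ _) (uniq_ground uE inv).
Qed.

(** By [failset_span] every class meets the failing set in at least as many elements as [X], and
    still the coverage falls short of the demand by the positive total deficit. *)
Lemma failset_lt X : indep E ind X ->
  D * size [seq x <- X | x \in failset recs] <
    sumn [seq p.2 | p <- ps & has (fun x => x \in failset recs) p.1].
Proof.
move=> hX; rewrite failset_sum; have := deficit_gt0 unsolved.
suff : D * size [seq x <- X | x \in failset recs] <= cov cls (failset recs) by lia.
rewrite -(ri_D inv) /cov; have := @failset_span X ^~ hX.
elim: cls => //= c cs IH h; rewrite mulnDl leq_add //.
  by rewrite leq_mul2l h ?orbT // mem_head.
by apply: IH => c' hc'; apply: h; rewrite inE hc' orbT.
Qed.

Lemma failset_cov c : c \in cls ->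
  cov cls (failset recs) = D * size [seq x <- c.1 | x \in failset recs].
Proof.
move=> hc; have hi := ri_ok inv; rewrite -(ri_D inv) /cov.
have h c' : c' \in cls -> size [seq x <- c'.1 | x \in failset recs] =
    size [seq x <- c.1 | x \in failset recs].
  move=> hc'; have [h1 _ _] := hi c hc; have [h2 _ _] := hi c' hc'.
  by apply/eqP; rewrite eqn_leq !failset_span.
elim: cls h => //= c' cs IH h; rewrite mulnDl h ?mem_head // IH // => c2 hc2.
by apply: h; rewrite inE hc2 orbT.
Qed.
End Fail.
End OutcomeCorrect.

(** * Running time of the covering algorithm *)

Section App.
Context (A : Type) {eA : encodable A} (P : oracle -> A -> Prop).
Context (B1 B2 B3 C : Type) {e1 : encodable B1} {e2 : encodable B2} {e3 : encodable B3}.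
Context {eC : encodable C}.

Lemma ptime_app1 (h : oracle -> B1 -> C) (f1 : oracle -> A -> B1) :
  ptime total h -> ptime P f1 -> ptime P (fun O x => h O (f1 O x)).
Proof. by move=> hh h1; apply: (ptime_comp (Q := total) h1 hh). Qed.

Lemma ptime_app2 (h : oracle -> B1 -> B2 -> C) (f1 : oracle -> A -> B1) (f2 : oracle -> A -> B2) :
  ptime total (fun O y => h O y.1 y.2) -> ptime P f1 -> ptime P f2 ->
  ptime P (fun O x => h O (f1 O x) (f2 O x)).
Proof.
move=> hh h1 h2.
exact: (ptime_comp (f := fun O x => (f1 O x, f2 O x)) (Q := total) (ptime_pair h1 h2) hh).
Qed.

Lemma ptime_app3 (h : oracle -> B1 -> B2 -> B3 -> C)
    (f1 : oracle -> A -> B1) (f2 : oracle -> A -> B2) (f3 : oracle -> A -> B3) :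
  ptime total (fun O y => h O y.1 y.2.1 y.2.2) -> ptime P f1 -> ptime P f2 -> ptime P f3 ->
  ptime P (fun O x => h O (f1 O x) (f2 O x) (f3 O x)).
Proof.
move=> hh h1 h2 h3.
exact: (ptime_comp (f := fun O x => (f1 O x, (f2 O x, f3 O x))) (Q := total)
  (ptime_pair h1 (ptime_pair h2 h3)) hh).
Qed.
End App.

Notation elt := (nat * nat)%type (only parsing).

Section RadoTime.
Context (A : Type) {eA : encodable A} (P : oracle -> A -> Prop).

Lemma ptime_lev (f : oracle -> A -> seq (record elt)) (g : oracle -> A -> elt) :
  ptime P f -> ptime P g -> ptime P (fun O x => lev (f O x) (g O x)).
Proof. apply: (ptime_app2 (h := fun _ a b => lev a b)); rewrite /lev; pt. Qed.

Lemma ptime_rado_init (f : oracle -> A -> seq (seq elt * nat)) (g : oracle -> A -> nat) :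
  ptime P f -> ptime P g -> ptime P (fun O x => rado_init (f O x) (g O x)).
Proof. apply: (ptime_app2 (h := fun _ a b => rado_init a b)); rewrite /rado_init; pt. Qed.

Lemma ptime_solved (f : oracle -> A -> seq (record elt)) :
  ptime P f -> ptime P (fun O x => solved (f O x)).
Proof. apply: (ptime_app1 (h := fun _ a => solved a)); rewrite /solved; pt. Qed.

Lemma ptime_failset (f : oracle -> A -> seq (record elt)) :
  ptime P f -> ptime P (fun O x => failset (f O x)).
Proof. apply: (ptime_app1 (h := fun _ a => failset a)); rewrite /failset /gap; pt. Qed.

Lemma ptime_rado_cond (f : oracle -> A -> seq (record elt) * seq (class elt)) :
  ptime P f -> ptime P (fun O x => rado_cond (f O x)).
Proof. apply: (ptime_app1 (h := fun _ a => rado_cond a)); rewrite /rado_cond /active; pt. Qed.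
End RadoTime.

Ltac ptime_user ::= first
  [ eapply ptime_idx | apply ptime_lev | apply ptime_rado_init | apply ptime_solved
  | apply ptime_failset | apply ptime_rado_cond ].

Section RadoLoop.
(** Independence tests form a family indexed by data in [G], since the algorithm is run both on a
    matroid and on its faces. *)
Context (G : Type) {eG : encodable G} (indf : oracle -> G -> seq elt -> bool).
Hypothesis hind : ptime total (fun O y => indf O y.1 y.2).

Lemma ptime_indf (A : Type) {eA : encodable A} (P : oracle -> A -> Prop)
    (f : oracle -> A -> G) (g : oracle -> A -> seq elt) :
  ptime P f -> ptime P g -> ptime P (fun O x => indf O (f O x) (g O x)).
Proof. exact: ptime_app2. Qed.

Lemma ptime_outgoing (A : Type) {eA : encodable A} (P : oracle -> A -> Prop)
    (f : oracle -> A -> G) (f1 : oracle -> A -> seq (record elt)) (f2 : oracle -> A -> nat)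
    (f3 : oracle -> A -> seq elt) (f4 : oracle -> A -> elt) :
  ptime P f -> ptime P f1 -> ptime P f2 -> ptime P f3 -> ptime P f4 ->
  ptime P (fun O x => outgoing (indf O (f O x)) (f1 O x) (f2 O x) (f3 O x) (f4 O x)).
Proof.
move=> h0 h1 h2 h3 h4.
apply: (ptime_app3 (h := fun O (a : G * seq (record elt)) (b : nat * seq elt) c =>
  outgoing (indf O a.1) a.2 b.1 b.2 c) (f1 := fun O x => (f O x, f1 O x))
  (f2 := fun O x => (f2 O x, f3 O x))) => //; try exact: ptime_pair.
rewrite /outgoing; repeat first [apply ptime_indf | ptime_step].
Qed.

Lemma ptime_good (A : Type) {eA : encodable A} (P : oracle -> A -> Prop)
    (f : oracle -> A -> G) (f1 : oracle -> A -> seq (record elt)) (f2 : oracle -> A -> nat)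
    (f3 : oracle -> A -> seq elt) (f4 : oracle -> A -> elt) :
  ptime P f -> ptime P f1 -> ptime P f2 -> ptime P f3 -> ptime P f4 ->
  ptime P (fun O x => good (indf O (f O x)) (f1 O x) (f2 O x) (f3 O x) (f4 O x)).
Proof.
move=> h0 h1 h2 h3 h4.
apply: (ptime_app3 (h := fun O (a : G * seq (record elt)) (b : nat * seq elt) c =>
  good (indf O a.1) a.2 b.1 b.2 c) (f1 := fun O x => (f O x, f1 O x))
  (f2 := fun O x => (f2 O x, f3 O x))) => //; try exact: ptime_pair.
rewrite /good; repeat first [apply ptime_indf | ptime_step].
Qed.

Lemma ptime_rado_step (A : Type) {eA : encodable A} (P : oracle -> A -> Prop)
    (f : oracle -> A -> G) (f1 : oracle -> A -> seq (record elt) * seq (class elt)) :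
  ptime P f -> ptime P f1 -> ptime P (fun O x => rado_step (indf O (f O x)) (f1 O x)).
Proof.
apply: (ptime_app2 (h := fun O a b => rado_step (indf O a) b)).
rewrite /rado_step /rado_at /push /relabel /at_top /active /top.
repeat first [apply ptime_good | apply ptime_outgoing | ptime_step].
Qed.
End RadoLoop.

Definition run_rado (T : eqType) (ind : pred (seq T)) (ps : seq (seq T * nat)) (D : nat) :=
  rado ind (size (flatten [seq p.1 | p <- ps])) (rado_init ps D).

Definition rado_bound n k := ((cap k n).+1 * k).+1 * (k * k) + (cap k n).+1 * k + cap k n.

Lemma rado_init_measure (T : eqType) n (ps : seq (seq T * nat)) D :
  rado_measure n (rado_init ps D) <= rado_bound n (size ps).
Proof.
rewrite /rado_measure /rado_bound /= size_map; set k := size ps; set c := cap k n.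
have -> : sumn [seq k - r.2.2 | r <- [seq (p.1, (p.2, 0)) | p <- ps]] = k * k.
  have h m (s : seq (seq T * nat)) :
      sumn [seq m - r.2.2 | r <- [seq (p.1, (p.2, 0)) | p <- s]] = size s * m.
    by elim: s => //= p s ->; rewrite subn0 mulSn.
  exact: h.
have h1 : heads [seq (p.1, (p.2, 0)) | p <- ps] <= k.
  by apply: leq_trans (heads_le _) _; rewrite size_map.
apply: leq_add; first by apply: leq_add => //; rewrite leq_mul2l h1 orbT.
by case: (posnP D) => //= _; rewrite addn0 leq_subr.
Qed.

Section Bounds.
Variables (T : eqType) (ind : pred (seq T)) (ps : seq (seq T * nat)) (D : nat).
Variables (recs : seq (record T)) (cls : seq (class T)).
Hypothesis uE : uniq (flatten [seq p.1 | p <- ps]).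
Hypothesis inv : rado_inv ind ps D recs cls.

Lemma rado_inv_size : size recs = size ps.
Proof. by rewrite -(perm_size (ri_cov inv)) size_map. Qed.

(** The potential of a class is below [cap], so each class contributes at least one to the measure.
    Although pushes split classes, their number therefore stays polynomial. *)
Lemma class_measure : size cls <= rado_measure (size (flatten [seq p.1 | p <- ps])) (recs, cls).
Proof.
rewrite /rado_measure /=; set n := size (flatten _).
suff : size cls <= sumn [seq cap (size recs) n - phi recs c.1 | c <- cls] by lia.
have : forall c, c \in cls -> 0 < cap (size recs) n - phi recs c.1.
  by move=> c hc; have [hi _ _] := ri_ok inv hc; rewrite subn_gt0; exact: (phi_le uE inv hi).
elim: cls => //= c cs IH h; have := h c (mem_head _ _).
have : size cs <= sumn [seq cap (size recs) n - phi recs c.1 | c <- cs].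
  by apply: IH => c' hc'; apply: h; rewrite inE hc' orbT.
lia.
Qed.

Lemma class_weight c : c \in cls -> c.2 <= D.
Proof. by move=> hc; rewrite -(ri_D inv); apply/mem_sumn/map_f. Qed.
End Bounds.

Section RunRado.
Variables (T : eqType) (ind : pred (seq T)) (ps : seq (seq T * nat)) (D : nat).
Hypothesis uE : uniq (flatten [seq p.1 | p <- ps]).
Hypothesis indM : list_matroid (flatten [seq p.1 | p <- ps]) ind.
Let st := run_rado ind ps D.

Lemma run_rado_ok : [/\ rado_inv ind ps D st.1 st.2, rado_cond (st.1, st.2) = false &
  size st.2 <= rado_bound (size (flatten [seq p.1 | p <- ps])) (size ps)].
Proof.
set n := size (flatten _).
have [[h1 h2] h3] : (rado_inv ind ps D st.1 st.2 /\
    rado_measure n st <= rado_measure n (rado_init ps D)) /\ rado_cond st = false.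
  apply: (loopP (mu := rado_measure n)
    (Inv := fun st => rado_inv ind ps D st.1 st.2 /\
       rado_measure n st <= rado_measure n (rado_init ps D))) => //.
    move=> y [hi hm] hc; have [hi' hm'] := rado_step_ok uE indM hi hc.
    by split=> //; split=> //; apply: leq_trans hm; apply: ltnW.
  by split=> //; apply: rado_init_inv.
split=> //.
apply: leq_trans (class_measure uE h1) _; rewrite -surjective_pairing.
exact: leq_trans h2 (rado_init_measure _ _ _).
Qed.
End RunRado.

Section RadoLoop.
Context (G : Type) {eG : encodable G} (indf : oracle -> G -> seq elt -> bool).
Hypothesis hind : ptime total (fun O y => indf O y.1 y.2).

Definition rado_dom (O : oracle) (x : G * (seq (seq elt * nat) * nat)) :=
  uniq (flatten [seq p.1 | p <- x.2.1]) /\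
  list_matroid (flatten [seq p.1 | p <- x.2.1]) (indf O x.1).

Let St : Type := (G * (seq (record elt) * seq (class elt)))%type.
Let ground (y : St) := size (flatten [seq r.1 | r <- y.2.1]).
Let dom (O : oracle) (y : St) := exists ps D, y.2 = rado_init ps D /\ rado_dom O (y.1, (ps, D)).
Let parts (y : St) := [seq (r.1, r.2.1) | r <- y.2.1].
Let weight (y : St) := sumn [seq c.2 | c <- y.2.2].

Lemma loop_pair (O : oracle) n (y : St) :
  loop n (fun y : St => rado_cond y.2) (fun y => (y.1, rado_step (indf O y.1) y.2)) y =
  (y.1, loop n (@rado_cond _) (rado_step (indf O y.1)) y.2).
Proof. by elim: n y => [|n IH] [g st] //=; case: ifP => // _; rewrite IH. Qed.

Lemma parts_init O (y : St) ps D : y.2 = rado_init ps D -> rado_dom O (y.1, (ps, D)) ->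
  [/\ parts y = ps, weight y = D & flatten [seq r.1 | r <- y.2.1] = flatten [seq p.1 | p <- ps]].
Proof.
rewrite /parts /weight /rado_init => ->; split=> /=.
- by rewrite -map_comp -[RHS]map_id; apply: eq_map => -[].
- by case: (posnP D) => //= _; rewrite addn0.
- by rewrite -map_comp.
Qed.

Lemma ptime_rado_loop :
  ptime dom (fun O y => (y.1, rado (indf O y.1) (ground y) y.2)).
Proof.
pose n (y : St) := rado_measure (ground y) y.2.
pose Inv (O : oracle) (x y : St) := [/\ y.1 = x.1,
  rado_inv (indf O x.1) (parts x) (weight x) y.2.1 y.2.2 & n y <= n x].
have hn O x : dom O x -> n x <= rado_bound (ground x) (size x.2.1).
  move=> [ps [D [e hd]]]; have [e1 e2 e3] := parts_init e hd.
  rewrite /n /ground e3 e; apply: leq_trans (rado_init_measure _ _ _) _.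
  by rewrite /rado_init size_map.
have s2 : forall y, 2 <= esz (A := St) y by move=> y; apply: esize_ge2.
have hr y : esize y.2.1 <= esize (y : St).
  by rewrite [leqRHS]esize_pair [in leqRHS]esize_pair; lia.
have hr2 y : esize y.2.2 <= esize (y : St).
  by rewrite [leqRHS]esize_pair [in leqRHS]esize_pair; lia.
have pbr : pbound (on dom) (esz (A := St)) (fun y => size y.2.2.1).
  apply: pbound_s => -[O y] _ /=; exact: leq_trans (size_le_esize _) (hr y).
have pbg : pbound (on dom) (esz (A := St)) (fun y => ground y.2).
  apply: pbound_s => -[O y] _ /=; apply: leq_trans (hr y); rewrite /ground.
  elim: y.2.1 => //= r rs IH; rewrite esize_cons esize_pair size_cat.
  pose proof (size_le_esize r.1); lia.
have pbn : pbound (on dom) (esz (A := St)) (fun y => n y.2).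
  apply: (pbound_le (g := fun y => rado_bound (ground y.2) (size y.2.2.1))) => [[O y] hd|].
    exact: hn hd.
  by rewrite /rado_bound /cap; repeat first [apply: pbr | apply: pbg
    | apply: pboundD | apply: pboundM | apply: pboundS | exact: pbound_const].
apply: (ptime_ext (f := fun O y => loop (n y) (fun y => rado_cond y.2)
   (fun y => (y.1, rado_step (indf O y.1) y.2)) y)).
  by move=> O y _; rewrite loop_pair.
apply: (ptime_loop (Q := total) (Inv := Inv) (c := fun _ y => rado_cond y.2)
  (f := fun O y => (y.1, rado_step (indf O y.1) y.2)) (mu := fun _ => n) (n := fun _ => n)) => //.
- by pt.
- apply: ptime_pair; first by pt.
  by apply: ptime_rado_step => //; pt.
- move=> O x [ps [D [e hd]]]; have [e1 e2 e3] := parts_init e hd.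
  by split=> //; rewrite e1 e2 e; case: hd => u m; apply: rado_init_inv.
- move=> O x y [ps [D [e hd]]] [h1 h2 h3] hc; have [e1 e2 e3] := parts_init e hd.
  rewrite e1 e2 in h2; case: (hd) => u m.
  have hg z : rado_inv (indf O x.1) ps D z.2.1 z.2.2 -> ground z = size (flatten [seq p.1 | p <- ps]).
    by move=> hz; rewrite /ground (perm_size (perm_ground hz)).
  have [h4 h5] := rado_step_ok u m h2 hc.
  have lt : n (y.1, rado_step (indf O y.1) y.2) < n y.
    by rewrite /n h1 !hg.
  split=> //; split=> //; first by rewrite h1 e1 e2.
  exact: leq_trans (ltnW lt) h3.
(* Records keep their parts, with deficits at most the demands and levels at most their number;
   classes are subsets of the ground set with weights at most [D]. *)
have [k hk] : pbound (on dom) (esz (A := St)) (fun y => let s := esz y in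
    (s + ((2 + size y.2.2.1 * (s + (s + (size y.2.2.1).+2).+1).+2) +
     (2 + n y.2 * ((2 + ground y.2 * s.+1) + s).+2)).+1).+1).
  repeat first [apply: pbr | apply: pbg | apply: pbn | apply: pbound_id
    | apply: pboundD | apply: pboundM | apply: pboundS | exact: pbound_const] => //.
exists k => O x y hd [h1 h2 h3]; apply: leq_trans (hk (O, x) hd); rewrite /=.
case: hd => ps [D [e hd]]; have [e1 e2 e3] := parts_init e hd; case: (hd) => u m.
rewrite e1 e2 in h2; set s := esz (O, x).
have hsz : size x.2.1 = size ps by rewrite e /rado_init size_map.
have hpx p : p \in ps -> esize p.1 <= s /\ esize p.2 <= s.
  move=> hp; have : (p.1, (p.2, 0)) \in x.2.1 by rewrite e; apply: (map_f (fun p => (p.1, (p.2, 0)))).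
  move/mem_esize => hm; pose proof (leq_trans hm (hr x)) as hm2.
  by split; apply: leq_trans hm2; rewrite !esize_pair /=; clear; lia.
have hE z : z \in flatten [seq p.1 | p <- ps] -> esize z <= s.
  move=> /flattenP[Q /mapP[p hp ->] hz]; apply: leq_trans (proj1 (hpx p hp)).
  exact: mem_esize.
have hgx : ground x = size (flatten [seq p.1 | p <- ps]) by rewrite /ground e3.
rewrite esize_pair h1 ltnS leq_add //; first by rewrite /s /esz /= [leqRHS]esize_pair; lia.
rewrite esize_pair ltnS leq_add //.
  apply: leq_trans (esize_seq_le (b := (s + (s + (size x.2.1).+2).+1).+1) _) _; last first.
    by rewrite (rado_inv_size h2) -hsz.
  move=> r hr'; have [p hp [e4 e5]] := deficit_le h2 hr'; have [h6 h7] := hpx p hp.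
  rewrite !esize_pair e4 ltnS leq_add // ltnS leq_add //.
    apply: leq_trans h7; apply: esize_nat_le; lia.
  apply: leq_trans (esize_nat_id _) _; rewrite !ltnS hsz -(rado_inv_size h2).
  exact: ri_lev h2 _ hr'.
apply: leq_trans (esize_seq_le (b := ((2 + ground x * s.+1) + s).+1) _) _; last first.
  rewrite leq_add2l leq_mul2r; apply/orP; right.
  apply: leq_trans h3; rewrite /n /ground (perm_size (perm_ground h2)).
  by rewrite [y.2]surjective_pairing; apply: class_measure u h2.
move=> c hc; rewrite esize_pair ltnS leq_add //.
  have [[us sE _] _ _] := ri_ok h2 hc.
  apply: leq_trans (esize_seq_le (b := s) _) _; first by move=> z /sE /hE.
  by rewrite leq_add2l leq_mul2r hgx (uniq_leq_size us sE) orbT.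
have hD := class_weight h2 hc; have : D <> 0.
  by move=> D0; have [_ c0 _] := ri_ok h2 hc; have := leq_trans c0 hD; rewrite D0.
case: (posnP D) => // D0 _; apply: leq_trans (esize_nat_le hD) _.
have : ([::] : seq elt, D) \in x.2.2 by rewrite e /rado_init D0 mem_head.
move/mem_esize => hm; pose proof (leq_trans hm (hr2 x)) as hm2.
by apply: leq_trans hm2; rewrite esize_pair /=; clear; lia.
Qed.

Lemma ptime_run_rado :
  ptime rado_dom (fun O x => run_rado (indf O x.1) x.2.1 x.2.2).
Proof.
apply: (ptime_ext (f := fun O x => (x.1, rado (indf O x.1)
    (ground (x.1, rado_init x.2.1 x.2.2)) (rado_init x.2.1 x.2.2)).2)).
  by move=> O x _; rewrite /run_rado /= /ground /rado_init /= -map_comp.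
apply: ptime_snd.
apply: (ptime_comp (f := fun O x => (x.1, rado_init x.2.1 x.2.2)) _ ptime_rado_loop).
  by pt.
by move=> O [g [ps D]] hd; exists ps, D.
Qed.
End RadoLoop.

(** * Faces of the matroid and the Newton search *)

Section Levels.
Variables (T : eqType) (val : T -> nat).

Lemma count_ltS n (s : seq T) : count (fun f => val f < n.+1) s =
  count (fun f => val f < n) s + count (fun f => val f == n) s.
Proof. by elim: s => //= f s ->; rewrite ltnS; case: ltngtP => _ /=; lia. Qed.

Lemma count_geS n (s : seq T) : count (fun f => n <= val f) s =
  count (fun f => val f == n) s + count (fun f => n < val f) s.
Proof. by elim: s => //= f s ->; case: (ltngtP n (val f)) => _ /=; lia. Qed.

Lemma val_bound (s : seq T) : exists N, forall f, f \in s -> val f < N.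
Proof.
elim: s => [|f s [N hN]]; first by exists 0.
exists (maxn (val f).+1 N) => g; rewrite inE leq_max => /orP[/eqP->|/hN->]; first by rewrite ltnSn.
exact: orbT.
Qed.

Section Compare.
Variables s t : seq T.
Hypothesis hst : forall k, count (fun f => val f == k) s <= count (fun f => val f == k) t.

Lemma count_lt_le n : count (fun f => val f < n) s <= count (fun f => val f < n) t.
Proof.
elim: n => [|n IH]; first by rewrite (eq_count (a2 := pred0)) ?count_pred0.
by rewrite (count_ltS n s) (count_ltS n t) leq_add.
Qed.

Lemma count_ge_le n : count (fun f => n <= val f) s <= count (fun f => n <= val f) t.
Proof.
have [N hN] := val_bound s.
move Ed: (N - n) => d; elim: d n Ed => [|d IH] n Ed.
  rewrite (eq_in_count (a2 := pred0)) ?count_pred0 // => f /hN hf /=.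
  by apply/negbTE; rewrite -ltnNge; lia.
by rewrite (count_geS n s) (count_geS n t) leq_add ?hst // IH //; lia.
Qed.

Lemma level_size_le : size s <= size t.
Proof.
have := count_ge_le 0; by rewrite !(eq_count (a1 := fun f => 0 <= val f) (a2 := predT)) ?count_predT.
Qed.
End Compare.

Lemma level_lt s t : size s < size t ->
  exists2 k, count (fun f => val f == k) s < count (fun f => val f == k) t & has (fun f => val f == k) t.
Proof.
move=> hlt; case: (boolP (has (fun f => count (fun g => val g == val f) s <
    count (fun g => val g == val f) t) t)) => [/hasP[f ft hf]|/hasPn h].
  by exists (val f) => //; apply/hasP; exists f.
suff : size t <= size s by rewrite leqNgt hlt.
apply: level_size_le => k; case: (boolP (has (fun f => val f == k) t)) => [/hasP[f ft /eqP <-]|].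
  by rewrite leqNgt h.
by rewrite has_count -leqNgt leqn0 => /eqP->.
Qed.

(** The layer cake formula, by which weights are compared level by level. *)
Lemma sumn_levels (s : seq T) N : (forall f, f \in s -> val f <= N) ->
  sumn [seq val f | f <- s] = \sum_(k < N) count (fun f => k < val f) s.
Proof.
elim: s => [|f s IH] h /=; first by rewrite big1.
rewrite IH => [|g gs]; last by apply: h; rewrite inE gs orbT.
rewrite big_split /=; congr (_ + _).
have hf : val f <= N by apply: h; rewrite mem_head.
rewrite -(big_mkord xpredT (fun k => nat_of_bool (k < val f))) (big_cat_nat (n := val f)) //=.
rewrite (eq_big_nat _ _ (F2 := fun=> 1)) => [|k /andP[_ ->]//].
rewrite (eq_big_nat (m := val f) _ _ (F2 := fun=> 0)) => [|k /andP[hk _]]; last first.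
  by rewrite ltnNge hk.
by rewrite !sum_nat_const_nat muln1 muln0 addn0 subn0.
Qed.
End Levels.

Section Face.
Variables (T : eqType) (ind : pred (seq T)).

(* The face of the matroid formed by the bases of maximal weight: the direct sum
   over the levels k of the contractions of {val = k} by {val > k}, where G is a
   base of maximal weight. *)
Definition face (val : T -> nat) (G J : seq T) : bool :=
  all (fun e => ind ([seq f <- J | val f == val e] ++ [seq f <- G | val e < val f])) J.

Variable E : seq T.
Hypothesis indM : list_matroid E ind.
Variables (val : T -> nat) (G : seq T).
Hypothesis hG : indep E ind G.

Lemma face_level J k : face val G J ->
  ind ([seq f <- J | val f == k] ++ [seq f <- G | k < val f]).
Proof.
move=> /allP h; case: (boolP (has (fun f => val f == k) J)) => [/hasP[e eJ /eqP <-]|].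
  exact: h.
rewrite has_filter negbK => /eqP->; rewrite cat0s.
by have [] := indep_filter indM (fun f => k < val f) hG.
Qed.

Lemma faceP J : (forall k, ind ([seq f <- J | val f == k] ++ [seq f <- G | k < val f])) ->
  face val G J.
Proof. by move=> h; apply/allP => e _; apply: h. Qed.

Lemma level_uniq (J H : seq T) k : uniq J -> uniq H ->
  uniq ([seq f <- J | val f == k] ++ [seq f <- H | k < val f]).
Proof.
move=> uJ uG; rewrite cat_uniq !filter_uniq //= andbT.
apply/hasPn => y; rewrite !mem_filter => /andP[h _]; apply/negP => /andP[/eqP hy _].
by rewrite hy ltnn in h.
Qed.

Lemma level_indep (J : seq T) k : uniq J -> {subset J <= E} -> face val G J ->
  indep E ind ([seq f <- J | val f == k] ++ [seq f <- G | k < val f]).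
Proof.
move=> uJ sJ fJ; case: hG => uG sG _; split; [exact: level_uniq| |exact: face_level].
move=> y; rewrite mem_cat !mem_filter => /orP[/andP[_ /sJ//]|/andP[_]].
exact: sG.
Qed.

Lemma list_matroid_face : list_matroid E (face val G).
Proof.
have uG : uniq G by case: hG.
split=> //.
  move=> s t hs ts ut; apply: faceP => k.
  apply: (lm_sub indM (face_level k hs)); last exact: level_uniq.
  move=> y; rewrite !mem_cat !mem_filter => /orP[/andP[-> /ts->]//|->]; exact: orbT.
move=> s t us ut sE tE hs ht hlt; have [k hk _] := level_lt val hlt.
have [|x [xt xs [_ _ hx]]] := indep_exch indM (level_indep k us sE hs) (level_indep k ut tE ht).
  by rewrite !size_cat !size_filter ltn_add2r.
have [hxk {}xt] : val x = k /\ x \in t.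
  move: xt xs; rewrite !mem_cat !mem_filter => /orP[/andP[/eqP-> ->]//|->].
  by rewrite orbT.
have {}xs : x \notin s by move: xs; rewrite mem_cat mem_filter hxk eqxx negb_or => /andP[].
exists x; split=> //; apply: faceP => j /=; case: eqP => [<-|_]; first by rewrite hxk.
exact: face_level.
Qed.

Hypothesis Gcard : forall X, indep E ind X -> size X <= size G.
Hypothesis Gmax : forall X, indep E ind X -> sumn (map val X) <= sumn (map val G).

(** Optimality of the greedy choice: otherwise some [x] of value at least [k] can join the members
    of [G] of value at least [k], and completing them inside [x :: G] drops a single [y] of value
    below [k], which increases the weight. *)
Lemma max_level X k : indep E ind X ->
  count (fun f => k <= val f) X <= count (fun f => k <= val f) G.
Proof.
move=> hX; case: (hG) => uG sG iG; rewrite leqNgt; apply/negP => hlt.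
have [|x [xX xG hx]] := indep_exch indM (indep_filter indM (fun f => k <= val f) hG)
    (indep_filter indM (fun f => k <= val f) hX); first by rewrite !size_filter.
move: xX; rewrite mem_filter => /andP[kx xX].
have {}xG : x \notin G by move: xG; rewrite mem_filter kx.
have [u [uG' hu su]] := indep_extend indM hx hG (Gcard hx).
set G' := u ++ _ in hu su.
have uxG : uniq (x :: G) by rewrite /= xG.
have hsub : {subset G' <= x :: G}.
  move=> y; rewrite mem_cat !inE mem_filter => /or3P[/uG'->|->//|/andP[_ ->]]; exact: orbT.
have [y yG yG'] : exists2 y, y \in x :: G & y \notin G'.
  apply/hasP; rewrite -[has _ _]negbK -all_predC; apply/negP => /allP hall.
  have : size (x :: G) <= size G'.
    by apply: uniq_leq_size => // z /hall /=; rewrite negbK.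
  by rewrite su /= ltnn.
have hp : perm_eq (y :: G') (x :: G).
  apply: uniq_perm => //; first by rewrite /= yG'; case: hu.
  have hs : {subset y :: G' <= x :: G} by move=> z; rewrite inE => /orP[/eqP->|/hsub].
  have uy : uniq (y :: G') by rewrite /= yG'; case: hu.
  by have [] := uniq_min_size uy hs; rewrite /= su.
have hy : val y < k.
  rewrite ltnNge; apply/negP => ky; move: yG'; rewrite mem_cat !inE mem_filter ky /=.
  by move: yG; rewrite inE => /orP[->|->]; rewrite ?orbT.
have := Gmax hu; have := sumn_perm (perm_map val hp); rewrite /= => h1 h2.
by move: h1 h2 hy kx; clear; lia.
Qed.

(** Extend the upper part of [H] by elements of [Y] to the size of [Y]. An added element cannot lie
    above [k], where [H] is already maximal, so it has value [k]; counting shows that all elements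
    of [Y] of value [k] are added. *)
Lemma replace_top (Y H : seq T) k : indep E ind H ->
  (forall X, indep E ind X -> count (fun f => k < val f) X <= count (fun f => k < val f) H) ->
  indep E ind Y -> (forall f, f \in Y -> k <= val f) ->
  count (fun f => k < val f) Y = count (fun f => k < val f) H ->
  indep E ind ([seq f <- Y | val f == k] ++ [seq f <- H | k < val f]).
Proof.
move=> hH Hmax hY Yk eYH.
have hHk := indep_filter indM (fun f => k < val f) hH.
have sYk : size Y = count (fun f => val f == k) Y + count (fun f => k < val f) Y.
  rewrite -count_geS; apply/eqP; rewrite eq_sym -all_count; exact/allP.
have [|u [uY hu su]] := indep_extend indM hHk hY; first by rewrite size_filter -eYH sYk leq_addl.
have uk : {subset u <= [seq f <- Y | val f == k]}.
  move=> y yu; have yY := uY y yu; rewrite mem_filter yY andbT eqn_leq (Yk y yY) andbT leqNgt.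
  apply/negP => ky; have hyH : indep E ind (y :: [seq f <- H | k < val f]).
    apply: (indep_sub indM hu); last first.
      have [uu _ _] := hu; move: uu; rewrite cat_uniq => /and3P[_ /hasPn h uH] /=; rewrite uH andbT.
      by apply/negP => /h; rewrite yu.
    by move=> z; rewrite inE mem_cat => /orP[/eqP->|->]; rewrite ?yu ?orbT.
  have := Hmax _ hyH; rewrite /= ky -size_filter.
  rewrite (eq_in_filter (a2 := predT)) ?filter_predT ?size_filter ?ltnn // => z.
  by rewrite mem_filter => /andP[->].
have uu : uniq u by case: hu; rewrite cat_uniq => /and3P[].
have su2 : size [seq f <- Y | val f == k] <= size u.
  by move: su; rewrite size_cat !size_filter sYk eYH; move=> /addIn ->.
have [_ eu] := uniq_min_size uu uk su2.
apply: (indep_sub indM hu); first by move=> z; rewrite !mem_cat eu.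
have [uH _ _] := hH; have [uY' _ _] := hY; exact: level_uniq.
Qed.

(** By [max_level] no layer of [Y] exceeds that of [G], so equal weights force equality in every
    layer; [replace_top] then exchanges the upper part of [Y] for that of [G] at each level. *)
Lemma max_in_face Y : indep E ind Y -> size Y = size G -> sumn (map val Y) = sumn (map val G) ->
  face val G Y.
Proof.
move=> hY sY wY.
have ec k : count (fun f => k <= val f) Y = count (fun f => k <= val f) G.
  have [N hN] := val_bound val (Y ++ G).
  have hle i : i < N -> count (fun f => i < val f) Y = count (fun f => i < val f) G.
    have hm j : count (fun f => j < val f) Y <= count (fun f => j < val f) G.
      exact: max_level.
    have hYN f : f \in Y -> val f <= N by move=> fY; rewrite ltnW // hN // mem_cat fY.
    have hGN f : f \in G -> val f <= N by move=> fG; rewrite ltnW // hN // mem_cat fG orbT.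
    move=> hi; apply/eqP; rewrite eqn_leq hm /= leqNgt; apply/negP => hlt.
    move: wY; rewrite (sumn_levels hYN) (sumn_levels hGN) => /eqP.
    rewrite (bigD1 (Ordinal hi)) //= [X in _ == X](bigD1 (Ordinal hi)) //= ltn_eqF //.
    by rewrite -addSn leq_add // leq_sum.
  case: k => [|k].
    by rewrite !(eq_count (a1 := fun f => 0 <= val f) (a2 := predT)) ?count_predT.
  case: (ltnP k N) => hk; first exact: hle.
  have z (s : seq T) : {subset s <= Y ++ G} -> count (fun f => k < val f) s = 0.
    move=> ss; rewrite (eq_in_count (a2 := pred0)) ?count_pred0 // => f /ss /hN hf /=.
    by apply/negbTE; rewrite -leqNgt ltnW // (leq_trans hf).
  by rewrite !z // => f hf; rewrite mem_cat hf ?orbT.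
apply: faceP => k.
have hYk := indep_filter indM (fun f => k <= val f) hY.
have cf : count (fun f => k < val f) [seq f <- Y | k <= val f] = count (fun f => k < val f) Y.
  rewrite count_filter; apply: eq_count => f /=; case: ltnP => //= h; exact: ltnW.
have := replace_top (Y := [seq f <- Y | k <= val f]) (H := G) (k := k) hG.
have -> : [seq f <- [seq f <- Y | k <= val f] | val f == k] = [seq f <- Y | val f == k].
  rewrite -filter_predI; apply: eq_filter => f /=; case: eqP => //= ->; exact: leqnn.
case=> //; first by move=> X; apply: max_level.
- by move=> f; rewrite mem_filter => /andP[].
- by rewrite cf ec.
Qed.

(** Bases of the face glue together to bases of maximal weight. No level of [S] exceeds that of [G],
    and equal sizes make the counts agree. *)
Lemma face_max S : uniq S -> {subset S <= E} -> face val G S -> size S = size G ->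
  indep E ind S /\ sumn (map val S) = sumn (map val G).
Proof.
move=> uS sS fS eS.
have hk k : count (fun f => val f == k) S <= count (fun f => val f == k) G.
  have := max_level k (level_indep k uS sS fS).
  rewrite count_cat !count_filter (count_geS val k G).
  have -> : count (predI (fun f => k <= val f) (fun f => val f == k)) S =
      count (fun f => val f == k) S.
    by apply: eq_count => f /=; case: eqP => [->|]; rewrite ?leqnn ?andbF.
  have -> : count (predI (fun f => k <= val f) (fun f => k < val f)) G =
      count (fun f => k < val f) G.
    by apply: eq_count => f /=; case: (ltnP k (val f)) => [/ltnW->|]; rewrite ?andbF.
  by rewrite leq_add2r.
have ege k : count (fun f => k <= val f) S = count (fun f => k <= val f) G.
  apply/eqP; rewrite eqn_leq count_ge_le //=.
  have h (s : seq T) : count (fun f => k <= val f) s = size s - count (fun f => val f < k) s.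
    rewrite -(count_predC (fun f => val f < k) s) addKn; apply: eq_count => f /=.
    by rewrite leqNgt.
  by rewrite !h eS leq_sub2l // count_lt_le.
split.
  (* Induction from the highest level down; each step exchanges the upper part of [G] for that of
     [S] by [replace_top]. *)
  suff h d k : (forall f, f \in S -> val f < k + d) -> indep E ind [seq f <- S | k <= val f].
    have [N hN] := val_bound val S; have := h N 0 hN.
    by rewrite (eq_filter (a2 := predT)) ?filter_predT.
  elim: d k => [|d IH] k hd.
    rewrite (eq_in_filter (a2 := pred0)) ?filter_pred0 => [|f /hd]; last first.
      by rewrite addn0 ltnNge => /negbTE.
    split=> //; exact: (lm_nil indM).
  have hS1 : indep E ind [seq f <- S | k < val f].
    by apply: IH => f /hd; rewrite addSnnS.
  have cf (s : seq T) : count (fun f => k < val f) [seq f <- s | k < val f] = count (fun f => k < val f) s.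
    by rewrite count_filter; apply: eq_count => f /=; rewrite andbb.
  have cE (s : seq T) : count (fun f => k < val f) [seq f <- s | val f == k] = 0.
    rewrite count_filter (eq_count (a2 := pred0)) ?count_pred0 // => f /=.
    by case: eqP => [->|]; rewrite ?ltnn ?andbF.
  have := replace_top (Y := [seq f <- S | val f == k] ++ [seq f <- G | k < val f])
    (H := [seq f <- S | k < val f]) (k := k) hS1.
  have -> : [seq f <- [seq f <- S | k < val f] | k < val f] = [seq f <- S | k < val f].
    by rewrite -filter_predI; apply: eq_filter => f /=; rewrite andbb.
  have -> : [seq f <- [seq f <- S | val f == k] ++ [seq f <- G | k < val f] | val f == k] =
      [seq f <- S | val f == k].
    rewrite filter_cat -!filter_predI [X in _ ++ X](eq_filter (a2 := pred0)) ?filter_pred0 ?cats0.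
      by apply: eq_filter => f /=; rewrite andbb.
    by move=> f /=; case: eqP => // ->; rewrite ltnn.
  move=> /(_ _)[||||_ sE iS].
  - by move=> X hX; rewrite cf ege; apply: max_level.
  - exact: level_indep.
  - by move=> f; rewrite mem_cat !mem_filter => /orP[/andP[/eqP->]//|/andP[/ltnW]].
  - by rewrite count_cat cE add0n cf cf ege.
  apply: (indep_sub indM (s := [seq f <- S | val f == k] ++ [seq f <- S | k < val f])).
  - by split=> //; apply: level_uniq.
  - move=> f; rewrite mem_cat !mem_filter leq_eqVlt => /andP[/orP[/eqP->|->] ->].
      by rewrite eqxx.
    by rewrite orbT.
  - exact: filter_uniq.
have [N hN] := val_bound val (S ++ G).
have hSN f : f \in S -> val f <= N by move=> fY; rewrite ltnW // hN // mem_cat fY.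
have hGN f : f \in G -> val f <= N by move=> fG; rewrite ltnW // hN // mem_cat fG orbT.
by rewrite (sumn_levels hSN) (sumn_levels hGN); apply: eq_bigr => i _.
Qed.
End Face.

(** * Newton search for the largest multiple of a base that can be subtracted *)

Section PeelDefs.
Variables (T : eqType) (ind : pred (seq T)) (E : seq T).

Definition mass (cls : seq (class T)) := sumn [seq c.2 | c <- cls].
Definition wt (cls : seq (class T)) e := cov cls [:: e].

(** All parts are singletons, so a solved run expresses the vector of these demands itself, element
    by element, as a sum of independent sets. *)
Definition demands (cls : seq (class T)) (S : seq T) p q :=
  [seq ([:: e], q * wt cls e - (if e \in S then p else 0)) | e <- E].
Definition peel (cls : seq (class T)) (S : seq T) p q :=
  run_rado ind (demands cls S p q) (q * mass cls - p).

(* A state ((p, q), (tau, st)) of the search for the largest p / q such that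
   p copies of S can be taken out of q copies of cls: st is the attempt for p / q,
   tau holds the obstruction met by the previous attempt. *)
Definition newton_state := ((nat * nat) * (seq (seq T) * (seq (record T) * seq (class T))))%type.
Definition newton_at cls S A p q : newton_state := ((p, q), ([:: A], peel cls S p q)).
(** The rank of the failing set: by [failset_span] every class attains it, so the first one is
    consulted. *)
Definition newton_rank (y : newton_state) :=
  casel y.2.2.2 0 (fun c _ => size [seq x <- c.1 | x \in failset y.2.2.1]).
(** For a set [A] of rank [r], subtraction requires [p * (r - |S /\ A|) <= q * (mass * r - cov A)].
    The next ratio turns this into an equality for the failing set. *)
Definition newton_step cls S (y : newton_state) : newton_state :=
  newton_at cls S (failset y.2.2.1)
    (mass cls * newton_rank y - cov cls (failset y.2.2.1))
    (newton_rank y - size [seq x <- S | x \in failset y.2.2.1]).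
Definition newton_cond (y : newton_state) := ~~ solved y.2.2.1.
(** The search descends from the largest ratio for which no weight and no mass becomes negative. *)
Definition newton_init cls S : newton_state :=
  let p := foldr minn (mass cls) [seq wt cls e | e <- S] in ((p, 1), ([::], peel cls S p 1)).
Definition newton cls S := loop (size E) newton_cond (newton_step cls S) (newton_init cls S).
End PeelDefs.

Lemma flatten_demands (T : eqType) (E : seq T) cls S p q :
  flatten [seq d.1 | d <- demands E cls S p q] = E.
Proof. by rewrite /demands -map_comp; elim: E => //= e E ->. Qed.

Lemma cov_le (T : eqType) (cls : seq (class T)) (A : seq T) r :
  (forall c, c \in cls -> size [seq x <- c.1 | x \in A] <= r) -> cov cls A <= mass cls * r.
Proof.
rewrite /cov /mass; elim: cls => //= c cls IH h; rewrite mulnDl leq_add //.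
  by rewrite leq_mul2l h ?mem_head ?orbT.
by apply: IH => c' hc'; apply: h; rewrite inE hc' orbT.
Qed.

Lemma cov_eq (T : eqType) (cls : seq (class T)) (A : seq T) r :
  (forall c, c \in cls -> size [seq x <- c.1 | x \in A] = r) -> cov cls A = mass cls * r.
Proof.
rewrite /cov /mass; elim: cls => //= c cls IH h; rewrite mulnDl h ?mem_head //.
by rewrite IH // => c' hc'; apply: h; rewrite inE hc' orbT.
Qed.

Lemma cov_tight (T : eqType) (cls : seq (class T)) (A : seq T) r :
  (forall c, c \in cls -> 0 < c.2) ->
  (forall c, c \in cls -> size [seq x <- c.1 | x \in A] <= r) -> cov cls A = mass cls * r ->
  forall c, c \in cls -> size [seq x <- c.1 | x \in A] = r.
Proof.
move=> h0 hr; elim: cls h0 hr => //= c cls IH h0 hr; rewrite /mass cov_cons /= mulnDl -/(mass cls).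
have hc := hr c (mem_head _ _); have hc0 := h0 c (mem_head _ _).
have h1 c' : c' \in cls -> 0 < c'.2 by move=> hc'; apply: h0; rewrite inE hc' orbT.
have h2 c' : c' \in cls -> size [seq x <- c'.1 | x \in A] <= r.
  by move=> hc'; apply: hr; rewrite inE hc' orbT.
have hle := cov_le h2.
have hle2 : c.2 * size [seq x <- c.1 | x \in A] <= c.2 * r by rewrite leq_mul2l hc orbT.
move=> e c'; rewrite inE => /orP[/eqP->|]; last by apply: IH => //; lia.
apply/eqP; rewrite -(eqn_pmul2l hc0); apply/eqP; lia.
Qed.

Lemma cov_filter (T : eqType) (cls : seq (class T)) (E A : seq T) :
  (forall c, c \in cls -> {subset c.1 <= E}) -> cov cls [seq x <- E | x \in A] = cov cls A.
Proof.
move=> h; rewrite /cov; congr sumn; apply/eq_in_map => c hc; congr (_ * size _).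
by apply: eq_in_filter => x xc; rewrite mem_filter (h c hc x xc) andbT.
Qed.

Lemma flatten_seq1 (T : eqType) (s : seq T) : flatten [seq [:: e] | e <- s] = s.
Proof. by elim: s => //= e s ->. Qed.

Lemma sumn_wt (T : eqType) (cls : seq (class T)) (s : seq T) :
  uniq s -> sumn [seq wt cls e | e <- s] = cov cls s.
Proof.
move=> us; rewrite -[in RHS](flatten_seq1 s) cov_flatten ?flatten_seq1 //.
by rewrite -map_comp.
Qed.

Section Peel.
Variables (T : eqType) (ind : pred (seq T)) (E : seq T).
Hypothesis uE : uniq E.
Hypothesis indM : list_matroid E ind.
Variables (cls : seq (class T)) (S : seq T) (m : nat).
Hypothesis cls_ok : forall c, c \in cls -> indep E ind c.1.
Hypothesis cls_E : cov cls E = mass cls * m.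
Hypothesis hS : indep E ind S.
Hypothesis sS : size S = m.

(** Under these bounds the truncated subtractions in [demands] and in the mass are exact. *)
Definition ratio_ok p q := [/\ 0 < q, p <= q * mass cls & forall e, e \in S -> p <= q * wt cls e].

Lemma sum_mem (A : seq T) : sumn [seq (e \in S : nat) | e <- E & e \in A] = size [seq x <- S | x \in A].
Proof.
case: hS => uS sE _.
have -> : size [seq x <- S | x \in A] = size [seq e <- [seq e <- E | e \in A] | e \in S].
  apply/perm_size/uniq_perm; rewrite ?filter_uniq // => x.
  by rewrite !mem_filter; case xS: (x \in S); rewrite ?andbF //= (sE x xS) !andbT.
by rewrite size_filter; elim: [seq e <- E | e \in A] => //= x s ->.
Qed.

Section Ratio.
Variables p q : nat.
Hypothesis pq : ratio_ok p q.
Let st := peel ind E cls S p q.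

Lemma demand_sum (A : seq T) :
  sumn [seq d.2 | d <- demands E cls S p q & has (fun x => x \in A) d.1] +
    p * size [seq x <- S | x \in A] = q * cov cls A.
Proof.
rewrite /demands sumn_map_filter /= -sum_mem -(@cov_filter _ cls E) => [|c /cls_ok[]//].
rewrite -(sumn_wt _ (filter_uniq _ uE)).
rewrite (eq_filter (a2 := fun e => e \in A)) => [|e]; last by rewrite orbF.
elim: [seq e <- E | e \in A] => [|e s IH] /=; first by rewrite !muln0.
rewrite !mulnDr -IH; case eS: (e \in S); last by rewrite subn0 muln0; lia.
by case: pq => _ _ h; have := h e eS; lia.
Qed.

Lemma demand_sum_all (A : seq T) :
  sumn [seq d.2 | d <- demands E cls S p q & all (fun x => x \in A) d.1] =
  sumn [seq d.2 | d <- demands E cls S p q & has (fun x => x \in A) d.1].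
Proof.
rewrite /demands !sumn_map_filter; congr sumn; congr map; apply: eq_filter => e /=.
Qed.

Lemma peel_ok : [/\ rado_inv ind (demands E cls S p q) (q * mass cls - p) st.1 st.2,
  rado_cond (st.1, st.2) = false & size st.2 <= rado_bound (size E) (size E)].
Proof.
have h := run_rado_ok (ind := ind) (ps := demands E cls S p q) (q * mass cls - p).
rewrite flatten_demands size_map in h; exact: h.
Qed.

Lemma demands_nonempty : all (fun d => d.1 != [::]) (demands E cls S p q).
Proof. by apply/allP => d /mapP[e _ ->]. Qed.

Lemma demands_uniq : uniq (flatten [seq d.1 | d <- demands E cls S p q]).
Proof. by rewrite flatten_demands. Qed.

Lemma demands_matroid : list_matroid (flatten [seq d.1 | d <- demands E cls S p q]) ind.
Proof. by rewrite flatten_demands. Qed.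

Lemma peel_indep c : c \in st.2 -> indep E ind c.1 /\ 0 < c.2.
Proof.
have [h _ _] := peel_ok; move=> hc; have [h1 h2 _] := ri_ok h hc.
by rewrite flatten_demands in h1.
Qed.

Lemma peel_mass : mass st.2 = q * mass cls - p.
Proof. by have [h _ _] := peel_ok; apply: ri_D h. Qed.

Lemma peel_solved_wt e : solved st.1 -> e \in E ->
  wt st.2 e = q * wt cls e - (if e \in S then p else 0).
Proof.
move=> hs eE; have [h _ _] := peel_ok.
apply: (solved_cov h hs (p := ([:: e], _))).
exact: (map_f (fun e => ([:: e], q * wt cls e - (if e \in S then p else 0)))).
Qed.

Lemma peel_solved_cov (A : seq T) : solved st.1 ->
  cov st.2 A + p * size [seq x <- S | x \in A] = q * cov cls A.
Proof.
move=> hs; rewrite -demand_sum; congr (_ + _).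
rewrite -(@cov_filter _ st.2 E) => [|c /peel_indep[[]]//].
rewrite -(sumn_wt _ (filter_uniq _ uE)) /demands sumn_map_filter.
rewrite (eq_filter (a2 := fun e => e \in A)) => [|e]; last by rewrite /= orbF.
congr sumn; apply/eq_in_map => e; rewrite mem_filter => /andP[_ eE].
exact: peel_solved_wt.
Qed.

Section Unsolved.
Hypothesis unsolved : ~~ solved st.1.
Let A := failset st.1.
Let r := casel st.2 0 (fun c _ => size [seq x <- c.1 | x \in A]).
Let Delta := deficit st.1.

(** If the whole mass were subtracted, the total demand would be [q * mass * m - p * m = 0] and
    nothing could be in deficit. Hence a failed run has a class from which to read the rank. *)
Lemma peel_D_gt0 : p < q * mass cls.
Proof.
have [q0 pt pw] := pq; rewrite ltn_neqAle pt andbT; apply/eqP => e.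
have [h _ _] := peel_ok.
have := demand_sum E; have sE : {subset S <= E} by case: hS.
have -> : [seq d <- demands E cls S p q | has (fun x => x \in E) d.1] = demands E cls S p q.
  by apply/all_filterP/allP => d /mapP[e0 eE ->]; rewrite /= eE.
have -> : [seq x <- S | x \in E] = S by apply/all_filterP/allP.
rewrite sS cls_E mulnA -e; set X := sumn _ => hX.
have X0 : X = 0 by lia.
case/allPn: unsolved => rr hr; have [d hd [e1 e2]] := deficit_le h hr.
have : d.2 <= X by rewrite /X; apply: mem_sumn; apply/mapP; exists d.
rewrite X0 => hd0 /negP; apply; rewrite -leqn0; apply: leq_trans hd0.
by rewrite -e2 leq_addr.
Qed.

Lemma peel_nonempty : exists c s, st.2 = c :: s.
Proof.
have := peel_mass; have := peel_D_gt0; case: st.2 => [|c s]; last by exists c, s.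
by rewrite /mass /=; lia.
Qed.

Lemma fail_span X : indep E ind X -> size [seq x <- X | x \in A] <= r.
Proof.
have [h hstop _] := peel_ok; rewrite /r; have [c [s es]] := peel_nonempty.
move=> hX; have hc : c \in st.2 by rewrite es mem_head.
have := failset_span demands_uniq demands_matroid h hstop unsolved (X := X) (c := c).
by rewrite flatten_demands es /= => /(_ hX); apply; rewrite es in hc.
Qed.

Lemma fail_cov : cov st.2 A = (q * mass cls - p) * r.
Proof.
have [h hstop _] := peel_ok; rewrite /r; have [c [s es]] := peel_nonempty.
have hc : c \in st.2 by rewrite es mem_head.
rewrite (failset_cov demands_uniq demands_matroid h hstop unsolved hc) es /=.
by [].
Qed.

(** The deficit is exactly the amount by which the inequality of the failing set is violated at the
    current ratio. *)
Lemma fail_sum : p * (r - size [seq x <- S | x \in A]) =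
   Delta + q * (mass cls * r - cov cls A).
Proof.
have [h hstop _] := peel_ok.
have := demand_sum A; rewrite (failset_sum demands_uniq h hstop unsolved demands_nonempty).
rewrite -/A fail_cov -/Delta; have hs := fail_span hS.
have hc : cov cls A <= mass cls * r by apply: cov_le => c /cls_ok; apply: fail_span.
have [q0 pt _] := pq; rewrite !mulnBr mulnBl.
have : p * r <= q * mass cls * r by rewrite leq_mul2r pt orbT.
have : p * size [seq x <- S | x \in A] <= p * r by rewrite leq_mul2l hs orbT.
have : q * cov cls A <= q * (mass cls * r) by rewrite leq_mul2l hc orbT.
rewrite mulnA; lia.
Qed.

(** No rank inequality is violated by more than the deficit, so with [fail_sum] the failing set is a
    most violated one, as Newton's method needs. *)
Lemma fail_max (A' : seq T) r' : (forall X, indep E ind X -> size [seq x <- X | x \in A'] <= r') ->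
  p * (r' - size [seq x <- S | x \in A']) <= Delta + q * (mass cls * r' - cov cls A').
Proof.
move=> hr'; have [h hstop _] := peel_ok.
have := demand_sum A'; rewrite -demand_sum_all; have := cover_bound demands_uniq h A'.
set X := sumn _; rewrite -/Delta; have hs := hr' _ hS.
have hc : cov cls A' <= mass cls * r' by apply: cov_le => c /cls_ok; apply: hr'.
have hc2 : cov st.2 A' <= (q * mass cls - p) * r'.
  by rewrite -peel_mass; apply: cov_le => c /peel_indep[hi _]; apply: hr'.
have [q0 pt _] := pq; rewrite !mulnBr; rewrite mulnBl in hc2.
have : p * r' <= q * mass cls * r' by rewrite leq_mul2r pt orbT.
have : p * size [seq x <- S | x \in A'] <= p * r' by rewrite leq_mul2l hs orbT.
have : q * cov cls A' <= q * (mass cls * r') by rewrite leq_mul2l hc orbT.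
rewrite mulnA; lia.
Qed.

Lemma Delta_gt0 : 0 < Delta.
Proof. exact: deficit_gt0. Qed.

Lemma fail_ratio : let N := mass cls * r - cov cls A in
  let s := r - size [seq x <- S | x \in A] in
  [/\ ratio_ok N s, s <= size E, N + cov cls A = mass cls * r,
      s + size [seq x <- S | x \in A] = r & q * N < p * s].
Proof.
move=> N s; have e := fail_sum; have D0 := Delta_gt0.
have hs := fail_span hS.
have hc : cov cls A <= mass cls * r by apply: cov_le => c /cls_ok; apply: fail_span.
have lt : q * N < p * s by rewrite /s /N e; lia.
have s0 : 0 < s by move: lt; case: (s) => //; rewrite muln0.
have [q0 pt pw] := pq.
have le X : p <= q * X -> N <= s * X.
  move=> hX; apply: ltnW; rewrite -(ltn_pmul2l q0); apply: leq_trans lt _.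
  by rewrite mulnCA mulnC leq_mul2l hX orbT.
split=> //; last 2 first.
- by rewrite /N subnK.
- by rewrite /s subnK.
- by split=> //; [apply: le|move=> x /pw; apply: le].
rewrite /s /r; have [c [w ew]] := peel_nonempty; rewrite ew /=.
have [[uc cE _] _] : indep E ind c.1 /\ 0 < c.2 by apply: peel_indep; rewrite ew mem_head.
apply: leq_trans (leq_subr _ _) (leq_trans _ (uniq_leq_size uc cE)).
by rewrite size_filter count_size.
Qed.
End Unsolved.
End Ratio.
End Peel.

Lemma foldr_minn_le b s : foldr minn b s <= b.
Proof. by elim: s => //= x s IH; rewrite geq_min IH orbT. Qed.

Lemma foldr_minn_mem b s x : x \in s -> foldr minn b s <= x.
Proof.
elim: s => //= y s IH; rewrite inE geq_min => /orP[/eqP->|/IH->]; first by rewrite leqnn.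
exact: orbT.
Qed.

Lemma foldr_minn_case b s : foldr minn b s = b \/ foldr minn b s \in s.
Proof.
elim: s => [|x s [IH|IH]] /=; [by left| |].
  by rewrite /minn; case: ifP => _; [right; rewrite mem_head|left].
by right; rewrite /minn; case: ifP => _; rewrite inE ?eqxx // IH orbT.
Qed.

Section Newton.
Variables (T : eqType) (ind : pred (seq T)) (E : seq T).
Hypothesis uE : uniq E.
Hypothesis indM : list_matroid E ind.
Variables (cls : seq (class T)) (S : seq T) (m : nat).
Hypothesis cls_ok : forall c, c \in cls -> indep E ind c.1.
Hypothesis cls_E : cov cls E = mass cls * m.
Hypothesis hS : indep E ind S.
Hypothesis sS : size S = m.

Definition obstruction (y : newton_state T) A r := [/\ y.2.1 = [:: A] /\ uniq A /\ {subset A <= E},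
  forall X, indep E ind X -> size [seq x <- X | x \in A] <= r,
  y.1.1 + cov cls A = mass cls * r & y.1.2 + size [seq x <- S | x \in A] = r].

(** The alternatives of [ni_tau] are the two ways in which a round makes progress: the initial
    ratio, which exhausts the mass or a weight, or a ratio at which a new rank inequality becomes
    tight. *)
Record newton_inv (y : newton_state T) : Prop := NewtonInv {
  ni_ratio : ratio_ok cls S y.1.1 y.1.2;
  ni_q : y.1.2 <= (size E).+1;
  ni_st : y.2.2 = peel ind E cls S y.1.1 y.1.2;
  ni_tau : y.2.1 = [::] /\ y.1.2 = 1 /\ y.1.1 = foldr minn (mass cls) [seq wt cls e | e <- S] \/
    exists A r, obstruction y A r }.

Let slack (y : newton_state T) := if solved y.2.2.1 then 0
  else newton_rank y - size [seq x <- S | x \in failset y.2.2.1].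

Lemma newton_init_inv : newton_inv (newton_init ind E cls S).
Proof.
split=> //=; last by left.
split=> //; rewrite ?mul1n; first exact: foldr_minn_le.
move=> e eS; rewrite mul1n; exact/foldr_minn_mem/map_f.
Qed.

(** Newton's method on a maximum of linear functions: the slope of the violated inequality strictly
    decreases, which leaves at most [size E] steps. Otherwise the maximality of the old obstruction,
    compared with the new one, contradicts the violation of the latter at the smaller ratio. *)
Lemma newton_step_inv y : newton_inv y -> newton_cond y ->
  newton_inv (newton_step ind E cls S y) /\ slack (newton_step ind E cls S y) < slack y.
Proof.
case: y => [[p q] [tau st]] [hr hq hst _] uns.
rewrite /= in hr hq hst; subst st; rewrite /newton_cond /= in uns.
have [h1 h2 h3 h4 h5] := fail_ratio uE indM cls_ok cls_E hS sS hr uns.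
set N := mass cls * _ - _ in h1 h3 h5; set s := _ - _ in h1 h2 h4 h5.
set A := failset (peel ind E cls S p q).1 in h3 h4.
set y := (_, _).
have e1 : newton_step ind E cls S y = newton_at ind E cls S A N s by [].
have sl : slack y = s by rewrite /slack /= (negPf uns).
have span := fail_span uE indM cls_ok cls_E hS sS hr uns.
rewrite e1 sl; split.
  split=> //=; first exact: leq_trans h2 (leqnSn _).
  right; exists A, (newton_rank y); split=> //; split=> //.
  have [hinv _ _] := peel_ok uE indM cls S p q.
  split; first exact: (failset_uniq (demands_uniq uE cls S p q) hinv).
  by move=> x /(failset_sub hinv); rewrite flatten_demands.
rewrite /slack /newton_at /=; case: ifP => [_|/negbT uns']; first by case: h1.
have [_ _ h3' h4' h5'] := fail_ratio uE indM cls_ok cls_E hS sS h1 uns'.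
have span' := fail_span uE indM cls_ok cls_E hS sS h1 uns'.
have hmax := fail_max uE indM cls_ok cls_E hS sS hr uns span'.
have hsum := fail_sum uE indM cls_ok cls_E hS sS hr uns.
rewrite /newton_rank /=; move: h3' h4' h5' hmax.
set N' := mass cls * _ - _; set s' := _ - _ => h3' h4' h5' hmax.
rewrite -/N -/s in hsum; rewrite ltnNge; apply/negP => hle.
have q0 : 0 < q by case: hr.
move: h5 h5' hmax hsum hle q0; clear => h5 h5' hmax hsum /subnKC; move: (s' - s) => d e q0.
move: h5' hmax hsum; rewrite -e; clear e => h5' hmax hsum.
(* The deficit cancels between the equality for the old obstruction and the bound for the new
   one. *)
have h6 : p * d + q * N <= q * N' by move: hmax hsum; rewrite mulnDr; lia.
have h7 : s * (p * d + q * N) <= s * (q * N') by rewrite leq_mul2l h6 orbT.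
have h8 : q * (s * N').+1 <= q * (N * (s + d)) by rewrite leq_mul2l h5' orbT.
have h9 : d * (q * N).+1 <= d * (p * s) by rewrite leq_mul2l h5 orbT.
nia.
Qed.

Lemma newton_ok : newton_inv (newton ind E cls S) /\ solved (newton ind E cls S).2.2.1.
Proof.
have [h1 h2] : newton_inv (newton ind E cls S) /\ newton_cond (newton ind E cls S) = false.
  apply: (loopP (mu := slack)); first exact: newton_step_inv.
    exact: newton_init_inv.
  rewrite /slack; case: ifP => // /negbT uns.
  have [hr _ hst _] := newton_init_inv.
  by have [_ h _ _ _] := fail_ratio uE indM cls_ok cls_E hS sS hr uns.
by split=> //; apply/negbFE.
Qed.
End Newton.

(** * Decomposition into transversals *)

Lemma list_matroid_subset (T : eqType) (ind : pred (seq T)) (E E' : seq T) :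
  {subset E' <= E} -> list_matroid E ind -> list_matroid E' ind.
Proof.
move=> h [h1 h2 h3]; split=> // s t us ut sE tE is_ it lt.
by apply: h3 => // x; [move/sE/h|move/tE/h].
Qed.

Lemma failset_part (T : eqType) (ind : pred (seq T)) ps D (recs : seq (record T)) cls p x y :
  uniq (flatten [seq p.1 | p <- ps]) -> rado_inv ind ps D recs cls ->
  p \in ps -> x \in p.1 -> y \in p.1 -> x \in failset recs -> y \in failset recs.
Proof.
move=> u inv hp xp yp xA.
have [r hr er] : exists2 r, r \in recs & r.1 = p.1.
  by move: hp; rewrite -(perm_mem (ri_cov inv)) => /mapP[r hr ->]; exists r.
rewrite -er in xp yp.
have hE z : z \in r.1 -> z \in flatten [seq p.1 | p <- ps] by apply: (mem_ground inv hr).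
by move: xA; rewrite !(mem_failset u inv) ?hE // !(lev_mem u inv hr).
Qed.

Lemma mass_ge (T : eqType) (cls : seq (class T)) c : c \in cls -> c.2 <= mass cls.
Proof. by move=> hc; apply: mem_sumn; apply/mapP; exists c. Qed.

Lemma wt_gt0 (T : eqType) (cls : seq (class T)) c e :
  c \in cls -> 0 < c.2 -> e \in c.1 -> 0 < wt cls e.
Proof.
move=> hc c0 ec; apply: (@leq_trans (c.2 * size [seq x <- c.1 | x \in [:: e]])).
  rewrite muln_gt0 c0 /= size_filter -has_count; apply/hasP; exists e => //.
  exact: mem_head.
by apply: mem_sumn; apply/mapP; exists c.
Qed.

Lemma sumn_map_const (A : eqType) (f : A -> nat) s b :
  (forall x, x \in s -> f x = b) -> sumn (map f s) = b * size s.
Proof.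
elim: s => [|x s IH] h /=; first by rewrite muln0.
by rewrite h ?mem_head // IH ?mulnS // => y ys; apply: h; rewrite inE ys orbT.
Qed.

Section DecDefs.
Variables (T : eqType) (ind : pred (seq T)) (Ps : seq (seq T)).

(** The classes meet every tight set in as many elements as possible, so the bases of maximal [cval]
    weight are those that are maximal on all tight sets at once: the common face. *)
Definition cval (tights : seq (seq T)) (e : T) := size [seq A <- tights | e \in A].
Definition support_parts (cls : seq (class T)) :=
  [seq ([seq e <- Q | 0 < wt cls e], 1) | Q <- Ps].
(** The covering algorithm itself finds the transversal: run on the face with total weight 1 and
    demand 1 for the support of each part. *)
Definition pick_base (cls : seq (class T)) (tights : seq (seq T)) : seq T :=
  casel (run_rado (face ind (cval tights) (casel cls [::] (fun c _ => c.1)))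
    (support_parts cls) 1).2 [::] (fun c _ => c.1).
Definition dec_state := (seq (class T) * (seq (seq T) * seq (class T)))%type.
(** Earlier output is multiplied by the new denominator, which keeps all weights integral. *)
Definition dec_update (st : dec_state) S (y : newton_state T) : dec_state :=
  (y.2.2.2, (y.2.1 ++ st.2.1, (S, y.1.1) :: [seq (c.1, y.1.2 * c.2) | c <- st.2.2])).
Definition dec_with (st : dec_state) S := dec_update st S (newton ind (flatten Ps) st.1 S).
Definition dec_step (st : dec_state) := dec_with st (pick_base st.1 st.2.1).
Definition dec_cond (st : dec_state) := casel st.1 false (fun _ _ => true).
End DecDefs.

Lemma sumn_cval (T : eqType) tights (X : seq T) :
  sumn (map (cval tights) X) = sumn [seq size [seq x <- X | x \in A] | A <- tights].
Proof.
elim: X => [|x X IH] /=; first by elim: tights => //= A t <-.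
rewrite IH /cval; elim: tights {IH} => //= A t IH.
by case: (x \in A) => /=; lia.
Qed.

Lemma sumn_eq_le (A : eqType) (f g : A -> nat) s : (forall x, x \in s -> f x <= g x) ->
  sumn (map f s) = sumn (map g s) -> forall x, x \in s -> f x = g x.
Proof.
elim: s => //= y s IH h e x.
have h1 z : z \in s -> f z <= g z by move=> hz; apply: h; rewrite inE hz orbT.
have := leq_sumn h1; have := h y (mem_head _ _) => h2 h3.
rewrite inE => /orP[/eqP->|]; first by lia.
by apply: IH => //; lia.
Qed.

Section Pick.
Variables (T : eqType) (ind : pred (seq T)) (Ps : seq (seq T)).
Let E := flatten Ps.
Hypothesis uE : uniq E.
Hypothesis indM : list_matroid E ind.
Hypothesis rank : forall X, indep E ind X -> size X <= size Ps.
Variables (cls : seq (class T)) (tights : seq (seq T)).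
Hypothesis cls_ok : forall c, c \in cls -> indep E ind c.1 /\ 0 < c.2.
Hypothesis cls_part : forall Q, Q \in Ps -> cov cls Q = mass cls.

Lemma cov_ground : cov cls E = mass cls * size Ps.
Proof.
by rewrite cov_flatten // (sumn_map_const cls_part).
Qed.

Lemma size_ground (X : seq T) : {subset X <= E} -> size [seq x <- X | x \in E] = size X.
Proof. by move=> h; congr size; apply/all_filterP/allP. Qed.

(** The coverage of the ground set attains the mass times the rank bound, so every single class
    attains the bound. *)
Lemma base_size c : c \in cls -> size c.1 = size Ps.
Proof.
move=> hc; have hE c' : c' \in cls -> {subset c'.1 <= E} by case/cls_ok=> -[].
rewrite -(size_ground (hE c hc)); apply: cov_tight cov_ground _ hc.
  by move=> c' /cls_ok[].
by move=> c' hc'; rewrite size_ground; [apply: rank; have [] := cls_ok hc'|apply: hE].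
Qed.

Lemma cov_support Q : cov cls [seq e <- Q | 0 < wt cls e] = cov cls Q.
Proof.
rewrite /cov; congr sumn; apply/eq_in_map => c hc; congr (_ * size _).
apply: eq_in_filter => x xc; rewrite mem_filter (wt_gt0 hc) //.
by have [] := cls_ok hc.
Qed.

Lemma support_ground : flatten [seq p.1 | p <- support_parts Ps cls] = [seq e <- E | 0 < wt cls e].
Proof. by rewrite /support_parts -map_comp /E filter_flatten. Qed.

Lemma support_uniq : uniq (flatten [seq p.1 | p <- support_parts Ps cls]).
Proof. by rewrite support_ground filter_uniq. Qed.

Hypothesis cls_tight : forall A c X, A \in tights -> c \in cls -> indep E ind X ->
  size [seq x <- X | x \in A] <= size [seq x <- c.1 | x \in A].
Hypothesis cls_nonempty : cls <> [::].

Let S := pick_base ind Ps cls tights.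

(** The given classes are bases in the face that cover each part once on average. If the run failed,
    every class would meet the failing set in fewer elements than it has parts, against this
    average. [face_max] turns the solution into a base of maximal weight, which is therefore tight
    on each recorded set. *)
Lemma pick_ok : [/\ indep E ind S, forall Q, Q \in Ps -> size [seq x <- S | x \in Q] = 1,
  forall e, e \in S -> 0 < wt cls e &
  forall A c, A \in tights -> c \in cls -> size [seq x <- S | x \in A] = size [seq x <- c.1 | x \in A]].
Proof.
case E1: cls cls_nonempty => [//|c0 cs] _; rewrite -E1.
have hc0 : c0 \in cls by rewrite E1 mem_head.
set G := c0.1; have [hG w0] := cls_ok hc0; rewrite -/G in hG.
set val := cval tights.
have Gcard X : indep E ind X -> size X <= size G.
  by move=> hX; rewrite (base_size hc0) rank.
have wle c X : c \in cls -> indep E ind X -> sumn (map val X) <= sumn (map val c.1).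
  by move=> hc hX; rewrite /val !sumn_cval; apply: leq_sumn => A hA; apply: cls_tight.
have Gmax X : indep E ind X -> sumn (map val X) <= sumn (map val G) by apply: wle.
have fM := list_matroid_face indM val hG.
pose sp := support_parts Ps cls.
have sE : {subset flatten [seq p.1 | p <- sp] <= E}.
  by move=> x; rewrite support_ground mem_filter => /andP[].
have fM' := list_matroid_subset sE fM.
set st := run_rado (face ind val G) sp 1.
have [inv stop _] := run_rado_ok 1 support_uniq fM'; rewrite -/st in inv stop.
have m0 : 0 < mass cls by apply: leq_trans w0 (mass_ge hc0).
have supne : all (fun p => p.1 != [::]) sp.
  apply/allP => p /mapP[Q hQ -> /=]; apply/eqP => h0.
  have := cov_support Q; rewrite h0 (cls_part hQ).
  have -> : cov cls [::] = 0 by exact: (cov_flatten cls (Qs := [::]) isT).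
  by move=> h; rewrite -h in m0.
have cface c : c \in cls -> indep (flatten [seq p.1 | p <- sp]) (face ind val G) c.1.
  move=> hc; have [[uc cE ic] wc] := cls_ok hc; split=> //.
    by move=> x xc; rewrite support_ground mem_filter (wt_gt0 hc wc xc) cE.
  have hi : indep E ind c.1 by [].
  apply: (max_in_face indM hG Gcard Gmax hi); first by rewrite !base_size.
  by apply/eqP; rewrite eqn_leq !wle.
have hsol : solved st.1.
  apply/negPn/negP => uns; set A := failset st.1.
  pose J := [seq p <- sp | has (fun x => x \in A) p.1].
  have hJ : sumn [seq p.2 | p <- J] = size J.
    rewrite (sumn_map_const (b := 1)) ?mul1n // => p; rewrite mem_filter.
    by move=> /andP[_ /mapP[Q _ ->]].
  have hlt c : c \in cls -> size [seq x <- c.1 | x \in A] < size J.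
    move=> hc; have := failset_lt support_uniq fM' inv stop uns supne (cface c hc).
    by rewrite mul1n -/J hJ.
  have h1 : cov cls A <= mass cls * (size J).-1.
    by apply: cov_le => c /hlt; case: (size J).
  have h2 : mass cls * size J <= cov cls A.
    have sub : {subset flatten [seq p.1 | p <- J] <= A}.
      move=> x /flattenP[Q /mapP[p]]; rewrite mem_filter => /andP[/hasP[y yp yA] hp] -> xp.
      exact: failset_part support_uniq inv hp yp xp yA.
    apply: leq_trans (cov_sub cls sub); rewrite cov_flatten; last first.
      exact: subseq_uniq (subseq_flatten_filter _ _ _) support_uniq.
    rewrite -map_comp (sumn_map_const (b := mass cls)) // => p.
    rewrite mem_filter => /andP[_ /mapP[Q hQ -> /=]].
    by rewrite cov_support cls_part.
  have := leq_trans h2 h1; rewrite leq_pmul2l //.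
  by case: (size J) (hlt c0 hc0) => // j _; rewrite ltnn.
(* The weights are positive and add up to 1, so there is a single class. *)
have [c st2] : exists c, st.2 = [:: c] /\ c.2 = 1.
  have := ri_D inv; have hpos c : c \in st.2 -> 0 < c.2 by move=> hc; have [] := ri_ok inv hc.
  case: (st.2) hpos => [//|c [|c' s]] hpos /=.
    by rewrite addn0 => h; exists c.
  have := hpos c (mem_head _ _); have : 0 < c'.2 by apply: hpos; rewrite !inE eqxx orbT.
  by case: (c'.2) => [|b]; case: (c.2) => [|a] // _ _; rewrite addSn addSn addnS.
case: st2 => st2 c1.
have SE : S = c.1 by rewrite /S /pick_base E1 /= -E1 -/G -/val -/sp -/st st2.
have hS : indep (flatten [seq p.1 | p <- sp]) (face ind val G) S.
  by rewrite SE; have [] := ri_ok inv (c := c) _; rewrite ?st2 ?mem_head.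
case: (hS) => uS sS fS.
have wS e : e \in S -> 0 < wt cls e.
  by move/sS; rewrite support_ground mem_filter => /andP[].
have S1 Q : Q \in Ps -> size [seq x <- S | x \in Q] = 1.
  move=> hQ; have hp : ([seq e <- Q | 0 < wt cls e], 1) \in sp.
    exact: (map_f (fun Q => ([seq e <- Q | 0 < wt cls e], 1))).
  have := solved_cov inv hsol hp; rewrite st2 /cov /= c1 mul1n addn0 -SE => <-.
  congr size; apply: eq_in_filter => x xS; by rewrite mem_filter wS.
have sSE : {subset S <= E} by move=> x /sS /sE.
have sizeS : size S = size G.
  rewrite /G (base_size hc0) -(size_ground sSE) /E size_filter_flatten //.
  by rewrite (sumn_map_const S1) mul1n.
have [hSi wSG] := face_max indM hG Gcard Gmax uS sSE fS sizeS.
split=> // A c' hA hc'; have [hc'i _] := cls_ok hc'.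
have eG : size [seq x <- S | x \in A] = size [seq x <- G | x \in A].
  have := @sumn_eq_le _ (fun B : seq T => size [seq x <- S | x \in B])
     (fun B : seq T => size [seq x <- G | x \in B]) tights; apply => //.
    by move=> B hB; apply: cls_tight.
  by rewrite -!sumn_cval.
apply/eqP; rewrite eqn_leq cls_tight //= eG; exact: cls_tight.
Qed.
End Pick.

Section Triangular.
Import GRing.Theory Num.Theory.
Variables (T : eqType) (E : seq T).
Hypothesis uE : uniq E.

Lemma size_inter_sum (S A : seq T) : uniq S -> {subset S <= E} ->
  size [seq x <- S | x \in A] = \sum_(e <- E) (e \in A) * (e \in S).
Proof.
move=> uS SE.
have -> : size [seq x <- S | x \in A] = size [seq e <- E | (e \in A) && (e \in S)].
  apply/perm_size/uniq_perm; rewrite ?filter_uniq // => x; rewrite !mem_filter.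
  by case xS: (x \in S); rewrite ?andbF //= (SE x xS) !andbT.
by rewrite size_filter -sum1_count big_mkcond; apply: eq_bigr => e _; case: (_ \in A); case: (_ \in S).
Qed.

(* The affine functionals X |-> #|X :&: A_i| - r_i vanish at the S_j that are newer
   than A_i but not at S_i: a triangular matrix of rank at most size E + 1. *)
Lemma triangular_bound (h : seq (seq T * (nat * seq T))) :
  (forall a, a \in h -> uniq a.2.2 /\ {subset a.2.2 <= E}) ->
  pairwise (fun b a => size [seq x <- b.2.2 | x \in a.1] == a.2.1) h ->
  (forall a, a \in h -> size [seq x <- a.2.2 | x \in a.1] != a.2.1) ->
  size h <= (size E).+1.
Proof.
move=> hS hP hD; pose d0 : seq T * (nat * seq T) := ([::], (0, [::])).
case: (posnP (size h)) => [->//|h0].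
(* An element serves as the default of [nth]; the empty ground set is treated at the end. *)
have [[e0 _]|E0] : {e0 : T | true} + {E = [::]}.
  by case: (E) => [|e E']; [right|left; exists e].
  pose A : 'M[rat]_(size h, (size E).+1) := (\matrix_(i, l)
    if (l < size E)%N then (nth e0 E l \in (nth d0 h i).1)%:R else - ((nth d0 h i).2.1)%:R)%R.
  pose B : 'M[rat]_((size E).+1, size h) := (\matrix_(l, j)
    if (l < size E)%N then (nth e0 E l \in (nth d0 h j).2.2)%:R else 1)%R.
  have hM i j : ((A *m B)%R i j = (size [seq x <- (nth d0 h j).2.2 | x \in (nth d0 h i).1])%:R
      - ((nth d0 h i).2.1)%:R)%R.
    rewrite mxE big_ord_recr /= !mxE ltnn mulr1; congr (_ + _)%R.
    have [uS SE] := hS _ (mem_nth d0 (ltn_ord j)).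
    rewrite (size_inter_sum _ uS SE) (big_nth e0) big_mkord natr_sum; apply: eq_bigr => l _.
    by rewrite !mxE /= !ltn_ord natrM.
  have tr : is_trig_mx ((A *m B)^T)%R.
    apply/is_trig_mxP => i j ij; rewrite mxE hM.
    have := pairwiseP d0 hP i j; rewrite !inE => /(_ (ltn_ord i) (ltn_ord j) ij)/eqP->.
    by rewrite subrr.
  have du : (A *m B)%R \in unitmx.
    rewrite -unitmx_tr unitmxE (det_trig tr) unitfE prodf_seq_neq0; apply/allP => i _ /=.
    rewrite mxE hM subr_eq0 eqr_nat; exact: hD (mem_nth _ _).
  have := mxrankM_maxr A B; rewrite mxrank_unit // => h1.
  exact: leq_trans h1 (rank_leq_row B).
rewrite E0 /=; case: h h0 hS hP hD => [//|a [//|b h]] _ hS hP hD.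
have [_ sa] := hS a (mem_head _ _).
have [_ sb] := hS b (mem_behead (s := a :: b :: h) (mem_head _ _)).
have z c : {subset c <= E} -> c = [::].
  by rewrite E0; case: c => // x c /(_ x (mem_head _ _)).
have := hD b (mem_behead (s := a :: b :: h) (mem_head _ _)).
by move: hP; rewrite /= (z _ sa) (z _ sb) /= => /andP[/andP[/eqP<- _] _].
Qed.
End Triangular.

(** * Invariant and progress of the decomposition *)

Section Dec.
Variables (T : eqType) (ind : pred (seq T)) (Ps : seq (seq T)).
Let E := flatten Ps.
Hypothesis uE : uniq E.
Hypothesis indM : list_matroid E ind.
Hypothesis rank : forall X, indep E ind X -> size X <= size Ps.
Variables (x0 : T -> nat) (D0 K M : nat).
Hypothesis hK : rado_bound (size E) (size E) <= K.

(** Support, room left for tight sets according to [triangular_bound], and a flag that pays for a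
    round using up the whole mass. *)
Definition dec_measure (st : dec_state T) :=
  size [seq e <- flatten Ps | 0 < wt st.1 e] + ((size (flatten Ps)).+2 - size st.2.1) + (0 < size st.1).

(** The entry [(A, (r, S))] records a tight set [A], its rank [r] and the transversal [S] whose
    subtraction made it tight. That [S] itself is not tight on [A] gives the nonzero diagonal in
    [triangular_bound]. *)
Definition hist_ok (cls : seq (class T)) (a : seq T * (nat * seq T)) :=
  [/\ forall X, indep E ind X -> size [seq x <- X | x \in a.1] <= a.2.1,
      forall c, c \in cls -> size [seq x <- c.1 | x \in a.1] = a.2.1,
      uniq a.2.2 /\ uniq a.1, {subset a.2.2 <= E} /\ {subset a.1 <= E} & size [seq x <- a.2.2 | x \in a.1] != a.2.1].

(** By [di_scale], output and remainder together are always a multiple of the original weights. By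
    [di_mass], a round multiplies the mass by at most [size E + 1], so polynomially many rounds
    leave weights of polynomial bit size. *)
Record dec_inv (st : dec_state T) : Prop := DecInv {
  di_ok : forall c, c \in st.1 -> indep E ind c.1 /\ 0 < c.2;
  di_part : forall Q, Q \in Ps -> cov st.1 Q = mass st.1;
  di_hist : exists h, [/\ [seq a.1 | a <- h] = st.2.1, forall a, a \in h -> hist_ok st.1 a
    & pairwise (fun b a => size [seq x <- b.2.2 | x \in a.1] == a.2.1) h];
  di_out : forall c, c \in st.2.2 ->
    indep E ind c.1 /\ forall Q, Q \in Ps -> size [seq x <- c.1 | x \in Q] = 1;
  di_scale : exists2 s, 0 < s & mass st.2.2 + mass st.1 = s * D0 /\
    forall e, e \in E -> wt st.2.2 e + wt st.1 e = s * x0 e;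
  di_size : size st.1 <= K;
  di_mass : mass st.2.2 + mass st.1 <= D0 * (size E).+1 ^ size st.2.2;
  di_count : size st.2.2 + dec_measure st <= M }.

Lemma size_mem1 (S : seq T) e : uniq S -> size [seq x <- S | x \in [:: e]] = (e \in S).
Proof.
move=> uS; rewrite size_filter (eq_count (a2 := pred1 e)) ?count_uniq_mem // => x.
by rewrite inE.
Qed.

Lemma tights_bound (st : dec_state T) : dec_inv st -> size st.2.1 <= (size E).+1.
Proof.
move=> inv; have [h [<- h2 h3]] := di_hist inv; rewrite size_map.
by apply: (triangular_bound uE) h3 _ => a /h2[_ _ [? _] [? _]].
Qed.

Section Step.
Variable st : dec_state T.
Hypothesis inv : dec_inv st.
Hypothesis cond : dec_cond st.
Let S := pick_base ind Ps st.1 st.2.1.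
Let y := newton ind E st.1 S.
Let p := y.1.1.
Let q := y.1.2.
Let cls' := y.2.2.2.

Let nonempty : exists c, c \in st.1.
Proof. by case: st cond => [[|c s] o] //= _; exists c; rewrite mem_head. Qed.

Let tight A c X : A \in st.2.1 -> c \in st.1 -> indep E ind X ->
  size [seq x <- X | x \in A] <= size [seq x <- c.1 | x \in A].
Proof.
have [h [<- hh _]] := di_hist inv; move=> /mapP[a ha ->] hc hX.
by have [h1 h2 _ _ _] := hh a ha; rewrite h2 // h1.
Qed.

Let ne : st.1 <> [::]. Proof. by case: nonempty => c + e; rewrite e. Qed.

Let hpick := pick_ok uE indM rank (di_ok inv) (di_part inv) tight ne.
Let hS : indep E ind S. Proof. by case: hpick. Qed.
Let S1 Q : Q \in Ps -> size [seq x <- S | x \in Q] = 1. Proof. by case: hpick => _ h _ _; apply: h. Qed.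
Let sS : size S = size Ps.
Proof.
case: hS => _ sE _; rewrite -(size_ground sE) /E size_filter_flatten //.
by rewrite (sumn_map_const S1) mul1n.
Qed.
Let indcls c : c \in st.1 -> indep E ind c.1. Proof. by case/(di_ok inv). Qed.
Let covE : cov st.1 E = mass st.1 * size Ps.
Proof. exact: (cov_ground uE (di_part inv)). Qed.

Let ynew : newton_inv ind E st.1 S y /\ solved y.2.2.1.
Proof. exact: (newton_ok uE indM indcls covE hS sS). Qed.
Let ratio : ratio_ok st.1 S p q. Proof. by case: ynew => -[]. Qed.
Let q0 : 0 < q. Proof. by case: ratio. Qed.
Let pm : p <= q * mass st.1. Proof. by case: ratio. Qed.
Let yst : y.2.2 = peel ind E st.1 S p q. Proof. by case: ynew => -[]. Qed.
Let sol : solved (peel ind E st.1 S p q).1. Proof. by rewrite -yst; case: ynew. Qed.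

Let cls'_ok c : c \in cls' -> indep E ind c.1 /\ 0 < c.2.
Proof. rewrite /cls' yst; exact: (peel_indep uE indM). Qed.
Let cls'_mass : mass cls' = q * mass st.1 - p.
Proof. rewrite /cls' yst; exact: (peel_mass uE indM). Qed.
Let cls'_cov A : cov cls' A + p * size [seq x <- S | x \in A] = q * cov st.1 A.
Proof. rewrite /cls' yst; exact: (peel_solved_cov uE indM indcls covE hS sS ratio A sol). Qed.
Let cls'_wt e : e \in E -> wt cls' e = q * wt st.1 e - (if e \in S then p else 0).
Proof. rewrite /cls' yst; exact: (peel_solved_wt uE indM sol). Qed.

Let st' := dec_step ind Ps st.

Let st'E : st' = (cls', (y.2.1 ++ st.2.1, (S, p) :: [seq (c.1, q * c.2) | c <- st.2.2])).
Proof. by []. Qed.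

Lemma cov_scale (out : seq (class T)) A : cov [seq (c.1, q * c.2) | c <- out] A = q * cov out A.
Proof. by rewrite /cov -map_comp; elim: out => [|c s IH] /=; rewrite ?muln0 // mulnDr -IH mulnA. Qed.

Lemma mass_scale (out : seq (class T)) : mass [seq (c.1, q * c.2) | c <- out] = q * mass out.
Proof. by rewrite /mass -map_comp; elim: out => [|c s IH] /=; rewrite ?muln0 // mulnDr -IH. Qed.

Lemma step_mass : mass st'.2.2 + mass st'.1 = q * (mass st.2.2 + mass st.1).
Proof.
rewrite st'E /= cls'_mass {1}/mass /= -/(mass [seq (c.1, q * c.2) | c <- st.2.2]) mass_scale.
by rewrite mulnDr; move: pm; lia.
Qed.

Lemma dec_newton : [/\ forall c, c \in st.1 -> indep E ind c.1,
  cov st.1 E = mass st.1 * size S & indep E ind S].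
Proof. by rewrite sS; split; [exact: indcls|exact: covE|exact: hS]. Qed.

(** Tight sets stay tight: [S] and all old classes meet [A] in [r] elements, so the new classes do
    on average, and none of them can exceed [r]. *)
Lemma old_hist a : a.1 \in st.2.1 -> hist_ok st.1 a -> hist_ok cls' a /\
  size [seq x <- S | x \in a.1] = a.2.1.
Proof.
move=> ha [h1 h2 h3 h4 h5]; have [c hc] := nonempty.
have hSa : size [seq x <- S | x \in a.1] = a.2.1.
  by case: hpick => _ _ _ h; rewrite (h _ c) // h2.
split=> //; split=> //; apply: cov_tight.
- by move=> c' /cls'_ok[].
- by move=> c' /cls'_ok[hc' _]; apply: h1.
have := cls'_cov a.1; rewrite hSa (cov_eq h2) cls'_mass mulnBl mulnA => <-.
by rewrite addnK.
Qed.

(** The ratio was chosen to make the obstruction tight for the remainder, whereas [S] misses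
    tightness by the positive denominator [q]. *)
Lemma new_hist A r : obstruction ind E st.1 S y A r -> hist_ok cls' (A, (r, S)).
Proof.
move=> [[_ [uA sA]] h1 h2 h3]; case: (hS) => uS sE _; split=> //=; last first.
  by rewrite -h3; move: q0; rewrite /q; lia.
apply: cov_tight.
- by move=> c' /cls'_ok[].
- by move=> c' /cls'_ok[hc' _]; apply: h1.
have := cls'_cov A; rewrite cls'_mass; move: h2 h3; rewrite -/p -/q.
move: (size _) (cov cls' A) (cov st.1 A) (mass st.1) pm; clear => s a b t.
move=> pm h2 h3 h; rewrite mulnBl -mulnA -h2 -h3 mulnDr -h !mulnDr.
rewrite (mulnC q p); lia.
Qed.

Lemma support_le : size [seq e <- E | 0 < wt cls' e] <= size [seq e <- E | 0 < wt st.1 e].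
Proof.
rewrite !size_filter; apply: sub_in_count => e eE; rewrite cls'_wt //.
by case: (posnP (wt st.1 e)) => // ->; rewrite muln0 sub0n.
Qed.

Lemma support_lt e : e \in S -> q = 1 -> wt st.1 e = p ->
  size [seq e <- E | 0 < wt cls' e] < size [seq e <- E | 0 < wt st.1 e].
Proof.
move=> eS q1 we; have eE : e \in E by case: hS => _ h _; apply: h.
have we0 : 0 < wt st.1 e by case: hpick => _ _ h _; apply: h.
have -> : size [seq e <- E | 0 < wt st.1 e] =
    (size [seq f <- [seq e <- E | 0 < wt st.1 e] | f != e]).+1.
  by rewrite size_filter_neq ?filter_uniq // mem_filter we0.
rewrite ltnS -filter_predI !size_filter; apply: sub_in_count => f fE /= hf.
apply/andP; split.
  by apply: contraTneq hf => ->; rewrite cls'_wt // eS q1 mul1n we subnn.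
by move: hf; rewrite cls'_wt //; case: (posnP (wt st.1 f)) => // ->; rewrite muln0 sub0n.
Qed.

Lemma step_hist : exists h, [/\ [seq a.1 | a <- h] = st'.2.1, forall a, a \in h -> hist_ok cls' a
    & pairwise (fun b a => size [seq x <- b.2.2 | x \in a.1] == a.2.1) h].
Proof.
have [h [h1 h2 h3]] := di_hist inv.
have old a : a \in h -> hist_ok cls' a /\ size [seq x <- S | x \in a.1] = a.2.1.
  by move=> ha; apply: old_hist (h2 a ha); rewrite -h1 map_f.
have [[_ _ _ ht] _] := ynew.
rewrite st'E /=; case: ht => [[-> _]|[A [r hob]]].
  by exists h; split=> // a /old[].
exists ((A, (r, S)) :: h); split.
- by case: (hob) => -[-> _] _ _ _ /=; rewrite h1.
- by move=> a; rewrite inE => /orP[/eqP->|/old[]//]; apply: new_hist.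
rewrite /= h3 andbT; apply/allP => a ha /=; by have [_ ->] := old a ha.
Qed.

(** A new tight set uses up room. Otherwise the initial ratio was accepted: if the mass attains the
    minimum, the remainder becomes empty; if the weight of some element does, that element leaves
    the support. *)
Lemma step_measure : dec_measure st' < dec_measure st.
Proof.
have flag : (0 < size st.1) = true by case: nonempty => c; case: st.1.
have [h [h1 h2 h3]] := step_hist.
have hb : size st'.2.1 <= (size E).+1.
  rewrite -h1 size_map; apply: (triangular_bound uE) h3 _.
    by move=> a /h2[_ _ [? _] [? _]].
  by move=> a /h2[].
have [[_ _ _ ht] _] := ynew.
have hsup := support_le; have hfl : (0 < size st'.1) <= 1 by case: (0 < _).
rewrite /dec_measure flag -/E; move: hb hfl; rewrite st'E /= size_cat => hb hfl.
case: ht => [[e1 [e2 e3]]|[A [r [[e1 _] _ _ _]]]]; last first.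
  by rewrite e1 /= in hb *; move: hsup hfl hb; rewrite add1n; lia.
rewrite e1 /= add0n; rewrite -/p -/q in e2 e3.
have [e4|e4] := foldr_minn_case (mass st.1) [seq wt st.1 e | e <- S].
  have : mass cls' = 0 by rewrite cls'_mass e2 mul1n e3 e4 subnn.
  case E1: cls' hsup => [|c s] hsup /=; first by move: hsup; lia.
  have [|_ c0] := cls'_ok (c := c) _; first by rewrite E1 mem_head.
  by rewrite /mass /= => /eqP; rewrite addn_eq0 => /andP[/eqP c00]; rewrite c00 in c0.
move: e4; rewrite -e3 => /mapP[e eS we]; have := support_lt eS e2 (esym we).
by move: hfl; lia.
Qed.

Lemma dec_step_inv : dec_inv st'.
Proof.
have [[_ hq _ _] _] := ynew.
split.
- exact: cls'_ok.
- move=> Q hQ; have := cls'_cov Q; rewrite S1 // (di_part inv hQ) cls'_mass muln1.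
  by rewrite st'E /=; lia.
- exact: step_hist.
- move=> c; rewrite st'E /= inE => /orP[/eqP->//|/mapP[c' hc' -> /=]]; exact: (di_out inv hc').
- have [s s0 [hs1 hs2]] := di_scale inv; exists (q * s); first by rewrite muln_gt0 q0.
  split; first by rewrite step_mass hs1 mulnA.
  move=> e eE; rewrite st'E /= {1}/wt cov_cons /= cov_scale cls'_wt // -/(wt _ e).
  case: (hS) => uS _ _; rewrite size_mem1 // -mulnA -hs2 // mulnDr.
  have [_ _ hp] := ratio; case eS: (e \in S); last by rewrite muln0; lia.
  by have := hp e eS; lia.
- rewrite st'E /= /cls' yst; have [_ _ h] := peel_ok uE indM st.1 S p q.
  exact: leq_trans h hK.
- rewrite step_mass st'E /= size_map expnS mulnCA leq_mul //; exact: (di_mass inv).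
- have := di_count inv; have := step_measure; rewrite {2}st'E /= size_map; lia.
Qed.
End Step.

Lemma dec_init_inv cls : (forall c, c \in cls -> indep E ind c.1 /\ 0 < c.2) ->
  (forall Q, Q \in Ps -> cov cls Q = mass cls) -> mass cls = D0 ->
  (forall e, e \in E -> wt cls e = x0 e) -> size cls <= K ->
  dec_measure (cls, ([::], [::])) <= M -> dec_inv (cls, ([::], [::])).
Proof.
move=> h1 h2 h3 h4 h5 h6; split=> //=.
- by exists [::].
- by exists 1 => //; split=> [|e eE]; rewrite mul1n ?h3 // -h4.
- by rewrite expn0 muln1 -h3.
Qed.
End Dec.

(** * Running time of the decomposition *)

Section DecTime.
Context (A : Type) {eA : encodable A} (P : oracle -> A -> Prop).

Lemma ptime_cov (f : oracle -> A -> seq (class elt)) (g : oracle -> A -> seq elt) :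
  ptime P f -> ptime P g -> ptime P (fun O x => cov (f O x) (g O x)).
Proof. apply: (ptime_app2 (h := fun _ a b => cov a b)); rewrite /cov; pt. Qed.

Lemma ptime_mass (f : oracle -> A -> seq (class elt)) :
  ptime P f -> ptime P (fun O x => mass (f O x)).
Proof. apply: (ptime_app1 (h := fun _ a => mass a)); rewrite /mass; pt. Qed.

Lemma ptime_cval (f : oracle -> A -> seq (seq elt)) (g : oracle -> A -> elt) :
  ptime P f -> ptime P g -> ptime P (fun O x => cval (f O x) (g O x)).
Proof. apply: (ptime_app2 (h := fun _ a b => cval a b)); rewrite /cval; pt. Qed.
End DecTime.

Lemma ptime_wt (A : Type) {eA : encodable A} (P : oracle -> A -> Prop)
    (f : oracle -> A -> seq (class elt)) (g : oracle -> A -> elt) :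
  ptime P f -> ptime P g -> ptime P (fun O x => wt (f O x) (g O x)).
Proof.
apply: (ptime_app2 (h := fun _ a b => wt a b)); rewrite /wt.
by apply: ptime_cov; pt.
Qed.

Ltac ptime_user ::= first
  [ eapply ptime_idx | apply ptime_lev | apply ptime_rado_init | apply ptime_solved
  | apply ptime_failset | apply ptime_rado_cond | apply ptime_cov | apply ptime_mass
  | apply ptime_wt | apply ptime_cval ].

Lemma esize_subset (T : eqType) {eT : encodable T} (E S : seq T) s :
  uniq S -> {subset S <= E} -> (forall e, e \in E -> esize e <= s) ->
  esize S <= 2 + size E * s.+1.
Proof.
move=> uS SE hs; apply: leq_trans (esize_seq_le (b := s) _) _; first by move=> e /SE /hs.
by rewrite leq_add2l leq_mul2r (uniq_leq_size uS SE) orbT.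
Qed.

Lemma esize_exp (a b : nat) : esize (a ^ b) <= 2 + b * esize a.
Proof.
elim: b => [|b IH]; first by rewrite expn0 esize_nat trunc_log1.
rewrite expnS mulSn; pose proof (esize_natM a (a ^ b)); lia.
Qed.

Section Loops.
Context (G : Type) {eG : encodable G} (indf : oracle -> G -> seq elt -> bool).
Hypothesis hind : ptime total (fun O y => indf O y.1 y.2).

Definition ground_ok (O : oracle) (g : G) (E : seq elt) := uniq E /\ list_matroid E (indf O g).

Lemma ptime_peel (A : Type) {eA : encodable A} (P : oracle -> A -> Prop)
    (fg : oracle -> A -> G) (fE : oracle -> A -> seq elt) (fc : oracle -> A -> seq (class elt))
    (fS : oracle -> A -> seq elt) (fp fq : oracle -> A -> nat) :
  ptime P fg -> ptime P fE -> ptime P fc -> ptime P fS -> ptime P fp -> ptime P fq ->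
  (forall O x, P O x -> ground_ok O (fg O x) (fE O x)) ->
  ptime P (fun O x => peel (indf O (fg O x)) (fE O x) (fc O x) (fS O x) (fp O x) (fq O x)).
Proof.
move=> hg hE hc hS hp hq hP.
pose X : Type := (G * (seq elt * (seq (class elt) * (seq elt * (nat * nat)))))%type.
apply: (ptime_comp (f := fun O x => (fg O x, (fE O x, (fc O x, (fS O x, (fp O x, fq O x))))))
  (Q := fun O (x : X) => ground_ok O x.1 x.2.1)
  (g := fun O (x : X) => peel (indf O x.1) x.2.1 x.2.2.1 x.2.2.2.1 x.2.2.2.2.1 x.2.2.2.2.2)) => //.
  by repeat apply: ptime_pair.
apply: (ptime_comp (f := fun O (x : X) => (x.1,
    (demands x.2.1 x.2.2.1 x.2.2.2.1 x.2.2.2.2.1 x.2.2.2.2.2,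
     x.2.2.2.2.2 * mass x.2.2.1 - x.2.2.2.2.1))) _ (ptime_run_rado hind)).
  by rewrite /demands; pt.
by move=> O x [u m]; split; rewrite /= flatten_demands.
Qed.

Let NX : Type := (G * (seq elt * (seq (class elt) * seq elt)))%type.
Let NS : Type := (NX * newton_state (Datatypes_prod__canonical__eqtype_Equality nat nat))%type.

Definition newton_dom (O : oracle) (x : NX) :=
  [/\ ground_ok O x.1 x.2.1, forall c, c \in x.2.2.1 -> indep x.2.1 (indf O x.1) c.1,
      cov x.2.2.1 x.2.1 = mass x.2.2.1 * size x.2.2.2 & indep x.2.1 (indf O x.1) x.2.2.2].

Lemma esize_seq1 (B : Type) {eB : encodable B} (b : B) : esize [:: b] = (esize b).+3.
Proof. by rewrite esize_cons esize_nil; lia. Qed.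

Lemma ptime_newton_loop : ptime
  (fun O (z : NS) => newton_dom O z.1 /\
     z.2 = newton_init (indf O z.1.1) z.1.2.1 z.1.2.2.1 z.1.2.2.2)
  (fun O z => loop (size z.1.2.1) (fun z => newton_cond z.2)
     (fun z => (z.1, newton_step (indf O z.1.1) z.1.2.1 z.1.2.2.1 z.1.2.2.2 z.2)) z).
Proof.
pose mu (z : NS) := if solved z.2.2.2.1 then 0
  else newton_rank z.2 - size [seq x <- z.1.2.2.2 | x \in failset z.2.2.2.1].
pose Inv O (z0 z : NS) := z.1 = z0.1 /\
  newton_inv (indf O z0.1.1) z0.1.2.1 z0.1.2.2.1 z0.1.2.2.2 z.2.
apply: (ptime_loop (Q := fun O z => newton_dom O z.1) (Inv := Inv) (mu := fun _ => mu)
  (c := fun _ (z : NS) => newton_cond z.2)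
  (f := fun O (z : NS) => (z.1, newton_step (indf O z.1.1) z.1.2.1 z.1.2.2.1 z.1.2.2.2 z.2))
  (n := fun _ z => size z.1.2.1)).
- by rewrite /newton_cond; pt.
- rewrite /newton_step /newton_at /newton_rank.
  repeat first [eapply ptime_peel | ptime_step].
  by move=> O z [[h _ _ _] _].
- move=> O z [[[u m] h1 h2 h3] hz]; split=> //; rewrite hz; exact: newton_init_inv.
- by move=> O x z [h _] [-> _].
- move=> O x z [[[u m] h1 h2 h3] _] [h4 h5] hc; rewrite /Inv /mu /= h4.
  by have [h6 h7] := newton_step_inv u m h1 h2 h3 (erefl _) h5 hc.
- move=> O z [[[u m] h1 h2 h3] hz].
  have [hr hq hst ht] := newton_init_inv (indf O z.1.1) z.1.2.1 z.1.2.2.1 z.1.2.2.2.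
  rewrite /mu; case: ifP => // /negbT uns; rewrite hz in uns *; rewrite hst in uns.
  by have [_ h _ _ _] := fail_ratio u m h1 h2 h3 (erefl _) hr uns.
- apply: pbound_s => -[O z] _ /=; apply: leq_trans (size_le_esize _) _.
  by rewrite /esz /= [leqRHS]esize_pair [in leqRHS]esize_pair [in leqRHS]esize_pair; lia.
pose X : Type := (G * (seq elt * (seq (class elt) * (seq elt * (nat * nat)))))%type.
have hpeel : ptime (fun O (x : X) => ground_ok O x.1 x.2.1) (fun O (x : X) =>
    peel (indf O x.1) x.2.1 x.2.2.1 x.2.2.2.1 x.2.2.2.2.1 x.2.2.2.2.2).
  by apply: ptime_peel => //; pt.
have [k0 hk0] := ptime_esize hpeel.
have hmass : ptime total (fun _ (z : NS) => mass z.1.2.2.1) by pt.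
have [k1 hk1] := ptime_esize hmass.
pose P0 (y : oracle * NS) := True.
have s2 : forall y, 2 <= esz (A := NS) y by move=> y; apply: esize_ge2.
have pE : pbound P0 (esz (A := NS)) (fun y => size y.2.1.2.1).
  apply: pbound_s => -[O z] _ /=; apply: leq_trans (size_le_esize _) _.
  by rewrite /esz /= [leqRHS]esize_pair [in leqRHS]esize_pair [in leqRHS]esize_pair; lia.
(* Every ratio met has a denominator of at most [size E + 1] and a numerator of at most the
   denominator times the mass. *)
pose bq (y : oracle * NS) := (size y.2.1.2.1).+3.
pose (bp := fun y : oracle * NS => bq y + esz y ^ k1).
pose (bx := fun y : oracle * NS => (esz y + (bp y + bq y).+1).+4).
have [k hk] : pbound P0 (esz (A := NS)) (fun y => (esz y + ((bp y + bq y).+1 +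
   ((2 + size y.2.1.2.1 * (esz y).+1).+3 + bx y ^ k0).+1).+1).+1).
  have pq : pbound P0 (esz (A := NS)) bq by do 3 apply: pboundS => //.
  have pid := pbound_id P0 (esz (A := NS)).
  have pp : pbound P0 (esz (A := NS)) bp by apply: pboundD => //; apply: pboundX.
  have px : pbound P0 (esz (A := NS)) bx.
    by do 4 apply: pboundS => //; apply: pboundD => //; apply: pboundS => //; apply: pboundD.
  by repeat first [exact: pE | exact: pq | exact: pp | exact: pid | apply: pboundX
    | apply: pboundD | apply: pboundM | apply: pboundS | exact: pbound_const] => //.
exists k => O x z [[[u m] h1 h2 h3] _] [h4 [hr hq hst ht]].
apply: leq_trans (hk (O, x) I); rewrite /=.
have hx1 : esize x.1 <= esize x by rewrite [leqRHS]esize_pair; lia.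
have bq' : esize z.2.1.2 <= bq (O, x).
  by apply: leq_trans (esize_nat_id _) _; rewrite /bq /= !ltnS.
have bp' : esize z.2.1.1 <= bp (O, x).
  have [_ hp _] := hr; apply: leq_trans (esize_nat_le hp) _.
  apply: leq_trans (esize_natM _ _) _; rewrite leq_add //; exact: (hk1 (O, x) I).
rewrite esize_pair h4 ltnS leq_add //.
rewrite esize_pair ltnS leq_add //; first by rewrite esize_pair ltnS leq_add.
rewrite esize_pair ltnS leq_add //.
  case: ht => [[-> _]|[B [r [[-> [uB sB]] _ _ _]]]]; first by rewrite esize_nil; lia.
  rewrite esize_seq1 !ltnS; apply: (esize_subset uB sB) => e he.
  apply: leq_trans hx1; apply: leq_trans (mem_esize he) _.
  by apply: leq_trans (esize_fst _) (esize_snd _).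
rewrite hst.
have := hk0 (O, (x.1.1, (x.1.2.1, (x.1.2.2.1, (x.1.2.2.2, (z.2.1.1, z.2.1.2)))))) (conj u m).
move=> h; apply: leq_trans h _; rewrite /esz /=.
case: (k0) => // k2; rewrite leq_exp2r // !esize_pair /=.
move: bp' bq' hx1; rewrite /bx /esz /= !esize_pair; lia.
Qed.

Lemma ptime_newton :
  ptime newton_dom (fun O x => newton (indf O x.1) x.2.1 x.2.2.1 x.2.2.2).
Proof.
have hl n O (z : NS) : loop n (fun z => newton_cond z.2)
     (fun z => (z.1, newton_step (indf O z.1.1) z.1.2.1 z.1.2.2.1 z.1.2.2.2 z.2)) z =
   (z.1, loop n (@newton_cond _) (newton_step (indf O z.1.1) z.1.2.1 z.1.2.2.1 z.1.2.2.2) z.2).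
  by elim: n z => [|n IH] [x y] //=; case: ifP => // _; rewrite IH.
apply: (ptime_ext (f := fun O (x : NX) => (loop (size (x, newton_init (indf O x.1) x.2.1 x.2.2.1 x.2.2.2).1.2.1)
     (fun z => newton_cond z.2)
     (fun z => (z.1, newton_step (indf O z.1.1) z.1.2.1 z.1.2.2.1 z.1.2.2.2 z.2))
     (x, newton_init (indf O x.1) x.2.1 x.2.2.1 x.2.2.2)).2)).
  by move=> O x _; rewrite hl.
apply: ptime_snd.
apply: (ptime_comp (f := fun O (x : NX) => (x, newton_init (indf O x.1) x.2.1 x.2.2.1 x.2.2.2)) _
   ptime_newton_loop) => //.
rewrite /newton_init; repeat first [eapply ptime_peel | ptime_step].
by move=> O x [].
Qed.
End Loops.

Definition decompose (T : eqType) (ind : pred (seq T)) Ps (cls : seq (class T)) : dec_state T :=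
  loop (dec_measure Ps (cls, ([::], [::]))) (@dec_cond _) (dec_step ind Ps) (cls, ([::], [::])).

Section Decompose.
Variables (T : eqType) (ind : pred (seq T)) (Ps : seq (seq T)).
Hypothesis uE : uniq (flatten Ps).
Hypothesis indM : list_matroid (flatten Ps) ind.
Hypothesis rank : forall X, indep (flatten Ps) ind X -> size X <= size Ps.
Variable cls : seq (class T).
Hypothesis cls_ok : forall c, c \in cls -> indep (flatten Ps) ind c.1 /\ 0 < c.2.
Hypothesis cls_part : forall Q, Q \in Ps -> cov cls Q = mass cls.
Let out := (decompose ind Ps cls).2.2.

Let n := size (flatten Ps).
Let K := size cls + rado_bound n n.
Let hK : rado_bound n n <= K. Proof. exact: leq_addl. Qed.

Lemma dec_start : dec_inv ind Ps (wt cls) (mass cls) K (dec_measure Ps (cls, ([::], [::])))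
  (cls, ([::], [::])).
Proof. by apply: dec_init_inv => //; apply: leq_addr. Qed.

Lemma decompose_ok :
  (forall c, c \in out -> indep (flatten Ps) ind c.1 /\
     forall Q, Q \in Ps -> size [seq x <- c.1 | x \in Q] = 1) /\
  exists2 s, 0 < s & mass out = s * mass cls /\
    forall e, e \in flatten Ps -> wt out e = s * wt cls e.
Proof.
have [inv stop] : dec_inv ind Ps (wt cls) (mass cls) K (dec_measure Ps (cls, ([::], [::])))
    (decompose ind Ps cls) /\ dec_cond (decompose ind Ps cls) = false.
  apply: (loopP (mu := dec_measure Ps)) => //; last exact: dec_start.
  move=> st hi hc; split; first exact: (dec_step_inv uE indM rank hK hi hc).
  exact: (step_measure uE indM rank hK hi hc).
split; first exact: (di_out inv).
have [s s0 [h1 h2]] := di_scale inv; exists s => //.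
have e0 : (decompose ind Ps cls).1 = [::] by case: (decompose ind Ps cls) stop => -[].
rewrite e0 /mass /= addn0 in h1; split=> // e he.
by rewrite -h2 // e0 /wt {2}/cov /= addn0.
Qed.
End Decompose.

Section DecLoop.
Context (G : Type) {eG : encodable G} (indf : oracle -> G -> seq elt -> bool).
Hypothesis hind : ptime total (fun O y => indf O y.1 y.2).

Definition env_ok (O : oracle) (g : G) (Ps : seq (seq elt)) :=
  [/\ uniq (flatten Ps), list_matroid (flatten Ps) (indf O g) &
      forall X, indep (flatten Ps) (indf O g) X -> size X <= size Ps].

Let DX : Type := (G * (seq (seq elt) * (seq (class elt) * (seq (seq elt) * seq (class elt)))))%type.

Definition step_dom (O : oracle) (x : DX) := env_ok O x.1 x.2.1 /\ dec_cond x.2.2 /\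
  exists x0 D0 K M, rado_bound (size (flatten x.2.1)) (size (flatten x.2.1)) <= K /\
    dec_inv (indf O x.1) x.2.1 x0 D0 K M x.2.2.

Let facef (O : oracle) (g : G * (seq (seq elt) * seq elt)) (J : seq elt) :=
  face (indf O g.1) (cval g.2.1) g.2.2 J.

Lemma ptime_facef : ptime total (fun O y => facef O y.1 y.2).
Proof.
rewrite /facef /face; repeat first [eapply (ptime_indf hind) | ptime_step].
Qed.

Lemma ptime_pick : ptime step_dom (fun O x => pick_base (indf O x.1) x.2.1 x.2.2.1 x.2.2.2.1).
Proof.
pose hd (x : DX) := casel x.2.2.1 [::] (fun c (_ : seq (class elt)) => c.1).
have h : ptime step_dom (fun O x => run_rado (facef O (x.1, (x.2.2.2.1, hd x)))
    (support_parts x.2.1 x.2.2.1) 1).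
  apply: (ptime_comp (f := fun O x => ((x.1, (x.2.2.2.1, hd x)), (support_parts x.2.1 x.2.2.1, 1)))
    _ (ptime_run_rado ptime_facef)); first by rewrite /hd /support_parts; pt.
  move=> O x [[u m r] [hc [x0 [D0 [K [M [hK inv]]]]]]]; split=> /=.
    exact: (support_uniq u x.2.2.1).
  have hG : indep (flatten x.2.1) (indf O x.1) (hd x).
    move: hc; rewrite /hd /dec_cond; case: x.2.2.1 (di_ok inv) => [|c s] //= h _.
    by have [] := h c (mem_head _ _).
  apply: (list_matroid_subset _ (list_matroid_face m _ hG)) => z.
  by rewrite support_ground mem_filter => /andP[].
apply: (ptime_ext (f := fun O x => casel (run_rado (facef O (x.1, (x.2.2.2.1, hd x)))
    (support_parts x.2.1 x.2.2.1) 1).2 [::] (fun c _ => c.1))) => //.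
by apply: ptime_casel; [apply: ptime_snd|pt|pt].
Qed.

Lemma ptime_dec_step : ptime step_dom (fun O x => dec_step (indf O x.1) x.2.1 x.2.2).
Proof.
pose W : Type := (DX * seq elt)%type.
pose domW (O : oracle) (w : W) := newton_dom indf O (w.1.1, (flatten w.1.2.1, (w.1.2.2.1, w.2))).
have hN : ptime domW (fun O w => newton (indf O w.1.1) (flatten w.1.2.1) w.1.2.2.1 w.2).
  apply: (ptime_comp (f := fun O (w : W) => (w.1.1, (flatten w.1.2.1, (w.1.2.2.1, w.2)))) _
    (ptime_newton hind)) => //.
  by pt.
have hW : ptime domW (fun O w => dec_with (indf O w.1.1) w.1.2.1 w.1.2.2 w.2).
  apply: (ptime_comp (f := fun O (w : W) => (w, newton (indf O w.1.1) (flatten w.1.2.1) w.1.2.2.1 w.2))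
    (g := fun O z => dec_update z.1.1.2.2 z.1.2 z.2) (Q := total)) => //.
    by apply: ptime_pair => //; pt.
  by rewrite /dec_update; pt.
apply: (ptime_comp (f := fun O x => (x, pick_base (indf O x.1) x.2.1 x.2.2.1 x.2.2.2.1)) _ hW).
  by apply: ptime_pair; [pt|exact: ptime_pick].
move=> O x [[u m r] [hc [x0 [D0 [K [M [hK inv]]]]]]].
by have [h1 h2 h3] := dec_newton u m r inv hc; split.
Qed.

Definition dec_dom (O : oracle) (x : G * (seq (seq elt) * seq (class elt))) :=
  [/\ env_ok O x.1 x.2.1, forall c, c \in x.2.2 -> indep (flatten x.2.1) (indf O x.1) c.1 /\ 0 < c.2
    & forall Q, Q \in x.2.1 -> cov x.2.2 Q = mass x.2.2].

Lemma ptime_dec_loop : ptime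
  (fun O (x : DX) => dec_dom O (x.1, (x.2.1, x.2.2.1)) /\ x.2.2.2 = ([::], [::]))
  (fun O x => loop (dec_measure x.2.1 x.2.2) (fun x => dec_cond x.2.2)
     (fun x => (x.1, (x.2.1, dec_step (indf O x.1) x.2.1 x.2.2))) x).
Proof.
pose K (x : DX) := size x.2.2.1 + rado_bound (size (flatten x.2.1)) (size (flatten x.2.1)).
pose mu (x : DX) := dec_measure x.2.1 x.2.2.
pose Inv O (x y : DX) := [/\ y.1 = x.1, y.2.1 = x.2.1 & dec_inv (indf O x.1) x.2.1
  (wt x.2.2.1) (mass x.2.2.1) (K x) (mu x) y.2.2].
pose P O (x : DX) := dec_dom O (x.1, (x.2.1, x.2.2.1)) /\ x.2.2.2 = ([::], [::]).
have hK x : rado_bound (size (flatten x.2.1)) (size (flatten x.2.1)) <= K x by apply: leq_addl.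
have s2 : forall y, 2 <= esz (A := DX) y by move=> y; apply: esize_ge2.
have pn : pbound (on P) (esz (A := DX)) (fun y => size (flatten y.2.2.1)).
  apply: pbound_s => -[O x] _ /=; apply: leq_trans (leq_trans (esize_fst _) (esize_snd x)).
  elim: x.2.1 => //= Q s IH; rewrite esize_cons size_cat.
  pose proof (size_le_esize Q); lia.
have pid := pbound_id (on P) (esz (A := DX)).
have pm : pbound (on P) (esz (A := DX)) (fun y => mu y.2).
  apply: (pbound_le (g := fun y => size (flatten y.2.2.1) + (size (flatten y.2.2.1)).+2 + 1)).
    move=> y _; rewrite /mu /dec_measure !leq_add ?leq_subr //; last by case: (0 < _).
    by rewrite size_filter count_size.
  by repeat first [exact: pn | apply: pboundD | apply: pboundS | exact: pbound_const].
have env O x : P O x -> env_ok O x.1 x.2.1 by case=> -[].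
apply: (ptime_loop (Q := fun O x => env_ok O x.1 x.2.1 /\ (dec_cond x.2.2 -> step_dom O x))
  (Inv := Inv) (mu := fun _ => mu) (c := fun _ (x : DX) => dec_cond x.2.2)
  (f := fun O (x : DX) => (x.1, (x.2.1, dec_step (indf O x.1) x.2.1 x.2.2)))
  (n := fun _ => mu)) => //.
- by rewrite /dec_cond; pt.
- do 2 (apply: ptime_pair; first by pt).
  by apply: ptime_sub ptime_dec_step => O x [[_ h] /h].
- move=> O [g [Ps [cls st]]] [[[u m r] h1 h2] /= ->]; split=> //.
  exact: (dec_start h1 h2).
- move=> O x y hP [h1 h2 h3]; rewrite h1 h2; have he := env _ _ hP; split=> // hc.
  rewrite /step_dom h1 h2; split=> //; split=> //.
  by exists (wt x.2.2.1), (mass x.2.2.1), (K x), (mu x).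
- move=> O x y hP [h1 h2 h3] hc; have [u m r] := env _ _ hP; rewrite /Inv /mu /= h1 h2.
  split; first by split=> //; apply: (dec_step_inv u m r (hK x) h3 hc).
  exact: (step_measure u m r (hK x) h3 hc).
have hmass : ptime total (fun _ (x : DX) => mass x.2.2.1) by pt.
have [k1 hk1] := ptime_esize hmass.
(* [bw] bounds the size of a weight through [di_mass]: logarithms turn the power over the rounds
   into a product. *)
pose (bw := fun y : oracle * DX => esz y ^ k1 + (2 + mu y.2 * (size (flatten y.2.2.1)).+3)).
pose (bS := fun y : oracle * DX => 2 + size (flatten y.2.2.1) * (esz y).+1).
have pS : pbound (on P) (esz (A := DX)) bS.
  by repeat first [exact: pn | exact: pid | apply: pboundM | apply: pboundD | apply: pboundS
    | exact: pbound_const].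
have pw : pbound (on P) (esz (A := DX)) bw.
  by repeat first [exact: pn | exact: pid | exact: pm | apply: pboundX | apply: pboundM
    | apply: pboundD | apply: pboundS | exact: pbound_const].
have pK : pbound (on P) (esz (A := DX)) (fun y => K y.2).
  apply: pboundD => //.
    apply: pbound_s => -[O x] _ /=; apply: leq_trans (size_le_esize _) _.
    exact: leq_trans (esize_fst _) (leq_trans (esize_snd _) (esize_snd _)).
  by rewrite /rado_bound /cap; repeat first [exact: pn | apply: pboundM
    | apply: pboundD | apply: pboundS | exact: pbound_const].
have [k hk] : pbound (on P) (esz (A := DX)) (fun y => (esz y + (esz y +
    ((2 + K y.2 * (bS y + bw y).+2) + ((2 + (size (flatten y.2.2.1)).+1 * (bS y).+1) +
     (2 + mu y.2 * (bS y + bw y).+2)).+1).+1).+1).+1).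
  by repeat first [exact: pn | exact: pid | exact: pm | exact: pS | exact: pw | exact: pK
    | apply: pboundM | apply: pboundD | apply: pboundS | exact: pbound_const].
exists k => O x y hP [h1 h2 inv]; apply: leq_trans (hk (O, x) hP); rewrite /=.
have [u m r] := env _ _ hP.
have hE e : e \in flatten x.2.1 -> esize e <= esize x.
  move=> /flattenP[Q hQ eQ]; apply: leq_trans (mem_esize eQ) _.
  apply: leq_trans (mem_esize hQ) _.
  exact: leq_trans (esize_fst _) (esize_snd _).
have hS S : indep (flatten x.2.1) (indf O x.1) S -> esize S <= bS (O, x).
  by move=> [uS sS _]; apply: (esize_subset uS sS).
have count := di_count inv.
have hw w : w <= mass y.2.2.2.2 + mass y.2.2.1 -> esize w <= bw (O, x).
  move=> hw; apply: leq_trans (esize_nat_le hw) _.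
  apply: leq_trans (esize_nat_le (di_mass inv)) _.
  apply: leq_trans (esize_natM _ _) _; apply: leq_add; first exact: (hk1 (O, x) I).
  apply: leq_trans (esize_exp _ _) _; rewrite leq_add2l leq_mul //.
    by apply: leq_trans count; apply: leq_addr.
  exact: esize_nat_id.
have hcls (cs : seq (class elt)) N : size cs <= N ->
    (forall c, c \in cs -> indep (flatten x.2.1) (indf O x.1) c.1 /\ esize c.2 <= bw (O, x)) ->
    esize cs <= 2 + N * (bS (O, x) + bw (O, x)).+2.
  move=> hN hc; apply: leq_trans (esize_seq_le (b := (bS (O, x) + bw (O, x)).+1) _) _.
    move=> c /hc[h3 h4]; rewrite esize_pair ltnS leq_add //; exact: hS.
  by rewrite leq_add2l leq_mul2r hN orbT.
rewrite esize_pair h1 ltnS leq_add ?esize_fst // esize_pair h2 ltnS leq_add //.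
  exact: leq_trans (esize_fst _) (esize_snd x).
rewrite esize_pair ltnS leq_add //.
  apply: hcls; first exact: (di_size inv).
  move=> c hc; have [h3 _] := di_ok inv hc; split=> //; apply: hw.
  by apply: leq_trans (mass_ge hc) _; apply: leq_addl.
rewrite esize_pair ltnS leq_add //.
  have [h [eh h4 _]] := di_hist inv.
  apply: leq_trans (esize_seq_le (b := bS (O, x)) _) _; last first.
    by rewrite leq_add2l leq_mul2r (tights_bound u inv) orbT.
  move=> B; rewrite -eh => /mapP[a ha ->]; have [_ _ [_ uB] [_ sB] _] := h4 a ha.
  exact: (esize_subset uB sB).
apply: hcls; first by apply: leq_trans count; apply: leq_addr.
move=> c hc; have [h3 _] := di_out inv hc; split=> //; apply: hw.
by apply: leq_trans (mass_ge hc) _; apply: leq_addr.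
Qed.

Lemma ptime_decompose :
  ptime dec_dom (fun O x => (decompose (indf O x.1) x.2.1 x.2.2).2.2).
Proof.
have hl n O (x : DX) : loop n (fun x => dec_cond x.2.2)
     (fun x => (x.1, (x.2.1, dec_step (indf O x.1) x.2.1 x.2.2))) x =
   (x.1, (x.2.1, loop n (@dec_cond _) (dec_step (indf O x.1) x.2.1) x.2.2)).
  by elim: n x => [|n IH] [g [Ps st]] //=; case: ifP => // _; rewrite IH.
pose f0 (O : oracle) (x : G * (seq (seq elt) * seq (class elt))) : DX :=
  (x.1, (x.2.1, (x.2.2, ([::], [::])))).
apply: (ptime_ext (f := fun O x => (loop (dec_measure (f0 O x).2.1 (f0 O x).2.2)
   (fun x => dec_cond x.2.2)
   (fun x => (x.1, (x.2.1, dec_step (indf O x.1) x.2.1 x.2.2))) (f0 O x)).2.2.2.2)).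
  by move=> O x _; rewrite hl.
do 4 apply: ptime_snd.
apply: (ptime_comp (f := f0) _ ptime_dec_loop); first by rewrite /f0; pt.
by move=> O [g [Ps cls]].
Qed.
End DecLoop.

(** * Serving vertices: the derived matroid *)

(* Name, class of the radius, scaled probability, points within the radius. *)
Notation vert := (nat * (nat * (nat * seq nat)))%type (only parsing).
Definition vid (v : vert) := v.1.
Definition vclass (v : vert) := v.2.1.
Definition vdemand (v : vert) := v.2.2.1.
Definition vball (v : vert) := v.2.2.2.
Definition touch (u v : vert) := has (fun z => z \in vball v) (vball u).

Lemma touchC u v : touch u v = touch v u.
Proof. by rewrite /touch; apply/hasP/hasP => -[z h1 h2]; exists z. Qed.

(* The label of an element of [serve n ws v] is the point that serves v, or
   n plus the name of a vertex of lower class served on behalf of v. The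
   element [idle n v] leaves v unserved; its label n + v prevents others from relying on v. *)
Definition serve n (ws : seq vert) (v : vert) : seq elt :=
  [seq (vid v, z) | z <- vball v] ++
  [seq (vid v, n + vid w) | w <- [seq w <- ws | (vclass w < vclass v) && touch w v]].
Definition idle n (v : vert) : elt := (vid v, n + vid v).
Definition blocks n ws := [seq idle n v :: serve n ws v | v <- ws].
Definition stations n (J : seq elt) := [seq k <- [seq e.2 | e <- J] | k < n].
(** Elements with equal labels are parallel, labels below [n] carry [ind], the others are free, and
    the rank is truncated to [m]. When [m] is the number of blocks, a member meeting every block
    once is a base. *)
Definition schedule n m (ind : pred (seq nat)) (J : seq elt) :=
  [&& size J <= m, uniq [seq e.2 | e <- J] & ind (stations n J)].
(** The demand of the idle element completes that of the serving elements to [D], so that every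
    block is covered by the whole mass. *)
Definition targets n D ws := [seq (serve n ws v, vdemand v) | v <- ws] ++
  [seq ([:: idle n v], D - vdemand v) | v <- ws].

Section Schedule.
Variables (n m : nat) (ind : pred (seq nat)).
Hypothesis indM : list_matroid (iota 0 n) ind.

Lemma mem_stations J k : (k \in stations n J) = (k < n) && (k \in [seq e.2 | e <- J]).
Proof. by rewrite mem_filter. Qed.

Lemma uniq_map_inj (A B : eqType) (f : A -> B) (s : seq A) :
  uniq [seq f x | x <- s] -> {in s &, injective f}.
Proof.
elim: s => //= a s IH /andP[h us] x y; rewrite !inE => /orP[/eqP->|xs] /orP[/eqP->|ys] e //.
- by rewrite e map_f in h.
- by rewrite -e map_f in h.
- exact: IH.
Qed.

(** If [t] has a label of at least [n] that [s] lacks, its element can be added. Otherwise [t] has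
    no more such labels than [s], hence more stations, and exchange in [ind] applies. *)
Lemma schedule_matroid E : list_matroid E (schedule n m ind).
Proof.
split.
- by rewrite /schedule /= (lm_nil indM).
- move=> s t /and3P[h1 h2 h3] ts ut.
  have u2 : uniq [seq e.2 | e <- t].
    by rewrite map_inj_in_uniq // => x y /ts xs /ts ys; apply: (uniq_map_inj h2).
  apply/and3P; split=> //.
    exact: leq_trans (uniq_leq_size ut ts) h1.
  apply: (lm_sub indM h3); last exact: filter_uniq.
  move=> k; rewrite !mem_stations => /andP[-> /mapP[x /ts xs ->]] /=.
  exact: map_f.
- move=> s t us ut _ _ /and3P[s1 s2 s3] /and3P[t1 t2 t3] lt.
  pose far (J : seq elt) := [seq k <- [seq e.2 | e <- J] | ~~ (k < n)].
  have sz J : size (stations n J) + size (far J) = size J.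
    rewrite /stations /far !size_filter -(size_map (fun e : elt => e.2) J).
    exact: count_predC.
  case: (boolP (has (fun e => ~~ (e.2 < n) && (e.2 \notin far s)) t)) => [/hasP[e et /andP[e1 e2]]|hno].
    have en : e.2 \notin [seq e.2 | e <- s].
      by apply: contra e2 => h; rewrite mem_filter e1.
    exists e; split=> //; first by apply: contra en => h; apply: map_f.
    apply/and3P; split=> /=; [exact: leq_trans lt t1|by rewrite en|].
    by rewrite /stations /= (negbTE e1).
  have hfar : size (far t) <= size (far s).
    apply: uniq_leq_size; first exact: filter_uniq.
    move=> k; rewrite mem_filter => /andP[kn /mapP[e et ek]].
    by move: (hasPn hno e et); rewrite -ek kn /= negbK.
  have hlt : size (stations n s) < size (stations n t).
    rewrite -(ltn_add2r (size (far t))) sz; apply: leq_ltn_trans lt.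
    by rewrite -(sz s) leq_add2l.
  have sub J : {subset stations n J <= iota 0 n}.
    by move=> k; rewrite mem_stations mem_iota => /andP[].
  have [k [kt ks ki]] := lm_exch indM (filter_uniq _ s2) (filter_uniq _ t2) (sub s) (sub t) s3 t3 hlt.
  move: kt ks; rewrite !mem_stations => /andP[kn /mapP[e et ek]]; rewrite kn /= => ks.
  exists e; split=> //; first by apply: contra ks => h; rewrite ek map_f.
  apply/and3P; split=> /=; [exact: leq_trans lt t1|by rewrite -ek ks|].
  by rewrite /stations /= -ek kn.
Qed.
End Schedule.

Section Blocks.
Variables (n : nat) (ws : seq vert).
Hypothesis uws : uniq [seq vid v | v <- ws].
Hypothesis ws_lt : forall v, v \in ws -> vid v < n.
Hypothesis ball_uniq : forall v, v \in ws -> uniq (vball v).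
Hypothesis ball_lt : forall v z, v \in ws -> z \in vball v -> z < n.

Lemma vid_inj u v : u \in ws -> v \in ws -> vid u = vid v -> u = v.
Proof. exact: uniq_map_inj. Qed.

Lemma serve_fst v e : e \in serve n ws v -> e.1 = vid v.
Proof. by rewrite mem_cat => /orP[] /mapP[z _ ->]. Qed.

Lemma serve_uniq v : v \in ws -> uniq (idle n v :: serve n ws v).
Proof.
move=> hv /=; apply/andP; split.
  rewrite mem_cat negb_or; apply/andP; split.
    apply/negP => /mapP[z zb [e]]; have := ball_lt hv zb; lia.
  apply/negP => /mapP[w]; rewrite mem_filter => /andP[/andP[hc _] hw] [/addnI e].
  by rewrite (vid_inj hv hw e) ltnn in hc.
rewrite cat_uniq; apply/and3P; split.
- by rewrite map_inj_uniq ?ball_uniq // => x y [].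
- apply/hasPn => e /mapP[w hw ->]; apply/negP => /mapP[z zb [e']].
  by have := ball_lt hv zb; lia.
- rewrite map_inj_in_uniq; first by rewrite filter_uniq ?(map_uniq uws).
  move=> u w; rewrite !mem_filter => /andP[_ hu] /andP[_ hw] [/addnI]; exact: vid_inj.
Qed.

Lemma block_fst v e : e \in idle n v :: serve n ws v -> e.1 = vid v.
Proof. by rewrite inE => /orP[/eqP-> //|]; apply: serve_fst. Qed.

Lemma blocks_uniq : uniq (flatten (blocks n ws)).
Proof.
suff h s : {subset s <= ws} -> uniq [seq vid v | v <- s] ->
    uniq (flatten [seq idle n v :: serve n ws v | v <- s]) by exact: h.
elim: s => [//|v s IH] hs /andP[hv us].
rewrite [map _ _]/= [flatten _]/= -cat_cons cat_uniq serve_uniq ?hs ?mem_head //.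
rewrite IH // ?andbT; last by move=> u hu; apply: hs; rewrite inE hu orbT.
apply/hasPn => e /flattenP[B /mapP[u hu ->] /block_fst e1]; apply: contra hv => /block_fst e2.
by apply/mapP; exists u; rewrite // -e1.
Qed.

Lemma targets_perm D : perm_eq (flatten [seq p.1 | p <- targets n D ws]) (flatten (blocks n ws)).
Proof.
apply/permP => p; rewrite /targets /blocks map_cat flatten_cat count_cat !count_flatten -!map_comp.
suff h s : sumn [seq count p (serve n ws v) | v <- s] + sumn [seq count p [:: idle n v] | v <- s] =
    sumn [seq count p (idle n v :: serve n ws v) | v <- s] by exact: h.
by elim: s => //= v s <-; clear; lia.
Qed.

Lemma mem_blocks v e : v \in ws -> e \in idle n v :: serve n ws v -> e \in flatten (blocks n ws).
Proof. by move=> hv he; apply/flattenP; exists (idle n v :: serve n ws v) => //; apply: map_f. Qed.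
End Blocks.

Record vertices_ok n (ws : seq vert) : Prop := VerticesOk {
  vo_uniq : uniq [seq vid v | v <- ws];
  vo_lt : forall v, v \in ws -> vid v < n;
  vo_ball : forall v, v \in ws -> uniq (vball v);
  vo_ball_lt : forall v z, v \in ws -> z \in vball v -> z < n;
  vo_self : forall v, v \in ws -> vid v \in vball v;
  vo_sep : forall u v, u \in ws -> v \in ws -> vclass u = vclass v -> touch u v -> u = v }.

(** * From a feasible set to a choice with distinct labels *)

Section Hit.
Variables (n : nat) (ws : seq vert).
Hypothesis hws : vertices_ok n ws.
Variables (ind : pred (seq nat)) (S : seq nat).
Hypothesis indS : forall t, uniq t -> {subset t <= S} -> ind t.
Variable H : pred vert.
Hypothesis hitH : forall v, v \in ws -> H v -> has (fun z => z \in S) (vball v).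

Definition pickup v := head 0 [seq z <- vball v | z \in S].
Definition below v := [seq w <- ws | [&& H w, pickup w == pickup v & vclass w < vclass v]].
Definition highest v :=
  head v [seq w <- below v | all (fun u => vclass u <= vclass w) (below v)].
Definition label v :=
  if H v then if below v == [::] then pickup v else n + vid (highest v) else n + vid v.

Lemma pickup_ok v : v \in ws -> H v -> pickup v \in vball v /\ pickup v \in S.
Proof.
move=> hv Hv; have : has (fun z => z \in S) (vball v) by apply: hitH.
rewrite has_filter /pickup; case E: (filter _ _) => [|z s] //= _.
by have := mem_head z s; rewrite -E mem_filter => /andP[].
Qed.

Lemma max_exists (s : seq vert) : s != [::] ->
  has (fun w => all (fun u => vclass u <= vclass w) s) s.
Proof.
elim: s => // v [|v' s] IH _; first by rewrite /= leqnn.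
have /hasP[w hw /allP h] := IH isT.
case: (leqP (vclass v) (vclass w)) => hvw; apply/hasP.
  exists w; first by rewrite inE hw orbT.
  by apply/allP => u; rewrite inE => /orP[/eqP->|/h].
exists v; first exact: mem_head.
by apply/allP => u; rewrite inE => /orP[/eqP->|/h hu] //; apply: leq_trans hu (ltnW hvw).
Qed.

Lemma highest_ok v : below v != [::] -> [/\ highest v \in ws, H (highest v),
  pickup (highest v) = pickup v, vclass (highest v) < vclass v &
  forall u, u \in below v -> vclass u <= vclass (highest v)].
Proof.
move/max_exists; rewrite has_filter /highest; case E: (filter _ _) => [|w s] //= _.
have := mem_head w s; rewrite -E mem_filter => /andP[/allP h].
by rewrite mem_filter => /andP[/and3P[h1 /eqP h2 h3] h4].
Qed.

Lemma same_pickup u v : u \in ws -> v \in ws -> H u -> H v -> pickup u = pickup v -> touch u v.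
Proof.
move=> hu hv Hu Hv e; have [b1 _] := pickup_ok hu Hu; have [b2 _] := pickup_ok hv Hv.
by apply/hasP; exists (pickup u); rewrite // e.
Qed.

Lemma group_inj u v : u \in ws -> v \in ws -> H u -> H v -> pickup u = pickup v ->
  ~~ (vclass u < vclass v) -> ~~ (vclass v < vclass u) -> u = v.
Proof.
move=> hu hv Hu Hv e h1 h2; apply: (vo_sep hws) => //; last exact: same_pickup.
apply/eqP; rewrite eqn_leq; apply/andP; split.
  by rewrite leqNgt.
by rewrite leqNgt.
Qed.

Lemma pickup_lt v : v \in ws -> H v -> pickup v < n.
Proof. by move=> hv Hv; have [h _] := pickup_ok hv Hv; apply: (vo_ball_lt hws hv h). Qed.

Lemma below_mem u v : u \in ws -> H u -> pickup u = pickup v -> vclass u < vclass v ->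
  u \in below v.
Proof. by move=> hu Hu e h; rewrite mem_filter Hu e eqxx h. Qed.

(** Vertices picked up at the same point have touching balls and hence, by [vo_sep], distinct
    classes. So only one of them is lowest; and if two relied on the same vertex, the lower one
    would lie strictly between that vertex and the higher one, against the choice of [highest]. *)
Lemma label_inj : {in ws &, injective label}.
Proof.
move=> u v hu hv; rewrite /label.
have vi := @vid_inj _ (vo_uniq hws).
case Hu: (H u); case Hv: (H v); last 1 first.
- by move=> /addnI; apply: vi.
- case: eqP => bu; case: eqP => bv.
  + move=> e; apply: group_inj => //.
      by apply/negP => h; have := below_mem hu Hu e h; rewrite bv.
    by apply/negP => h; have := below_mem hv Hv (esym e) h; rewrite bu.
  + have := pickup_lt hu Hu; lia.
  + have := pickup_lt hv Hv; lia.
  move/eqP in bu; move/eqP in bv.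
  have [u1 u2 u3 u4 u5] := highest_ok bu; have [v1 v2 v3 v4 v5] := highest_ok bv.
  move/addnI => /(vi _ _ u1 v1) e; have e2 : pickup u = pickup v by rewrite -u3 -v3 e.
  apply: group_inj => //; rewrite -leqNgt.
    rewrite leqNgt; apply/negP => h.
    have := v5 u (below_mem hu Hu e2 h); rewrite -e leqNgt; by rewrite u4.
  rewrite leqNgt; apply/negP => h.
  by have := u5 v (below_mem hv Hv (esym e2) h); rewrite e leqNgt v4.
- case: eqP => [_|/eqP bu]; first by have := pickup_lt hu Hu; lia.
  have [u1 u2 _ _ _] := highest_ok bu.
  by move/addnI => /(vi _ _ u1 hv) e; rewrite e Hv in u2.
- case: eqP => [_|/eqP bv]; first by have := pickup_lt hv Hv; lia.
  have [v1 v2 _ _ _] := highest_ok bv.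
  by move/addnI => /(vi _ _ hu v1) e; rewrite -e Hu in v2.
Qed.

Lemma label_serve v : v \in ws -> (vid v, label v) \in (if H v then serve n ws v else [:: idle n v]).
Proof.
move=> hv; rewrite /label; case Hv: (H v); last by rewrite mem_head.
rewrite mem_cat; case: eqP => [_|/eqP bv]; apply/orP; [left|right].
  by apply: (map_f (pair (vid v))); have [] := pickup_ok hv Hv.
have [v1 v2 v3 v4 _] := highest_ok bv; apply/mapP; exists (highest v) => //.
by rewrite mem_filter v4 v1 same_pickup.
Qed.

Definition travel := [seq (vid v, label v) | v <- ws].

Lemma travel_indep E : {subset flatten (blocks n ws) <= E} ->
  indep E (schedule n (size ws) ind) travel.
Proof.
move=> hE; have ul : uniq [seq e.2 | e <- travel].
  by rewrite -map_comp map_inj_in_uniq ?(map_uniq (vo_uniq hws)) //; apply: label_inj.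
split; first exact: map_uniq ul.
  move=> e /mapP[v hv ->]; apply: hE; apply: (mem_blocks hv); have := label_serve hv.
  by case: (H v); rewrite !inE => ->; rewrite ?orbT.
apply/and3P; split=> //; first by rewrite size_map.
apply: indS; first exact: filter_uniq.
move=> k; rewrite mem_stations -map_comp => /andP[kn /mapP[v hv e]]; move: kn e => /=.
rewrite /label; case Hv: (H v) => kn e; last by move: kn; rewrite e; lia.
move: e; case: eqP => [_|_] e; last by move: kn; rewrite e; lia.
by rewrite e; have [] := pickup_ok hv Hv.
Qed.

Lemma size_travel (A : seq elt) (s i : pred vert) :
  (forall v, v \in ws -> forall e, e \in serve n ws v -> (e \in A) = s v) ->
  (forall v, v \in ws -> (idle n v \in A) = i v) ->
  size [seq x <- travel | x \in A] = sumn [seq nat_of_bool (if H v then s v else i v) | v <- ws].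
Proof.
move=> hs hi; rewrite size_filter /travel count_map -sumn_count.
congr sumn; apply/eq_in_map => v hv /=; have := label_serve hv.
case: (H v); first by move/(hs v hv) => ->.
by rewrite inE => /eqP ->; rewrite hi.
Qed.
End Hit.

Lemma sumn_filter_mul (A : Type) (f : A -> nat) (p : pred A) l :
  sumn [seq f x | x <- l & p x] = sumn [seq p x * f x | x <- l].
Proof. by elim: l => //= x l <-; case: (p x); rewrite ?mul1n. Qed.

Section Infeasible.
Variables (n D : nat) (ws : seq vert) (ind : pred (seq nat)).
Hypothesis hws : vertices_ok n ws.
Hypothesis indM : list_matroid (iota 0 n) ind.
Let ps := targets n D ws.
Let st := run_rado (schedule n (size ws) ind) ps D.

Lemma targets_uniq : uniq (flatten [seq p.1 | p <- ps]).
Proof.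
rewrite (perm_uniq (targets_perm _ _ _)); case: hws => h1 h2 h3 h4 _ _; exact: blocks_uniq.
Qed.

Lemma targets_matroid : list_matroid (flatten [seq p.1 | p <- ps]) (schedule n (size ws) ind).
Proof. exact: schedule_matroid. Qed.

(** The failing set is a union of parts; [s] and [i] tell which serving parts and idle parts it
    contains. Given [S], the vertices with [s v] whose ball is hit are served as in [travel], all
    others idle, and [failset_lt] applies to this choice. *)
Lemma unsolved_violated : ~~ solved st.1 -> exists s i : pred vert,
  forall S : seq nat, (forall t, uniq t -> {subset t <= S} -> ind t) ->
  D * sumn [seq nat_of_bool (if s v && has (fun z => z \in S) (vball v) then true else i v) | v <- ws] <
  sumn [seq s v * vdemand v + i v * (D - vdemand v) | v <- ws].
Proof.
move=> un; have uE := targets_uniq; have indE := targets_matroid.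
have [inv stop _] := run_rado_ok D uE indE.
pose A := failset st.1.
pose s v := has (fun x => x \in A) (serve n ws v); pose i v := idle n v \in A.
exists s, i => S hS.
have nonempty : all (fun p => p.1 != [::]) ps.
  apply/allP => p; rewrite mem_cat => /orP[] /mapP[v hv ->] //=.
  apply/eqP => e; have : (vid v, vid v) \in serve n ws v.
    by rewrite mem_cat (map_f (pair (vid v))) // (vo_self hws).
  by rewrite e.
pose H v := s v && has (fun z => z \in S) (vball v).
have hH v : v \in ws -> H v -> has (fun z => z \in S) (vball v) by move=> _ /andP[].
have hX := travel_indep hws hS hH (E := flatten [seq p.1 | p <- ps]).
have /hX {}hX : {subset flatten (blocks n ws) <= flatten [seq p.1 | p <- ps]}.
  by move=> e; rewrite (perm_mem (targets_perm _ _ _)).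
have hs v : v \in ws -> forall e, e \in serve n ws v -> (e \in A) = s v.
  move=> hv e he; apply/idP/hasP => [h|[x hx xA]]; first by exists e.
  have hp : (serve n ws v, vdemand v) \in ps.
    by rewrite mem_cat (map_f (fun v => (serve n ws v, vdemand v)) hv).
  exact: (failset_part uE inv hp hx he xA).
have := failset_lt uE indE inv stop un nonempty hX.
rewrite (size_travel hH hs (i := i)) // => h.
have -> : sumn [seq s v * vdemand v + i v * (D - vdemand v) | v <- ws] =
    sumn [seq p.2 | p <- ps & has (fun x => x \in A) p.1].
  rewrite /ps /targets filter_cat map_cat sumn_cat sumnD !sumn_map_filter; congr (_ + _).
    by rewrite sumn_filter_mul.
  rewrite (eq_filter (a2 := i)) ?sumn_filter_mul // => v; exact: orbF.
apply: leq_ltn_trans h; rewrite leq_mul2l; apply/orP; right; apply: eq_leq.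
congr sumn; apply/eq_in_map => v hv; rewrite /H; by case: (s v); case: (has _ _).
Qed.
End Infeasible.

(** * Greedy choice of the kept vertices *)

Definition insert (s : seq vert) v :=
  [seq u <- s | vdemand v <= vdemand u] ++ v :: [seq u <- s | ~~ (vdemand v <= vdemand u)].
Definition conflict (u v : vert) := (vclass u == vclass v) && touch u v.
Definition keep (s : seq vert) v := if has (fun u => conflict u v) s then s else v :: s.
Definition reps (vs : seq vert) := foldl keep [::] (foldl insert [::] vs).

Lemma insert_perm s v : perm_eq (insert s v) (v :: s).
Proof. by rewrite /insert -cat1s perm_catCA /= perm_cons perm_filterC. Qed.

Lemma foldl_insert_perm vs s : perm_eq (foldl insert s vs) (vs ++ s).
Proof.
elim: vs s => //= v vs IH s; apply: perm_trans (IH _) _.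
by rewrite (perm_catl _ (insert_perm s v)) -cat_cons -cat1s perm_catCA.
Qed.

Definition geq_demand (u v : vert) := vdemand v <= vdemand u.

Lemma insert_pairwise s v : pairwise geq_demand s -> pairwise geq_demand (insert s v).
Proof.
move=> hs; rewrite /insert pairwise_cat pairwise_cons !pairwise_filter // !andbT.
apply/andP; split; last first.
  by apply/allP => u; rewrite mem_filter /geq_demand -ltnNge => /andP[/ltnW].
apply/allrelP => x y; rewrite mem_filter => /andP[hx _]; rewrite inE => /orP[/eqP->//|].
rewrite mem_filter -ltnNge => /andP[/ltnW hy _]; exact: leq_trans hy hx.
Qed.

Lemma foldl_insert_pairwise vs s : pairwise geq_demand s -> pairwise geq_demand (foldl insert s vs).
Proof. by elim: vs s => //= v vs IH s hs; apply/IH/insert_pairwise. Qed.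

Lemma touch_refl v : vid v \in vball v -> touch v v.
Proof. by move=> h; apply/hasP; exists (vid v). Qed.

(** The list is sorted, so the kept vertex that blocks [u] has at least the demand of [u]. A kept
    vertex represents itself, because its ball contains it. *)
Lemma keep_cover s : (forall v, v \in s -> vid v \in vball v) -> pairwise geq_demand s ->
  [/\ subseq (rev (foldl keep [::] s)) s,
      forall u, u \in s -> exists2 v, v \in foldl keep [::] s &
        conflict v u /\ vdemand u <= vdemand v
    & uniq s -> forall u v, u \in foldl keep [::] s -> v \in foldl keep [::] s -> conflict u v -> u = v].
Proof.
elim/last_ind: s => [//|s w IH] hself.
rewrite pairwise_rcons => /andP[/allP hw hp].
have [v hv|h1 h2 h3] := IH _ hp; first by apply: hself; rewrite mem_rcons inE hv orbT.
have hsub : {subset foldl keep [::] s <= s} by move=> v; rewrite -mem_rev; apply: mem_subseq.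
rewrite -cats1 foldl_cat /= /keep; case: hasP => [[v hv hc]|hno]; split.
- exact: subseq_trans h1 (prefix_subseq _ _).
- move=> u; rewrite mem_cat inE => /orP[/h2 //|/eqP->]; exists v => //; split=> //.
  exact: hw (hsub _ hv).
- by rewrite cat_uniq => /andP[/h3].
- by rewrite rev_cons -cats1 cat_subseq.
- move=> u; rewrite mem_cat inE => /orP[/h2[v hv hc]|/eqP->].
    by exists v => //; rewrite inE hv orbT.
  exists w; rewrite ?mem_head //; split=> //; rewrite /conflict eqxx touch_refl // hself //.
  by rewrite mem_rcons mem_head.
- rewrite cat_uniq => /and3P[us _ _] u v; rewrite !inE => /orP[/eqP->|hu] /orP[/eqP->|hv] // hc.
  + case: hno; exists v => //; move: hc; by rewrite /conflict eq_sym touchC.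
  + by case: hno; exists u.
  + exact: h3.
Qed.

Section Reps.
Variable vs : seq vert.
Hypothesis uvs : uniq [seq vid v | v <- vs].
Hypothesis self : forall v, v \in vs -> vid v \in vball v.

Let sorted_perm : perm_eq (foldl insert [::] vs) vs.
Proof. by have := foldl_insert_perm vs [::]; rewrite cats0. Qed.

Let cover := keep_cover (s := foldl insert [::] vs)
  (fun v h => self (eq_ind _ (fun b : bool => b) h _ (perm_mem sorted_perm v)))
  (foldl_insert_pairwise vs (isT : pairwise geq_demand [::])).

Lemma reps_sub : {subset reps vs <= vs}.
Proof.
have [h _ _] := cover; move=> v; rewrite -mem_rev => /(mem_subseq h).
by rewrite (perm_mem sorted_perm).
Qed.

Lemma reps_cover u : u \in vs -> exists2 v, v \in reps vs & conflict v u /\ vdemand u <= vdemand v.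
Proof. by have [_ h _] := cover; rewrite -(perm_mem sorted_perm) => /h. Qed.

Lemma reps_sep u v : u \in reps vs -> v \in reps vs -> vclass u = vclass v -> touch u v -> u = v.
Proof.
have [_ _ h] := cover; move=> hu hv e m; apply: h => //.
  by rewrite (perm_uniq sorted_perm) (map_uniq uvs).
by rewrite /conflict e eqxx.
Qed.

Lemma reps_uniq : uniq [seq vid v | v <- reps vs].
Proof.
have [h _ _] := cover; rewrite -rev_uniq -map_rev.
apply: subseq_uniq (map_subseq _ h) _.
by rewrite (perm_uniq (perm_map _ sorted_perm)).
Qed.
End Reps.

(** * Distance bounds along the chains *)

Section Distance.
Import Order.TTheory GRing.Theory Num.Theory.
Local Open Scope ring_scope.
Variables (n : nat) (vs : seq vert) (delta : nat -> nat -> rat) (rho : vert -> nat).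
Hypothesis delta_sym : forall x y, (x < n)%N -> (y < n)%N -> delta x y = delta y x.
Hypothesis delta_tri : forall x y z, (x < n)%N -> (y < n)%N -> (z < n)%N ->
  delta x z <= delta x y + delta y z.
Hypothesis uvs : uniq [seq vid v | v <- vs].
Hypothesis vs_lt : forall v, v \in vs -> (vid v < n)%N.
Hypothesis ball_lt : forall v z, v \in vs -> z \in vball v -> (z < n)%N.
Hypothesis ball_rho : forall v z, v \in vs -> z \in vball v -> delta (vid v) z <= (rho v)%:R.
Hypothesis class_rho : forall v, v \in vs -> (2 ^ vclass v <= rho v < 2 ^ (vclass v).+1)%N.
Variable ws : seq vert.
Hypothesis ws_sub : {subset ws <= vs}.
Variable J : seq elt.
Hypothesis uJ : uniq [seq e.2 | e <- J].
Hypothesis one : forall v, v \in ws -> has (fun e => e \in idle n v :: serve n ws v) J.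

Lemma touch_delta u v : u \in vs -> v \in vs -> touch u v ->
  delta (vid u) (vid v) <= (rho u)%:R + (rho v)%:R.
Proof.
move=> hu hv /hasP[z zu zv]; have zn := ball_lt hu zu.
apply: le_trans (delta_tri (vs_lt hu) zn (vs_lt hv)) _; apply: lerD; first exact: ball_rho.
by rewrite delta_sym ?ball_rho ?vs_lt.
Qed.

Lemma serve_delta v e : v \in ws -> e \in J -> e \in serve n ws v ->
  exists2 k, k \in stations n J & delta (vid v) k <= (rho v)%:R + 4 * 2 ^+ vclass v.
Proof.
have [c] := ubnP (vclass v); elim: c v e => // c IH v e hc hv eJ.
have hv' := ws_sub hv.
have pos m : 0 <= (2 : rat) ^+ m by rewrite exprn_ge0.
rewrite mem_cat => /orP[] /mapP[x hx ee].
  have xn := ball_lt hv' hx; exists x.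
    by rewrite mem_stations xn; apply/mapP; exists e; rewrite // ee.
  by apply: le_trans (ball_rho hv' hx) _; rewrite lerDl mulr_ge0.
move: hx; rewrite mem_filter => /andP[/andP[hlt hm] hx].
have [e' eJ' he'] := hasP (one hx).
(* The vertex [x] is not idle: its idle element has the label [n + vid x], which [e] already
   uses. *)
have {he'} es : e' \in serve n ws x.
  move: he'; rewrite inE => /orP[/eqP e2|//].
  have : e' = e by apply: (uniq_map_inj uJ) => //; rewrite e2 ee.
  rewrite e2 ee => -[e3].
  by rewrite (uniq_map_inj uvs (ws_sub hx) hv' e3) ltnn in hlt.
have [k kJ hk] := IH x e' (leq_trans hlt hc) hx eJ' es; exists k => //.
have kn : (k < n)%N by move: kJ; rewrite mem_stations => /andP[].
have hx' := ws_sub hx.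
apply: le_trans (delta_tri (vs_lt hv') (vs_lt hx') kn) _.
have h1 := touch_delta hv' hx'; rewrite touchC hm in h1; have {}h1 := h1 isT.
have [_ h2] := andP (class_rho hx').
have h3 : (rho x)%:R <= 2 * 2 ^+ vclass x :> rat.
  by rewrite -exprS -natrX ler_nat ltnW.
have h4 : 2 * 2 ^+ vclass x <= 2 ^+ vclass v :> rat.
  by rewrite -exprS ler_eXn2l // ltr1n.
lra.
Qed.

Lemma cover_delta u v e : u \in vs -> v \in ws -> conflict v u -> e \in J -> e \in serve n ws v ->
  exists2 k, k \in stations n J & delta (vid u) k <= 9 * (rho u)%:R.
Proof.
move=> hu hv /andP[/eqP hc hm] eJ es; have [k kJ hk] := serve_delta hv eJ es; exists k => //.
have kn : (k < n)%N by move: kJ; rewrite mem_stations => /andP[].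
have hv' := ws_sub hv; rewrite touchC in hm.
apply: le_trans (delta_tri (vs_lt hu) (vs_lt hv') kn) _.
have h1 := touch_delta hu hv' hm.
have [_ h2] := andP (class_rho hv'); have [h5 _] := andP (class_rho hu).
have h3 : (rho v)%:R <= 2 * 2 ^+ vclass v :> rat.
  by rewrite -exprS -natrX ler_nat ltnW.
have h4 : 2 ^+ vclass v <= (rho u)%:R :> rat by rewrite -natrX ler_nat hc.
lra.
Qed.
End Distance.

(** * The program *)

Lemma double_lt_square a b : 2 <= a -> a + a < (a + b).+1 * (a + b).+1.
Proof. nia. Qed.

Definition halve (y : nat * nat) := (y.1 %/ 2, y.2.+1).

Lemma loop_halve r : (loop (trunc_log 2 r) (fun y => 1 < y.1) halve (r, 0)).2 = trunc_log 2 r.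
Proof.
have [] := loopP (c := fun y : nat * nat => 1 < y.1) (f := halve) (mu := fun y => trunc_log 2 y.1)
  (Inv := fun y => trunc_log 2 y.1 + y.2 = trunc_log 2 r) (n := trunc_log 2 r) (x := (r, 0)).
- by move=> [a b] /= h a1; rewrite divn2 -h (trunc_log2S a1) addSnnS.
- by rewrite addn0.
- by [].
case: (loop _ _ _ _) => a b /= <- a1.
by case: a a1 => [|[|a]] //=; rewrite ?trunc_log0 ?trunc_log1.
Qed.

Lemma ptime_halve : ptime total (fun O r => trunc_log 2 r).
Proof.
apply: (ptime_ext (f := fun O r => (loop (trunc_log 2 (r, 0).1) (fun y => 1 < y.1) halve (r, 0)).2)).
  by move=> O r _; apply: loop_halve.
apply: ptime_snd.
apply: (ptime_comp (f := fun O r => (r, 0)) (Q := fun _ y => y.2 = 0)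
  (g := fun O x => loop (trunc_log 2 x.1) (fun y => 1 < y.1) halve x)); [by pt| |by []].
apply: (ptime_loop (Q := total) (c := fun _ (y : nat * nat) => 1 < y.1) (f := fun _ => halve)
  (Inv := fun _ x y => y.1 <= x.1 /\ y.2 + trunc_log 2 y.1 <= trunc_log 2 x.1)
  (mu := fun _ y => trunc_log 2 y.1) (n := fun _ y => trunc_log 2 y.1)) => //.
- by pt.
- by rewrite /halve; pt.
- by move=> _ [a b] /= ->.
- move=> _ [a b] [c d] /= _ [h1 h2] c1; rewrite divn2 addSnnS -trunc_log2S //; split; last first.
    by rewrite (trunc_log2S c1).
  by split=> //; apply: leq_trans h1; rewrite -divn2 leq_div.
- apply: pbound_s => -[O [a b]] _ /=; rewrite /esz /= esize_pair (esize_nat a).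
  by rewrite !addSn -!addnS leq_addr.
exists 2 => _ [a b] [c d] /= -> [h1 h2]; rewrite !esize_pair.
have h3 : esize d <= esize a.
  rewrite (esize_nat a); apply: leq_trans (esize_nat_id _) _; rewrite !ltnS.
  by apply: leq_trans h2; apply: leq_addr.
have h4 := esize_nat_le h1; rewrite expnS expn1; apply: leq_ltn_trans (leq_add h4 h3) _.
exact/double_lt_square/esize_ge2.
Qed.

Definition euclid_step (y : nat * nat) := (y.2, y.1 - y.1 %/ y.2 * y.2).
Definition euclid_measure (y : nat * nat) := trunc_log 2 (y.1 * y.2) + (0 < y.2).
Definition euclid_loop (y : nat * nat) :=
  loop (euclid_measure y) (fun y : nat * nat => 0 < y.2) euclid_step y.
(** Output fractions must be in lowest terms, because [tree_of_rat] shows the normalized numerator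
    and denominator. The minimum brings every input into the domain of [ptime_euclid]. *)
Definition weight_gcd a b := (euclid_loop (a, minn a b)).1.

Lemma subn_divM a b : a - a %/ b * b = a %% b.
Proof. by rewrite {1}(divn_eq a b) addKn. Qed.

(** A division step at least halves the product of the pair, since [b + a %% b <= a]; the flag
    counts the last step, where the remainder is 0. *)
Lemma euclid_measure_lt a b : b <= a -> 0 < b -> euclid_measure (b, a %% b) < euclid_measure (a, b).
Proof.
move=> ba b0; rewrite /euclid_measure /= b0 addn1 ltnS; have rb := ltn_pmod a b0.
case: (posnP (a %% b)) => [->|r0]; first by rewrite muln0 trunc_log0.
rewrite addn1.
have r2 : 2 * (b * (a %% b)) <= a * b.
  have : b + a %% b <= a.
    by rewrite [leqRHS](divn_eq a b) leq_add2r -{1}(mul1n b) leq_mul2r divn_gt0 // ba orbT.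
  by move: rb; clear; nia.
have -> : (trunc_log 2 (b * (a %% b))).+1 = trunc_log 2 (2 * (b * (a %% b))).
  by rewrite mul2n trunc_log2_double // muln_gt0 b0.
exact: leq_trunc_log2.
Qed.

Lemma weight_gcdE a b : b <= a -> weight_gcd a b = gcdn a b.
Proof.
move=> ba; rewrite /weight_gcd /euclid_loop (minn_idPr ba).
have [] := loopP (c := fun y : nat * nat => 0 < y.2) (f := euclid_step) (mu := euclid_measure)
  (Inv := fun y => y.2 <= y.1 /\ gcdn y.1 y.2 = gcdn a b) (n := euclid_measure (a, b)) (x := (a, b)).
- move=> [c d] /= [dc <-] d0; rewrite /euclid_step /= !subn_divM; split; last exact: euclid_measure_lt.
  by split; [rewrite ltnW ?ltn_pmod|rewrite gcdn_modr gcdnC].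
- by [].
- by [].
by case: (loop _ _ _ _) => c [|d] //= [_ <-] _; rewrite gcdn0.
Qed.

Lemma ptime_euclid : ptime (fun _ y => y.2 <= y.1) (fun O y => euclid_loop y).
Proof.
apply: (ptime_loop (Q := total) (c := fun _ (y : nat * nat) => 0 < y.2) (f := fun _ => euclid_step)
  (Inv := fun _ x y => y.2 <= y.1 /\ y.1 <= x.1)
  (mu := fun _ => euclid_measure) (n := fun _ => euclid_measure)) => //.
- by pt.
- by rewrite /euclid_step; pt.
- move=> _ [a b] [c d] /= _ [h1 h2] d0; rewrite /euclid_step /= !subn_divM; split; last exact: euclid_measure_lt.
  by split; [rewrite ltnW ?ltn_pmod|apply: leq_trans h1 h2].
- apply: pbound_s => -[O [a b]] _; rewrite /esz /= esize_pair /euclid_measure /=.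
  have := trunc_logM a b; rewrite !esize_nat; case: (0 < b) => /=; lia.
exists 2 => _ [a b] [c d] /= _ [h1 h2]; rewrite !esize_pair expnS expn1.
have h4 := esize_nat_le h2; have h3 := leq_trans (esize_nat_le h1) h4.
apply: leq_ltn_trans (leq_add h4 h3) _.
exact/double_lt_square/esize_ge2.
Qed.

Section UserOps.
Context (A : Type) {eA : encodable A} (P : oracle -> A -> Prop).

Lemma ptime_trunc_log (f : oracle -> A -> nat) :
  ptime P f -> ptime P (fun O x => trunc_log 2 (f O x)).
Proof. exact: (ptime_app1 ptime_halve). Qed.

Lemma ptime_weight_gcd (f g : oracle -> A -> nat) :
  ptime P f -> ptime P g -> ptime P (fun O x => weight_gcd (f O x) (g O x)).
Proof.
move=> hf hg; apply: ptime_fst.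
apply: (ptime_comp (f := fun O x => (f O x, minn (f O x) (g O x))) _ ptime_euclid).
  by apply: ptime_pair => //; apply: ptime_minn.
by move=> O x _; apply: geq_minl.
Qed.

Lemma uniqE (l : seq nat) : uniq l = all (fun k => size [seq j <- l | j == k] <= 1) l.
Proof.
apply/idP/allP => [u k _|h].
  by rewrite size_filter count_uniq_mem //; case: (_ \in _).
apply: count_mem_uniq => k; case: (boolP (k \in l)) => [hk|]; last by move/count_memPn.
by apply/eqP; rewrite eqn_leq -size_filter h //= size_filter -has_count has_pred1.
Qed.

Lemma ptime_uniq (f : oracle -> A -> seq nat) : ptime P f -> ptime P (fun O x => uniq (f O x)).
Proof.
apply: (ptime_app1 (h := fun _ l => uniq l)).
by apply: (ptime_ext (fun _ l _ => esym (uniqE l))); pt.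
Qed.
End UserOps.

Lemma esize_filterC (A : Type) {eA : encodable A} (p : pred A) (s : seq A) :
  esize [seq x <- s | p x] + esize [seq x <- s | ~~ p x] = esize s + 2.
Proof.
elim: s => [|x s IH]; first by rewrite esize_nil.
by rewrite [in RHS]esize_cons /=; case: (p x); rewrite /= esize_cons; lia.
Qed.

Lemma ptime_reps : ptime total (fun O vs => reps vs).
Proof.
rewrite /reps.
apply: (ptime_foldl (h := fun _ _ s v => keep s v)).
- by rewrite /keep /conflict /touch /vclass /vball; pt.
- exact: ptime_const.
- apply: (ptime_foldl (h := fun _ _ s v => insert s v)).
  + by rewrite /insert /vdemand; pt.
  + exact: ptime_const.
  + exact: ptime_id.
  + exists 1 => O x c b; rewrite expn1 /insert.
    apply: leq_trans (esize_cat _ _) _; rewrite esize_cons (esize_pair (x, b)) /= addnS addnCA.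
    by rewrite esize_filterC addnCA ltn_add2l ltnS addnC leq_add2r esize_ge2.
- exists 1 => O x c b; rewrite expn1 /keep; case: ifP => _; first exact: leq_addr.
  by rewrite esize_cons (esize_pair (x, b)) /= addnS ltnS addnC leq_add2l leq_addl.
Qed.

Ltac ptime_user ::= first
  [ eapply ptime_idx | apply ptime_lev | apply ptime_rado_init | apply ptime_solved
  | apply ptime_failset | apply ptime_rado_cond | apply ptime_cov | apply ptime_mass
  | apply ptime_wt | apply ptime_cval | apply ptime_trunc_log | apply ptime_weight_gcd
  | apply ptime_uniq ].

Section Solve.
Variables (n D : nat) (ws : seq vert) (ind : pred (seq nat)).
Hypothesis hws : vertices_ok n ws.
Hypothesis indM : list_matroid (iota 0 n) ind.
Hypothesis demand_le : forall v, v \in ws -> vdemand v <= D.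
Let sch := schedule n (size ws) ind.
Let st := run_rado sch (targets n D ws) D.
Hypothesis ok : solved st.1.

Lemma blocks_ok : [/\ uniq (flatten (blocks n ws)), list_matroid (flatten (blocks n ws)) sch &
  forall X, indep (flatten (blocks n ws)) sch X -> size X <= size (blocks n ws)].
Proof.
split; first by case: hws => h1 h2 h3 h4 _ _; apply: blocks_uniq.
  exact: schedule_matroid.
by move=> X [_ _ /and3P[h _ _]]; rewrite size_map.
Qed.

Let inv : rado_inv sch (targets n D ws) D st.1 st.2.
Proof. by have [] := run_rado_ok D (targets_uniq D hws) (targets_matroid D ws indM). Qed.

Lemma solve_cov v : v \in ws ->
  cov st.2 (serve n ws v) = vdemand v /\ wt st.2 (idle n v) = D - vdemand v.
Proof.
move=> hv; split.
  have hp : (serve n ws v, vdemand v) \in targets n D ws.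
    by rewrite mem_cat (map_f (fun v => (serve n ws v, vdemand v)) hv).
  exact: (solved_cov inv ok hp).
have hp : ([:: idle n v], D - vdemand v) \in targets n D ws.
  by rewrite mem_cat (map_f (fun v => ([:: idle n v], D - vdemand v)) hv) orbT.
exact: (solved_cov inv ok hp).
Qed.

Lemma solve_mass : mass st.2 = D. Proof. exact: ri_D inv. Qed.

Lemma solve_ok : (forall c, c \in st.2 -> indep (flatten (blocks n ws)) sch c.1 /\ 0 < c.2) /\
  forall Q, Q \in blocks n ws -> cov st.2 Q = mass st.2.
Proof.
split=> [c hc|Q /mapP[v hv ->]].
  have [[u s h] c0 _] := ri_ok inv hc; split=> //; split=> // e /s.
  by rewrite (perm_mem (targets_perm _ _ _)).
have [h1 h2] := solve_cov hv; rewrite solve_mass.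
have := @cov_flatten _ st.2 [:: [:: idle n v]; serve n ws v].
rewrite [flatten _]/= cats0 => ->; last first.
  by case: hws => h3 h4 h5 h6 _ _; apply: serve_uniq.
by rewrite /= addn0 h1 -[cov _ [:: _]]/(wt st.2 (idle n v)) h2 subnK // demand_le.
Qed.
End Solve.

(** * Input data and the complete algorithm *)

Notation raw := (nat * (seq (seq (nat * nat)) * (seq (nat * nat) * seq (nat * nat))))%type
  (only parsing).
(** A common denominator. As a product, its size is at most about the sum of the sizes of the
    factors. *)
Definition denom (l : seq (nat * nat)) := foldr muln 1 [seq q.2 | q <- l].
Definition scaled D (q : nat * nat) := q.1 * (D %/ q.2).
Definition ratio_leq (p q : nat * nat) := p.1 * q.2 <= q.1 * p.2.
Definition vertex (x : raw) i : vert :=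
  (i, (trunc_log 2 (scaled (denom x.2.2.1) (nth (0, 1) x.2.2.1 i)),
  (scaled (denom x.2.2.2) (nth (0, 1) x.2.2.2 i),
  [seq z <- idx x.2.2.1 | ratio_leq (nth (0, 1) (nth [::] x.2.1 i) z) (nth (0, 1) x.2.2.1 i)]))).
Definition vertices (x : raw) := [seq vertex x i | i <- idx x.2.2.1].
Definition prepare (x : raw) := (x.1, (denom x.2.2.2, reps (vertices x))).

Definition feasible (O : oracle) (s : seq nat) := O (encode s).
Definition scheduler (O : oracle) (g : nat * nat) := schedule g.1 g.2 (feasible O).
Notation prep := (nat * (nat * seq (nat * (nat * (nat * seq nat)))))%type (only parsing).
Definition solve (O : oracle) (y : prep) :=
  run_rado (scheduler O (y.1, size y.2.2)) (targets y.1 y.2.1 y.2.2) y.2.1.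
Definition sampler (O : oracle) (y : prep) :=
  (decompose (scheduler O (y.1, size y.2.2)) (blocks y.1 y.2.2) (solve O y).2).2.2.
Definition report n (out : seq (class elt)) :=
  [seq (stations n c.1, (c.2 %/ weight_gcd (mass out) c.2, mass out %/ weight_gcd (mass out) c.2))
  | c <- out].
(** The two branches are the trees of [Some] and [None] in [tree_of_answer]. *)
Definition answer_tree (O : oracle) (y : prep) : tree :=
  if solved (solve O y).1 then encode (1, report y.1 (sampler O y)) else Leaf 0.

Definition prep_ok (O : oracle) (y : prep) := [/\ vertices_ok y.1 y.2.2,
  list_matroid (iota 0 y.1) (feasible O) & forall v, v \in y.2.2 -> vdemand v <= y.2.1].

Lemma ptime_prepare : ptime total (fun O x => prepare x).
Proof.
apply: ptime_pair; first by pt.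
apply: ptime_pair; first by rewrite /denom; pt.
apply: (ptime_app1 ptime_reps).
by rewrite /vertices /vertex /scaled /denom /ratio_leq; pt.
Qed.

Lemma ptime_scheduler : ptime total (fun O (y : (nat * nat) * seq elt) => scheduler O y.1 y.2).
Proof. by rewrite /scheduler /schedule /stations /feasible; pt. Qed.

Lemma ptime_answer_tree : ptime prep_ok answer_tree.
Proof.
have hs : ptime prep_ok solve.
  apply: (ptime_comp (f := fun O (y : prep) => ((y.1, size y.2.2), (targets y.1 y.2.1 y.2.2, y.2.1)))
    _ (ptime_run_rado ptime_scheduler)).
    by rewrite /targets /serve /idle /touch /vid /vclass /vdemand /vball; pt.
  move=> O y [h1 h2 h3]; split; first exact: targets_uniq.
  exact: targets_matroid.
apply: (ptime_if (b := fun O y => solved (solve O y).1)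
  (f := fun O y => encode (1, report y.1 (sampler O y)))); last exact: ptime_const.
  by apply: ptime_solved; apply: ptime_fst.
have hs' : ptime (fun O y => prep_ok O y /\ solved (solve O y).1) solve.
  by apply: ptime_sub hs => O x [].
apply: (ptime_comp (f := fun O (y : prep) => (y.1, sampler O y)) (Q := total)
  (g := fun O z => encode (1, report z.1 z.2))) => //; last first.
  by rewrite /report /stations; pt.
apply: ptime_pair; first by pt.
apply: (ptime_comp (f := fun O (y : prep) => ((y.1, size y.2.2), (blocks y.1 y.2.2, (solve O y).2)))
  _ (ptime_decompose ptime_scheduler)).
  apply: ptime_pair; first by pt.
  apply: ptime_pair; last exact: ptime_snd.
  by rewrite /blocks /serve /idle /touch /vid /vclass /vdemand /vball; pt.
move=> O y [[h1 h2 h3] h4].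
have [h5 h6] := solve_ok h1 h2 h3 h4.
by split=> //; apply: blocks_ok.
Qed.

(** * Correctness on an instance *)

Import Order.TTheory GRing.Theory Num.Theory.

Section Oracle.
Variables (n : nat) (F : {set {set 'I_n}}).

Definition points (s : seq nat) : {set 'I_n} := [set i : 'I_n | val i \in s].

Lemma family_oracleE s : feasible (family_oracle F) s = (points s \in F).
Proof.
rewrite /feasible /family_oracle; congr (_ \in F); apply/setP => i; rewrite !inE.
elim: s => //= k s IH; rewrite inE -IH; congr (_ || _).
by rewrite eqz_nat eq_sym.
Qed.

Lemma oracle_matroid : matroid F -> list_matroid (iota 0 n) (feasible (family_oracle F)).
Proof.
have card s : uniq s -> {subset s <= iota 0 n} -> #|points s| = size s.
  move=> us sn; rewrite cardE -(size_map val).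
  apply/eqP; rewrite eqn_leq; apply/andP; split; apply: uniq_leq_size => //.
  - by rewrite map_inj_uniq ?enum_uniq //; apply: val_inj.
  - by move=> k /mapP[i]; rewrite mem_enum inE => h ->.
  move=> k ks; have kn : k < n by have := sn k ks; rewrite mem_iota.
  by apply/mapP; exists (Ordinal kn); rewrite // mem_enum inE.
move=> [F0 Fsub Fexch]; split.
- have e : points [::] = set0 by apply/setP => i; rewrite !inE.
  by rewrite family_oracleE e.
- move=> s t; rewrite !family_oracleE => h ts _; apply: Fsub h.
  by apply/subsetP => i; rewrite !inE => /ts.
move=> s t us ut sn tn; rewrite !family_oracleE => hs ht lt.
have [|x] := Fexch _ _ hs ht; first by rewrite !card.
rewrite !inE => /andP[xs xt] h; exists (val x); split=> //.
have e : points (val x :: s) = x |: points s by apply/setP => i; rewrite !inE.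
by rewrite family_oracleE e.
Qed.
End Oracle.

Definition ratio (q : rat) : nat * nat := (`|numq q|, `|denq q|).

Lemma ratio_tree q : (0 <= q)%R -> encode (ratio q) = tree_of_rat q.
Proof.
move=> q0; rewrite /tree_of_rat /encode /=; congr Node; congr Leaf.
  by rewrite /encode /= gez0_abs // numq_ge0.
by rewrite /encode /= gez0_abs // denq_ge0.
Qed.

Lemma ratio_eq q : (0 <= q)%R -> ((ratio q).1%:R / (ratio q).2%:R = q)%R.
Proof.
move=> q0; rewrite -[RHS]divq_num_den /ratio /=; congr (_ / _)%R.
  by rewrite -[in RHS](gez0_abs (_ : 0 <= numq q)%R) ?numq_ge0.
by rewrite -[in RHS](gez0_abs (denq_ge0 q)).
Qed.

Lemma ratio_den q : 0 < (ratio q).2.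
Proof. by rewrite /ratio /= absz_gt0 denq_eq0. Qed.

Lemma ratio_leqE a b : (0 <= a)%R -> (0 <= b)%R -> ratio_leq (ratio a) (ratio b) = (a <= b)%R.
Proof.
move=> a0 b0; rewrite -[in RHS](ratio_eq a0) -[in RHS](ratio_eq b0) /ratio_leq.
have ha := ratio_den a; have hb := ratio_den b.
rewrite ler_pdivrMr ?ltr0n // mulrAC ler_pdivlMr ?ltr0n //.
by rewrite -!natrM ler_nat.
Qed.

Lemma scaledE D q : (0 <= q)%R -> (ratio q).2 %| D -> ((scaled D (ratio q))%:R = q * D%:R :> rat)%R.
Proof.
move=> q0; move: (ratio_eq q0) (ratio_den q); case: (ratio q) => a d /= <- d0 /dvdnP[k ->].
rewrite /scaled /= mulnK // !natrM -mulrA (mulrCA (d%:R^-1)%R) mulVf ?mulr1 //.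
by rewrite pnatr_eq0 -lt0n.
Qed.

Lemma denom_gt0 (l : seq (nat * nat)) : all (fun q => 0 < q.2) l -> 0 < denom l.
Proof. by elim: l => //= q l IH /andP[h1 /IH h2]; rewrite /denom /= muln_gt0 h1. Qed.

Lemma denom_dvd (l : seq (nat * nat)) q : q \in l -> q.2 %| denom l.
Proof.
elim: l => //= p l IH; rewrite inE /denom /= => /orP[/eqP->|/IH h]; first exact: dvdn_mulr.
exact: dvdn_mull.
Qed.

Section Raw.
Variables (n : nat) (I : instance 'I_n).

Definition table (f : 'I_n -> rat) := [seq ratio (f i) | i <- enum 'I_n].
Definition raw_of : raw :=
  (n, ([seq table (dist I i) | i <- enum 'I_n], (table (radius I), table (prob I)))).

Lemma tree_of_seq_map (A B : Type) (g : A -> B) (f : B -> tree) s :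
  tree_of_seq f (map g s) = tree_of_seq (fun x => f (g x)) s.
Proof. by elim: s => //= x s ->. Qed.

Lemma eq_in_tree_of_seq (A : eqType) (f g : A -> tree) s :
  {in s, f =1 g} -> tree_of_seq f s = tree_of_seq g s.
Proof.
elim: s => //= x s IH h; rewrite h ?mem_head // IH // => z zs.
by rewrite h // inE zs orbT.
Qed.

Lemma table_tree f : (forall i, 0 <= f i)%R -> encode (table f) = tree_of_fun tree_of_rat f.
Proof.
move=> h; rewrite /encode /encodable_seq /table tree_of_seq_map; apply: eq_in_tree_of_seq => i _.
exact: ratio_tree.
Qed.

Lemma raw_tree : encode raw_of = tree_of_instance I.
Proof.
rewrite /tree_of_instance /raw_of /encode /= /encodable_prod; congr Node.
rewrite /encode /=; congr Node.
  rewrite /encode /encodable_seq tree_of_seq_map; apply: eq_in_tree_of_seq => i _.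
  exact/table_tree/dist_ge0.
rewrite /encode /=; congr Node; apply: table_tree => i; last exact: prob_ge0.
exact/ltW/radius_gt0.
Qed.

Lemma nth_table d f (i : 'I_n) : nth d (table f) i = ratio (f i).
Proof. by rewrite (nth_map i) ?size_enum_ord // nth_ord_enum. Qed.

Lemma size_table f : size (table f) = n.
Proof. by rewrite size_map size_enum_ord. Qed.

Lemma table_mem f i : ratio (f i) \in table f.
Proof. by apply: map_f; rewrite mem_enum. Qed.

Lemma table_denom f : 0 < denom (table f).
Proof. by apply: denom_gt0; apply/allP => q /mapP[i _ ->]; apply: ratio_den. Qed.

Lemma table_scaled f i : (0 <= f i)%R ->
  ((scaled (denom (table f)) (ratio (f i)))%:R = f i * (denom (table f))%:R :> rat)%R.
Proof. by move=> h; apply: scaledE => //; apply/denom_dvd/table_mem. Qed.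

Let vert_of (i : 'I_n) := vertex raw_of i.

Lemma vert_class i : vclass (vert_of i) = trunc_log 2 (scaled (denom (table (radius I))) (ratio (radius I i))).
Proof. by rewrite /vclass /vert_of /= nth_table. Qed.

Lemma vert_demand i : vdemand (vert_of i) = scaled (denom (table (prob I))) (ratio (prob I i)).
Proof. by rewrite /vdemand /vert_of /= nth_table. Qed.

Lemma vert_demandE i : ((vdemand (vert_of i))%:R = prob I i * (denom (table (prob I)))%:R :> rat)%R.
Proof. by rewrite vert_demand table_scaled // prob_ge0. Qed.

Lemma vert_demand_le i : vdemand (vert_of i) <= denom (table (prob I)).
Proof.
rewrite -(ler_nat rat) vert_demandE ler_piMl ?ler0n //; exact: prob_le1.
Qed.

Lemma vert_ball (i j : 'I_n) : (val j \in vball (vert_of i)) = (dist I i j <= radius I i)%R.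
Proof.
rewrite /vball /vert_of /= mem_filter idxE size_table mem_iota leq0n add0n ltn_ord !andbT.
rewrite (nth_map i) ?size_enum_ord // nth_ord_enum !nth_table ratio_leqE ?dist_ge0 //.
exact/ltW/radius_gt0.
Qed.

Lemma vert_ball_uniq i : uniq (vball (vert_of i)).
Proof. by rewrite filter_uniq // idxE iota_uniq. Qed.

Lemma vert_ball_lt i z : z \in vball (vert_of i) -> z < n.
Proof. by rewrite mem_filter idxE size_table mem_iota => /andP[]. Qed.

Lemma verticesP v : reflect (exists i, v = vert_of i) (v \in vertices raw_of).
Proof.
apply: (iffP mapP) => [[k]|[i ->]].
  by rewrite idxE size_table mem_iota => kn ->; exists (Ordinal kn).
by exists (val i) => //; rewrite idxE size_table mem_iota ltn_ord.
Qed.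

Lemma vert_self i : vid (vert_of i) \in vball (vert_of i).
Proof. by rewrite vert_ball (dist_eq0 I i i).2 // ltW // radius_gt0. Qed.

Lemma vertices_uniq : uniq [seq vid v | v <- vertices raw_of].
Proof. by rewrite -map_comp map_id idxE iota_uniq. Qed.

Lemma reps_vertices_ok : vertices_ok n (reps (vertices raw_of)).
Proof.
have self v : v \in vertices raw_of -> vid v \in vball v.
  by move=> /verticesP[i ->]; apply: vert_self.
split.
- exact: reps_uniq vertices_uniq self.
- by move=> v /(reps_sub self)/verticesP[i ->]; apply: ltn_ord.
- by move=> v /(reps_sub self)/verticesP[i ->]; apply: vert_ball_uniq.
- by move=> v z /(reps_sub self)/verticesP[i ->]; apply: vert_ball_lt.
- by move=> v /(reps_sub self); apply: self.
- exact: reps_sep vertices_uniq self.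
Qed.

Lemma prepare_ok (F : {set {set 'I_n}}) : matroid F -> prep_ok (family_oracle F) (prepare raw_of).
Proof.
move=> hF; split; [exact: reps_vertices_ok|exact: oracle_matroid|].
have self v : v \in vertices raw_of -> vid v \in vball v.
  by move=> /verticesP[i ->]; apply: vert_self.
by move=> v /(reps_sub self)/verticesP[i ->]; apply: vert_demand_le.
Qed.

Local Open Scope ring_scope.
Let Dr : rat := (denom (table (radius I)))%:R.

(** Distances are scaled by the common denominator of the radii, which turns the radii into the
    naturals [rho]. Indices out of range get the default 0. *)
Definition delta (x y : nat) : rat :=
  if (insub x, insub y) is (Some i, Some j) then dist I i j * Dr else 0.
Definition rho (v : vert) : nat := scaled (denom (table (radius I))) (nth (0, 1)%N (table (radius I)) (vid v)).

Lemma deltaE (i j : 'I_n) : delta i j = dist I i j * Dr.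
Proof. by rewrite /delta !valK. Qed.

Lemma rhoE i : (rho (vert_of i))%:R = radius I i * Dr.
Proof. by rewrite /rho /vid /= nth_table table_scaled // ltW // radius_gt0. Qed.

Lemma Dr_gt0 : 0 < Dr. Proof. by rewrite ltr0n table_denom. Qed.

Lemma vertices_cover (J : seq elt) (i : 'I_n) v e : uniq [seq e.2 | e <- J] ->
  (forall w, w \in reps (vertices raw_of) ->
    has (fun e => e \in idle n w :: serve n (reps (vertices raw_of)) w) J) ->
  v \in reps (vertices raw_of) -> conflict v (vert_of i) ->
  e \in J -> e \in serve n (reps (vertices raw_of)) v ->
  exists2 k : 'I_n, val k \in stations n J & dist I i k <= 9 * radius I i.
Proof.
have self w : w \in vertices raw_of -> vid w \in vball w.
  by move=> /verticesP[j ->]; apply: vert_self.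
move=> uJ one hv hc eJ es.
have [//|||||||k kJ] := @cover_delta n (vertices raw_of) delta rho _ _ vertices_uniq _ _ _ _
  (reps (vertices raw_of)) (reps_sub self) J uJ one (vert_of i) v e _ hv hc eJ es.
- by move=> x y xn yn; rewrite (deltaE (Ordinal xn) (Ordinal yn)) (deltaE (Ordinal yn) (Ordinal xn)) dist_sym.
- move=> x y z xn yn zn.
  rewrite (deltaE (Ordinal xn) (Ordinal yn)) (deltaE (Ordinal yn) (Ordinal zn)).
  rewrite (deltaE (Ordinal xn) (Ordinal zn)) -mulrDl ler_pM2r ?Dr_gt0 //.
  exact: dist_triangle.
- by move=> w /verticesP[j ->]; apply: ltn_ord.
- by move=> w z /verticesP[j ->]; apply: vert_ball_lt.
- move=> w z /verticesP[j ->] hz; have zn := vert_ball_lt hz.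
  rewrite (deltaE j (Ordinal zn)) rhoE ler_pM2r ?Dr_gt0 //.
  by rewrite -vert_ball.
- move=> w /verticesP[j ->]; rewrite vert_class /rho /vid /= nth_table.
  rewrite trunc_logP ?trunc_log_ltn //.
  by rewrite -(ltr0n rat) table_scaled ?mulr_gt0 ?Dr_gt0 ?radius_gt0 // ltW // radius_gt0.
- by apply/verticesP; exists i.
move: (kJ); rewrite mem_stations => /andP[kn _].
rewrite (deltaE i (Ordinal kn)) rhoE mulrA ler_pM2r ?Dr_gt0 // => h.
by exists (Ordinal kn).
Qed.
End Raw.

Local Open Scope ring_scope.

Lemma dist_setP (X : finType) (I : instance X) v (S : {set X}) r :
  reflect (exists2 s, s \in S & dist I v s <= r) (dist_set I v S <= r%:E)%E.
Proof.
rewrite /dist_set; apply: (iffP idP) => [h|[s sS h]]; last first.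
  by apply: le_trans (bigmin_le_cond _ _ sS) _; rewrite lee_fin.
case: (boolP [exists s in S, dist I v s <= r]) => [/existsP[s /andP[]]|hno]; first by exists s.
have : (r%:E < \big[Order.min/+oo]_(s in S) (dist I v s)%:E)%E.
  apply: lt_bigmin => [|s sS]; first exact: ltry.
  rewrite lte_fin ltNge; apply: contra hno => hs; apply/existsP; exists s; exact/andP.
by rewrite ltNge h.
Qed.

(** * Both answers are correct *)

Section Correctness.
Variables (R : realType) (n : nat) (I : instance 'I_n) (F : {set {set 'I_n}}).
Hypothesis hF : matroid F.
Let O := family_oracle F.
Let y := prepare (raw_of I).
Let ws := reps (vertices (raw_of I)).
Let D := denom (table (prob I)).
Let st := solve O y.

Let self v : v \in vertices (raw_of I) -> vid v \in vball v.
Proof. by move=> /verticesP[i ->]; apply: vert_self. Qed.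

Let D0 : (0 < D)%N. Proof. exact: table_denom. Qed.

Lemma demand_real (i : 'I_n) : (vdemand (vertex (raw_of I) i))%:R = ratr (prob I i) * D%:R :> R.
Proof.
by rewrite -(ratr_nat R (vdemand _)) (vert_demandE I i) rmorphM /= ratr_nat.
Qed.

Definition members (S : {set 'I_n}) := [seq val j | j <- enum S].

Lemma members_feasible S : S \in F ->
  forall t, uniq t -> {subset t <= members S} -> feasible O t.
Proof.
case: hF => _ h _ hS t _ ts; rewrite family_oracleE; apply: h hS.
apply/subsetP => i; rewrite inE => /ts/mapP[j]; rewrite mem_enum => jS /val_inj -> //.
Qed.

Lemma ball_members (i : 'I_n) S : has (fun z => z \in members S) (vball (vertex (raw_of I) i)) =
  (dist_set I i S <= (1 * radius I i)%:E)%E.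
Proof.
rewrite mul1r; apply/hasP/dist_setP => [[z zb /mapP[j]]|[j jS hj]].
  by rewrite mem_enum => jS e; exists j => //; rewrite -(vert_ball I i j) -e.
exists (val j); first by rewrite vert_ball.
by apply: map_f; rewrite mem_enum.
Qed.

(** The inequality of [unsolved_violated] is averaged over a hypothetical lottery. The probability
    demands bound the average contribution of every kept vertex from below by its share of the
    right-hand side, a contradiction. *)
Lemma unsolved_infeasible : ~~ solved st.1 -> ~ exists mu : {set 'I_n} -> R, approximate I F 1 mu.
Proof.
move=> un [mu [[mu0 muF mu1] hmu]].
have [h1 h2 h3] := prepare_ok I hF.
have [s [i hv]] := unsolved_violated h1 h2 un.
pose b v S := nat_of_bool (if s v && has (fun z => z \in members S) (vball v) then true else i v).
pose q v := (s v * vdemand v + i v * (D - vdemand v))%N.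
pose Q := sumn [seq q v | v <- ws].
(* A strict inequality between naturals leaves a gap of 1, which survives averaging. *)
have hS S : mu S * (D * sumn [seq b v S | v <- ws])%:R <= mu S * (Q%:R - 1).
  case: (boolP (S \in F)) => [SF|/muF ->]; last by rewrite !mul0r.
  apply: ler_wpM2l => //; rewrite lerBrDr natr1 ler_nat.
  exact: (hv (members S) (members_feasible SF)).
have : \sum_S mu S * (D * sumn [seq b v S | v <- ws])%:R <= Q%:R - 1.
  by apply: le_trans (ler_sum _ (fun S _ => hS S)) _; rewrite -mulr_suml mu1 mul1r.
have -> : \sum_S mu S * (D * sumn [seq b v S | v <- ws])%:R =
    \sum_(v <- ws) D%:R * \sum_S mu S * (b v S)%:R.
  rewrite -mulr_sumr exchange_big /= mulr_sumr; apply: eq_bigr => S _.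
  by rewrite natrM sumnE big_map natr_sum -mulr_sumr mulrCA.
have hq : Q%:R = \sum_(v <- ws) (q v)%:R :> R by rewrite /Q sumnE big_map natr_sum.
suff : \sum_(v <- ws) (q v)%:R <= \sum_(v <- ws) D%:R * \sum_S mu S * (b v S)%:R.
  by rewrite -hq => k1 k2; have := le_trans k1 k2; rewrite lerBrDl gerDr ler10.
rewrite big_seq [leRHS]big_seq; apply: ler_sum => v /(reps_sub self)/verticesP[k ->] {v}.
set v := vertex _ _.
have dle : (vdemand v <= D)%N by apply: vert_demand_le.
have all1 : (forall S, b v S = 1)%N -> D%:R * \sum_S mu S * (b v S)%:R = D%:R.
  by move=> h; rewrite (eq_bigr mu) ?mu1 ?mulr1 // => S _; rewrite h mulr1.
rewrite /q; case es: (s v); case ei: (i v); rewrite ?mul1n ?mul0n ?addn0 ?add0n.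
- rewrite all1 ?subnKC // => S; by rewrite /b es ei; case: (has _ _).
- rewrite demand_real mulrC ler_pM2l ?ltr0n //; apply: le_trans (hmu k) _.
  rewrite /Pr big_mkcond /=; apply: ler_sum => S _; rewrite /b es ei ball_members.
  by case: ifP => _; rewrite ?mulr1 ?mulr0.
- by rewrite all1 ?ler_nat ?leq_subr // => S; rewrite /b es ei.
- by rewrite mulr_ge0 ?ler0n // sumr_ge0 // => S _; rewrite mulr_ge0 ?ler0n.
Qed.

Section Sampler.
Hypothesis ok : solved st.1.
Let out := sampler O y.
Let E := flatten (blocks n ws).
Let sch := schedule n (size ws) (feasible O).

Lemma sampler_ok :
  (forall c, c \in out -> indep E sch c.1 /\
     forall Q, Q \in blocks n ws -> size [seq x <- c.1 | x \in Q] = 1%N) /\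
  exists2 s, (0 < s)%N & mass out = (s * D)%N /\
    forall v, v \in ws -> cov out (serve n ws v) = (s * vdemand v)%N.
Proof.
have [h1 h2 h3] := prepare_ok I hF.
have [b1 b2 b3] := blocks_ok h1 h2.
have [c1 c2] := solve_ok h1 h2 h3 ok.
have [d1 [s s0 [d2 d3]]] := decompose_ok b1 b2 b3 c1 c2.
split=> //; exists s => //.
have hm : mass out = (s * D)%N by rewrite [LHS]d2 (solve_mass D h1 h2).
split=> // v hv; have [e1 e2] := solve_cov h1 h2 ok hv.
have hB : (idle n v :: serve n ws v) \in blocks n ws by apply: (map_f (fun v => idle n v :: serve n ws v)).
have tot : cov out (idle n v :: serve n ws v) = mass out.
  rewrite /cov /mass; congr sumn; apply/eq_in_map => c /d1[_ /(_ _ hB) ->].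
  by rewrite muln1.
have he : idle n v \in E by apply/flattenP; exists (idle n v :: serve n ws v); rewrite ?mem_head.
have := @cov_flatten _ out [:: [:: idle n v]; serve n ws v].
rewrite [flatten _]/= cats0 tot /= addn0 -[cov _ [:: _]]/(wt out (idle n v)) d3 // e2 hm => hc.
have {}hc : (s * D = s * (D - vdemand v) + cov out (serve n ws v))%N.
  by apply: hc; case: h1 => f1 f2 f3 f4 _ _; apply: serve_uniq.
have := h3 v hv; rewrite -/D => le; apply/eqP; rewrite -(eqn_add2l (s * (D - vdemand v))%N) -hc.
by rewrite -mulnDr subnK.
Qed.

Definition ords (s : seq nat) : seq 'I_n := pmap insub s.

Lemma val_ords s : (forall k, k \in s -> (k < n)%N) -> [seq val i | i <- ords s] = s.
Proof.
move=> h; rewrite /ords (pmap_filter (insubK _)).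
by apply/all_filterP/allP => k /h kn; rewrite insubT.
Qed.

Lemma points_ords s : [set i in ords s] = points n s.
Proof. by apply/setP => i; rewrite !inE mem_pmap_sub. Qed.

Definition outcome : seq (seq 'I_n * rat) :=
  [seq (ords (stations n c.1), c.2%:R / (mass out)%:R) | c <- out].

Lemma mass_gt0 : (0 < mass out)%N.
Proof. by have [_ [s s0 [-> _]]] := sampler_ok; rewrite muln_gt0 s0. Qed.

Lemma fraction_tree a b : (a <= b)%N -> (0 < b)%N ->
  tree_of_rat (a%:R / b%:R) = encode (a %/ weight_gcd b a, b %/ weight_gcd b a)%N.
Proof.
move=> ab b0; rewrite weight_gcdE //; set g := gcdn b a.
have g0 : (0 < g)%N by rewrite gcdn_gt0 b0.
have ga : (g %| a)%N by apply: dvdn_gcdr.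
have gb : (g %| b)%N by apply: dvdn_gcdl.
have b0' : (0 < b %/ g)%N by rewrite divn_gt0 // dvdn_leq.
have -> : a%:R / b%:R = (a %/ g)%N%:Z%:~R / (b %/ g)%N%:Z%:~R :> rat.
  rewrite -!pmulrn -{1}(divnK ga) -{1}(divnK gb) !natrM -mulf_div divff ?mulr1 //.
  by rewrite pnatr_eq0 -lt0n.
have cop : coprime (a %/ g) (b %/ g).
  by rewrite coprime_sym /coprime -(eqn_pmul2r g0) mul1n muln_gcdl !divnK.
rewrite /tree_of_rat coprimeq_num // coprimeq_den // eqz_nat (gtn_eqF b0') gtr0_sg ?mul1r //.
Qed.

Lemma weight_sum (P : pred (class elt)) :
  \sum_(c <- out | P c) ratr (c.2%:R / (mass out)%:R : rat) =
  (\sum_(c <- out | P c) c.2)%N%:R / (mass out)%:R :> R.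
Proof.
rewrite natr_sum mulr_suml; apply: eq_bigr => c _.
by rewrite fmorph_div /= !ratr_nat.
Qed.

Lemma lottery_sum (E' : pred {set 'I_n}) : Pr (lottery_of R outcome) E' =
  (\sum_(c <- out | E' (points n (stations n c.1))) c.2)%N%:R / (mass out)%:R.
Proof.
rewrite -weight_sum /Pr /lottery_of.
rewrite (exchange_big_dep xpredT) //= /outcome big_map [RHS]big_mkcond /=.
apply: eq_bigr => c _; rewrite points_ords.
case: ifP => hE.
  rewrite (bigD1 (points n (stations n c.1))) /= ?hE ?eqxx // big1 ?addr0 //.
  by move=> S /andP[/andP[_ /eqP->]]; rewrite eqxx.
by rewrite big1 // => S /andP[hS /eqP e]; rewrite e hS in hE.
Qed.

Lemma outcome_tree :
  tree_of_answer (Some outcome) = answer_tree O y.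
Proof.
rewrite /answer_tree -/st ok /tree_of_answer /encode /=; congr Node.
rewrite /encode /encodable_seq /outcome /report !tree_of_seq_map.
apply: eq_in_tree_of_seq => c hc; rewrite [RHS]/encode /=; congr Node.
  rewrite /encode /encodable_seq -[in RHS](val_ords (s := stations n c.1)) ?tree_of_seq_map //.
  by move=> k; rewrite mem_stations => /andP[].
by apply: fraction_tree; [exact: mass_ge|exact: mass_gt0].
Qed.

Lemma outcome_mu S : lottery_of R outcome S =
  (\sum_(c <- out | points n (stations n c.1) == S) c.2)%N%:R / (mass out)%:R.
Proof. by rewrite -(lottery_sum (pred1 S)) /Pr big_pred1_eq. Qed.

Lemma block_one c w : c \in out -> w \in ws ->
  size [seq x <- c.1 | x \in idle n w :: serve n ws w] = 1%N.
Proof.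
move=> hc hw; have [h _] := sampler_ok; have [_ h1] := h c hc; apply: h1.
exact: (map_f (fun v => idle n v :: serve n ws v)).
Qed.

(** A class that serves [v] has a station within [9 r] of [i], and it serves [v] only once. The
    chain argument requires that the class meets the block of every kept vertex, which is why
    transversals were produced. *)
Lemma cov_le_good (i : 'I_n) v : v \in ws -> conflict v (vertex (raw_of I) i) ->
  (cov out (serve n ws v) <=
   \sum_(c <- out | (dist_set I i (points n (stations n c.1)) <= (9 * radius I i)%:E)%E) c.2)%N.
Proof.
move=> hv hc; rewrite /cov sumnE big_map [leqRHS]big_mkcond big_seq [leqRHS]big_seq /=.
apply: leq_sum => c c_out; have [h _] := sampler_ok; have [[_ _ /and3P[_ uc _]] _] := h c c_out.
have one := block_one c_out hv.
have le1 : (size [seq x <- c.1 | x \in serve n ws v] <= 1)%N.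
  rewrite -[leqRHS]one !size_filter; apply: sub_count => x /= hx.
  by rewrite inE hx orbT.
case: ifPn => [_|no]; first by rewrite -{2}(muln1 c.2) leq_mul2l le1 orbT.
rewrite (_ : [seq x <- c.1 | x \in serve n ws v] = [::]) ?muln0 //.
apply/eqP; rewrite -[_ == _]negbK -has_filter; apply: contra no => /hasP[e ec es].
have [k kJ hk] : exists2 k : 'I_n, val k \in stations n c.1 & dist I i k <= 9 * radius I i.
  apply: (vertices_cover uc _ hv hc ec es) => w hw.
  by rewrite has_filter -size_eq0 block_one.
by apply/dist_setP; exists k; rewrite // inE.
Qed.

Lemma outcome_ok : approximate I F 9 (lottery_of R outcome).
Proof.
have [h1 [s s0 [hm hc]]] := sampler_ok; have m0 := mass_gt0.
have m0R : (0 : R) < (mass out)%:R by rewrite ltr0n.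
split; first split.
- by move=> S; rewrite outcome_mu divr_ge0 ?ler0n.
- move=> S SF; rewrite outcome_mu big1_seq ?mul0r // => c /andP[/eqP e hcc].
  have [[_ _ /and3P[_ _ hf]] _] := h1 c hcc.
  by rewrite -/O family_oracleE e (negbTE SF) in hf.
- rewrite -[LHS]/(Pr (lottery_of R outcome) predT) lottery_sum /=.
  by rewrite /mass sumnE big_map divff // lt0r_neq0 // -(big_map snd predT id) -sumnE.
move=> i; rewrite lottery_sum ler_pdivlMr // hm natrM mulrCA -demand_real -natrM ler_nat.
have hi : vertex (raw_of I) i \in vertices (raw_of I) by apply/verticesP; exists i.
have [v hv [hcf le]] := reps_cover self hi.
apply: leq_trans (cov_le_good hv hcf); rewrite hc // leq_mul2l le orbT //.
Qed.
End Sampler.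
End Correctness.

Theorem theorem6p3 (R : realType) :
  exists p : program,
    polytime_approximation R (fun n (F : {set {set 'I_n}}) => matroid F) 9 p.
Proof.
pose P (O : oracle) (x : raw) := prep_ok O (prepare x).
have : ptime P (fun O x => answer_tree O (prepare x)).
  by apply: ptime_comp (ptime_sub _ ptime_prepare) ptime_answer_tree _.
move=> [p [k hp]]; exists p, ('X^k)%R => n I F hF.
have [t ht tk] := hp (family_oracle F) (raw_of I) (prepare_ok I hF).
rewrite raw_tree /esize raw_tree in ht tk.
case: (boolP (solved (solve (family_oracle F) (prepare (raw_of I))).1)) => ok.
  exists (Some (outcome I F)), t; split; [|by rewrite hornerXn|exact: outcome_ok].
  by rewrite outcome_tree.
exists None, t; split; [|by rewrite hornerXn|exact: unsolved_infeasible].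
by move: ht; rewrite /answer_tree (negbTE ok).
Qed.
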